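(* Consider the second order ordinary differential equation for a function $f\colon\mathbb{R}\to\mathbb{R}$ $$ a(x)f''(x)+b(x)f'(x)+(c(x)-\lambda)f(x)=-g(x)\quad\text{for all }x\in\mathbb{R}, $$ where the functions $a,b,c,g\colon \mathbb{R}\to \mathbb{R}$ and the number $\lambda$ are known parameters. Assume that there exists a constant $a_0>0$ such that $a(x)>a_0$ for all $x\in \mathbb{R}$. Assume that there exists $\beta\in(0,1]$ such that $c$ is bounded and Hölder continuous with Hölder exponent $\beta$, and the functions $a$, $x\mapsto 1/a(x)$, $b$ are, together with their derivatives of order one and two, bounded and Hölder continuous with Hölder exponent $\beta$. Assume that $g$ is continuous and vanishes at infinity. Assume that $\lambda\in\mathbb{R}$ and $\lambda>\max(0,\sup_{x\in\mathbb{R}}c(x))$. Then the equation has a unique continuous and vanishing at infinity solution $f$, and it is given for all $x_0\in\mathbb{R}$ by the formula $$ f(x_0)=\lim_{n\to\infty}\int_0^\infty e^{-\lambda t}\Bigg[\underbrace{\int_{\mathbb{R}}\dots\int_{\mathbb{R}}}_n \exp\left(\frac{t}{n}\sum_{j=1}^n\left(c(x_{j-1})-\frac{b(x_{j-1})^2}{4a(x_{j-1})}\right)\right) \exp\left(\sum_{j=1}^n\frac{b(x_{j-1})(x_j-x_{j-1})}{2a(x_{j-1})} \right)\times $$ $$ \times\left(\frac{\sqrt{n}}{\sqrt{4\pi t}}\right)^n\left(\prod_{j=0}^{n-1}a(x_j)\right)^{-1/2}\exp\left(-\frac{n}{4t}\sum_{j=0}^{n-1}\frac{(x_j-x_{j+1})^2}{a(x_j)}\right)g(x_n)\,dx_1\dots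 dx_n\Bigg] dt, $$ where the limit as $n\to\infty$ exists uniformly in $x_0\in\mathbb{R}$.
   Context: A function $f\colon\mathbb{R}\to\mathbb{R}$ vanishes at infinity if $\lim_{|x|\to\infty}f(x)=0$. A solution is a twice differentiable function satisfying the equation at every $x\in\mathbb{R}$. *)

(* Defs.v *)
From HB Require Import structures.
From mathcomp Require Import all_boot all_order all_algebra.
From mathcomp Require Import all_classical all_reals all_analysis.

Set Implicit Arguments.
Unset Strict Implicit.
Unset Printing Implicit Defensive.

Import Order.TTheory GRing.Theory Num.Theory.
Import numFieldNormedType.Exports.

Local Open Scope ring_scope.
Local Open Scope classical_set_scope.

Section ode.
Context {R : realType}.
Implicit Types (f a b c g : R -> R) (beta lambda : R).

Definition vanishes_at_infinity f : Prop :=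
  forall e : R, 0 < e ->
    exists M : R, forall x : R, M < `|x| -> `|f x| < e.

Definition twice_differentiable f : Prop :=
  (forall x : R, derivable f x 1) /\ (forall x : R, derivable f^`() x 1).

Definition hoelder_continuous beta f : Prop :=
  exists K : R, forall x y : R, `|f x - f y| <= K * `|x - y| `^ beta.

Definition bounded_hoelder beta f : Prop :=
  bounded_fun f /\ hoelder_continuous beta f.

Definition bounded_hoelder2 beta f : Prop :=
  [/\ twice_differentiable f, bounded_hoelder beta f,
      bounded_hoelder beta f^`() & bounded_hoelder beta f^`(2)].

Definition is_solution a b c g lambda f : Prop :=
  twice_differentiable f /\
  forall x : R, a x * f^`(2)%classic x + b x * f^`()%classic x
                + (c x - lambda) * f x = - g x.

(* The n-fold integral of F [:: x_1; ...; x_n] against dx_1 ... dx_n, as an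
   iterated Lebesgue integral whose outermost variable is x_1. *)
Fixpoint iter_integral (n : nat) (F : seq R -> \bar R) : \bar R :=
  if n is n'.+1 then
    (\int[lebesgue_measure]_(y in setT)
       iter_integral n' (fun s => F (y :: s)))%E
  else F [::].

(* The integrand of the n-fold integral; x = [:: x_0; x_1; ...; x_n], so that
   x`_j is x_j. *)
Definition feynman_integrand a b c g (n : nat) (t : R) (x : seq R) : R :=
  expR (t / n%:R *
    \sum_(1 <= j < n.+1)
       (c x`_j.-1 - b x`_j.-1 ^+ 2 / (4 * a x`_j.-1)))
  * expR (\sum_(1 <= j < n.+1)
       b x`_j.-1 * (x`_j - x`_j.-1) / (2 * a x`_j.-1))
  * (Num.sqrt n%:R / Num.sqrt (4 * pi * t)) ^+ n
  * (\prod_(0 <= j < n) a x`_j) `^ (- 2^-1)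
  * expR (- (n%:R / (4 * t)) *
       \sum_(0 <= j < n) (x`_j - x`_j.+1) ^+ 2 / a x`_j)
  * g x`_n.

Definition feynman_integral a b c g (n : nat) (t x0 : R) : \bar R :=
  iter_integral n (fun s => (feynman_integrand a b c g n t (x0 :: s))%:E).

Definition feynman_abs_integral a b c g (n : nat) (t x0 : R) : \bar R :=
  iter_integral n (fun s => `|feynman_integrand a b c g n t (x0 :: s)|%:E).

Definition laplace_integrand a b c g lambda (n : nat) (x0 t : R) : \bar R :=
  ((expR (- lambda * t))%:E * feynman_integral a b c g n t x0)%E.

Definition chernoff_approximation a b c g lambda (n : nat) (x0 : R) : R :=
  fine (\int[lebesgue_measure]_(t in `]0%R, +oo[)
          laplace_integrand a b c g lambda n x0 t)%E.

(* Absolute convergence of all the integrals in the n-th approximation, which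
   makes the iterated integral independent of the order of integration and the
   use of fine in chernoff_approximation harmless. *)
Definition chernoff_approximation_exists a b c g lambda
    (n : nat) (x0 : R) : Prop :=
  (forall t : R, 0 < t -> (feynman_abs_integral a b c g n t x0 < +oo)%E) /\
  lebesgue_measure.-integrable `]0%R, +oo[
    (laplace_integrand a b c g lambda n x0).

End ode.

(* Main.v *)
Require Import Defs.
From HB Require Import structures.
From mathcomp Require Import all_boot all_order all_algebra.
From mathcomp Require Import all_classical all_reals all_analysis measurable_realfun.
From mathcomp Require Import ring lra.

Set Implicit Arguments.
Unset Strict Implicit.
Unset Printing Implicit Defensive.

Import Order.TTheory GRing.Theory Num.Theory.
Import numFieldNormedType.Exports.

Local Open Scope ring_scope.
Local Open Scope classical_set_scope.

(* After subtracting [omega = sup c] from [c] and from [lambda] one may assume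
   [c <= 0 < lambda]. Let [L v = a v'' + b v' + c v], acting on continuous
   functions vanishing at infinity. The maximum principle makes
   [lambda - L] injective with inverse bounded by [1 / lambda]; for large
   [lambda] surjectivity is a contraction argument around [v'' - m^2 v], and a
   Neumann series gives all [lambda > 0]. In particular the implicit Euler steps
   [J_s = (1 - s L)^-1] are contractions commuting with [L].

   The n-fold integral is [S_(t/n)^n g], where [S_s v (x)] is [e^(s c(x))] times
   the mean of [v] under the normal law of mean [x + s b(x)] and variance
   [2 s a(x)]. Instead of comparing [S_(t/n)^n] with a semigroup, which would
   have to be constructed, it is compared with [J_(t/n)^n]: for [v] in the domain
   of [L^2], a Taylor expansion gives [S_s v - v - s L v = o(s)], with a rate
   depending only on bounds for [v], [L v] and [L^2 v]; these bounds are preserved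
   by [J_s], and [S_s] is a contraction, so the errors telescope to
   [S_(t/n)^n v - J_(t/n)^n v = t o(1)].
   Since [d/dt J_(t/n)^n h = J_(t/n)^(n+1) L h], integrating the derivative of
   [e^(-lambda t) J_(t/n)^n h] shows that the Laplace transform of
   [J_(t/n)^n (lambda h - L h)] is [h + O(1/n)]. This proves the convergence for
   [g] in the domain of [L^2], which is dense; both sides are bounded in [g] by
   [1 / lambda]. *)

(** * Derivatives, mean values and the maximum principle on the line *)

Section calculus.
Context {R : realType}.
Implicit Types (f g h p q : R -> R) (x y : R).

(** The obstacle is uniformity in the number of steps. The one-step error is evaluated at [J_s^k v]
    for every [k], and of these functions only the sup norms of their images under [I], [L] and
    [L^2] are under control. All information on derivatives is therefore recovered from the
    equation: [derivative_bound] controls [v'] and [v''] by the sup norms of [v] and [L v], and the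
    continuity of [v''] is read off from [a v'' = L v - b v' - c v], where [L v] is Lipschitz
    because it lies in the domain as well. Hence [L^2] for the data, and a third power for [h],
    since [lambda h - L h] has to lie in the domain of [L^2]. The coefficients enter through
    [modulus], the bounds [e + K |x - y|] for every [e > 0]. Such a bound passes to [v''] and leads
    to Gaussian moments of order at most four; an error [o(s)] thus takes the form [s (e + D s)]
    with [e] arbitrary. The normal law itself comes from completing the square in the exponents of
    the n-fold integral. *)

(** The derivative is a separate function, so that it can be given by a formula and rewritten with
    [has_derivative_eq]. *)
Definition has_derivative f p := forall x : R, is_derive x (1 : R) f (p x).

Lemma has_derivative_continuous f p : has_derivative f p -> continuous f.
Proof.
move=> fp x; apply/differentiable_continuous/derivable1_diffP.
by have [] := fp x.
Qed.

Lemma has_derivativeD f g p q : has_derivative f p -> has_derivative g q ->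
  has_derivative (fun x => f x + g x) (fun x => p x + q x).
Proof. by move=> fp gq x; have := fp x; have := gq x => ? ?; exact: is_deriveD. Qed.

Lemma has_derivativeB f g p q : has_derivative f p -> has_derivative g q ->
  has_derivative (fun x => f x - g x) (fun x => p x - q x).
Proof. by move=> fp gq x; have := fp x; have := gq x => ? ?; exact: is_deriveB. Qed.

Lemma has_derivativeZ k f p : has_derivative f p ->
  has_derivative (fun x => k * f x) (fun x => k * p x).
Proof. by move=> fp x; have := fp x => ?; exact: is_deriveZ. Qed.

Lemma has_derivativeM f g p q : has_derivative f p -> has_derivative g q ->
  has_derivative (fun x => f x * g x) (fun x => p x * g x + f x * q x).
Proof.
move=> fp gq x; have := fp x; have := gq x => ? ?.
by apply: is_derive_eq; rewrite /GRing.scale/=; ring.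
Qed.

Lemma has_derivative_comp f g p q : has_derivative f p -> has_derivative g q ->
  has_derivative (fun x => f (g x)) (fun x => p (g x) * q x).
Proof.
move=> fp gq x; have := fp (g x); have := gq x => ? ?.
exact: is_derive1_comp.
Qed.

Lemma has_derivative_cst (k : R) : has_derivative (fun=> k) (fun=> 0).
Proof. by move=> x; exact: is_derive_cst. Qed.

Lemma has_derivative_id : has_derivative (fun x => x) (fun=> 1).
Proof. by move=> x; exact: is_derive_id. Qed.

Lemma has_derivative_exp (k : R) :
  has_derivative (fun x => expR (k * x)) (fun x => k * expR (k * x)).
Proof.
move=> x; have H : is_derive x 1 (fun x => k * x) k.
  by have := has_derivativeZ k has_derivative_id x; rewrite mulr1.
have := @is_derive1_comp R expR (fun x => k * x) x _ _ (is_derive_expR _) H.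
by rewrite mulrC.
Qed.

Lemma has_derivative_eq f p q : has_derivative f p -> p =1 q ->
  has_derivative f q.
Proof. by move=> + /funext <-. Qed.

Lemma mean_value f p x y : has_derivative f p -> x < y ->
  exists2 z, x < z < y & f y - f x = p z * (y - x).
Proof.
move=> fp xy.
have [z] := MVT xy (fun t _ => fp t)
  (continuous_subspaceT (has_derivative_continuous fp)).
by rewrite in_itv/= => xzy e; exists z.
Qed.

Lemma mean_value_sym f p x y : has_derivative f p ->
  exists2 z, `|z - x| <= `|y - x| & f y - f x = p z * (y - x).
Proof.
move=> fp; have [xy|yx|<-] := ltgtP x y.
- have [z /andP[xz zy] e] := mean_value fp xy; exists z => //.
  by rewrite !gtr0_norm ?subr_gt0// lerB// ltW.
- have [z /andP[yz zx] e] := mean_value fp yx; exists z.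
    by rewrite !ltr0_norm ?subr_lt0// lerN2 lerB// ltW.
  by rewrite -(opprB (f x)) e -(opprB x) mulrN.
- by exists x => //; rewrite !subrr mulr0.
Qed.

Lemma lipschitz_of_derivative f p (B : R) : has_derivative f p ->
  (forall x, `|p x| <= B) -> forall x y, `|f x - f y| <= B * `|x - y|.
Proof.
move=> fp pB x y; have [z _ ->] := mean_value_sym y x fp.
by rewrite normrM ler_wpM2r.
Qed.

Lemma derivative_ge0_le f p x y : has_derivative f p -> x <= y ->
  (forall z, x < z < y -> 0 <= p z) -> f x <= f y.
Proof.
rewrite le_eqVlt => fp /predU1P[<-//|xy] p0.
have [z xzy e] := mean_value fp xy.
by rewrite -subr_ge0 e mulr_ge0 ?p0// subr_ge0 ltW.
Qed.

Lemma derivative_gt0_near f p x : is_derive x (1 : R) f (p x) -> 0 < p x ->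
  exists2 d, 0 < d & forall y, x < y < x + d -> f x < f y.
Proof.
move=> [df dfx] px0.
have H : h^-1 *: (f (h *: 1 + x) - f x) @[h --> 0^'] --> p x.
  by rewrite -dfx; exact: df.
have : \forall h \near (0 : R)^', 0 < h^-1 *: (f (h *: 1 + x) - f x).
  exact: (@cvgr_gt _ _ _ _ _ _ H).
move=> [d /= d0 dP]; exists d => // y /andP[xy yx].
have y0 : 0 < y - x by rewrite subr_gt0.
have := dP (y - x).
rewrite /= sub0r normrN gtr0_norm// ltrBlDl gt_eqF// => /(_ yx isT).
rewrite /GRing.scale /= mulr1 subrK pmulr_rgt0 ?invr_gt0//.
by rewrite subr_gt0.
Qed.

Lemma interior_max f p x : is_derive x (1 : R) f (p x) ->
  (forall y, f y <= f x) -> p x = 0.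
Proof.
move=> fp fmax.
have [p0|p0|//] := ltgtP (p x) 0.
(* The reflection [y |-> - y] turns a negative slope at [x] into a positive one at [- x]. *)
- have fp' : is_derive (- x) (1 : R) (fun y => f (- y)) (- p x).
    have H : is_derive (- x) (1:R) (fun y : R => - y) (- 1).
      exact: is_deriveNid.
    have := fp; rewrite -{1}(opprK x) => fp'.
    have := @is_derive1_comp R f -%R (- x) _ _ fp' H.
    by rewrite mulrN mulr1.
  have np0 : 0 < - p x by lra.
  have [d d0 dP] := @derivative_gt0_near _ (fun=> - p x) (- x) fp' np0.
  have xd : - x < - x + d / 2 < - x + d by lra.
  have := dP _ xd.
  by rewrite opprK => /lt_le_trans/(_ (fmax _)); rewrite ltxx.
- have [d d0 dP] := derivative_gt0_near fp p0.
  have xd : x < x + d / 2 < x + d by lra.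
  have := dP _ xd.
  by move=> /lt_le_trans/(_ (fmax _)); rewrite ltxx.
Qed.

(* At a maximum the derivative vanishes; if moreover the second derivative were
   positive there, the function would increase to the right of it. *)
Lemma interior_max2 f p q x : has_derivative f p ->
  is_derive x (1 : R) p (q x) -> (forall y, f y <= f x) -> q x <= 0.
Proof.
move=> fp pq fmax; rewrite leNgt; apply/negP => q0.
have [d d0 dP] := derivative_gt0_near pq q0.
have px0 := interior_max (fp x) fmax.
have xd : x < x + d / 2 by lra.
have [z /andP[xz zx] e] := mean_value fp xd.
have pz : 0 < p z by rewrite -px0 dP// xz/=; lra.
have := fmax (x + d / 2); rewrite leNgt => /negP; apply.
by rewrite -subr_gt0 e mulr_gt0// addrAC subrr add0r; lra.
Qed.

(** Outside a compact interval [f] stays below [f x0], so the maximum over that interval is global.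
    Smallness at infinity is one-sided: the functions it is applied to may tend to a negative limit
    or to minus infinity. *)
Lemma continuous_max (f : R -> R) : continuous f ->
  (forall e, 0 < e -> exists M, forall x, M < `|x| -> f x < e) ->
  forall x0, 0 < f x0 -> exists2 x, 0 < f x & forall y, f y <= f x.
Proof.
move=> cf finf x0 fx0; have [M MP] := finf _ fx0.
pose N := Num.max M `|x0|.
have NN : - N <= N by rewrite lerNl (le_trans _ (_ : 0 <= N))// ?oppr_le0 ?le_max ?normr_ge0 ?orbT.
have [z zN zmax] := EVT_max NN (continuous_subspaceT cf).
have x0N : x0 \in `[- N, N]%R.
  by rewrite in_itv/= -ler_norml /N le_max lexx orbT.
exists z; first exact: lt_le_trans fx0 (zmax _ x0N).
move=> y; have [yN|yN] := leP `|y| N.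
  by apply: zmax; rewrite in_itv/= -ler_norml.
apply: le_trans (zmax _ x0N); apply/ltW/MP.
by apply: le_lt_trans yN; rewrite /N le_max lexx.
Qed.

Lemma max_principle f p q : has_derivative f p -> has_derivative p q ->
  (forall e, 0 < e -> exists M, forall x, M < `|x| -> f x < e) ->
  (forall x, 0 < f x -> p x = 0 -> 0 < q x) ->
  forall x, f x <= 0.
Proof.
move=> fp pq finf fpos x; rewrite leNgt; apply/negP => fx0.
have [z fz0 fz] := continuous_max (has_derivative_continuous fp) finf fx0.
have := interior_max2 fp (pq z) fz; rewrite leNgt => /negP; apply.
by apply: fpos => //; exact: interior_max (fp z) fz.
Qed.

End calculus.

(** * Continuous functions vanishing at infinity *)

Section C0_functions.
Context {R : realType}.
Implicit Types (f g h : R -> R) (x y e B : R).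

Definition C0 f := continuous f /\ vanishes_at_infinity f.

Definition bounded_by B f := forall x : R, `|f x| <= B.

Lemma bounded_by_ge0 B f : bounded_by B f -> 0 <= B.
Proof. by move=> /(_ 0); exact: le_trans. Qed.

Lemma bounded_byW B B' f : B <= B' -> bounded_by B f -> bounded_by B' f.
Proof. by move=> BB' fB x; exact: le_trans (fB x) BB'. Qed.

Lemma C0_bounded f : C0 f -> exists2 B, 0 < B & bounded_by B f.
Proof.
move=> [cf finf].
have cnf : continuous (fun x => `|f x|).
  by move=> x; apply: cvg_norm; exact: cf.
have [[x0 fx0]|fle] := pselect (exists x0, 0 < `|f x0|).
  have [z fz0 zmax] := continuous_max cnf finf fx0.
  by exists `|f z|.
exists 1 => // x; rewrite leNgt; apply/negP => fx1; apply: fle; exists x.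
exact: lt_trans fx1.
Qed.

Lemma C0D f g : C0 f -> C0 g -> C0 (fun x => f x + g x).
Proof.
move=> [cf finf] [cg ginf]; split.
  by move=> x; apply: cvgD; [exact: cf|exact: cg].
move=> e e0; have e20 : 0 < e / 2 by rewrite divr_gt0.
have [M MP] := finf _ e20; have [N NP] := ginf _ e20.
exists (Num.max M N) => x; rewrite gt_max => /andP[/MP fx /NP gx].
by rewrite [e]splitr (le_lt_trans (ler_normD _ _))// ltrD.
Qed.

Lemma C0M (B : R) b f : continuous b -> bounded_by B b -> C0 f ->
  C0 (fun x => b x * f x).
Proof.
move=> cb bB [cf finf]; split.
  by move=> x; apply: cvgM; [exact: cb|exact: cf].
have B1 : 0 < B + 1 by have := bounded_by_ge0 bB; lra.
move=> e e0; have [M MP] := finf (e / (B + 1)) (divr_gt0 e0 B1).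
exists M => x /MP; rewrite ltr_pdivlMr// => fx.
rewrite normrM; apply: le_lt_trans fx.
rewrite mulrC ler_wpM2l//.
by rewrite (le_trans (bB x))//; lra.
Qed.

Lemma C0Z k f : C0 f -> C0 (fun x => k * f x).
Proof.
by apply: (@C0M `|k|) => // x; exact: cvg_cst.
Qed.

Lemma C0B f g : C0 f -> C0 g -> C0 (fun x => f x - g x).
Proof.
move=> C0f C0g; rewrite (_ : (fun _ => _) = (fun x => f x + (- 1) * g x)).
  exact/C0D/C0Z.
by apply/funext => x; rewrite mulN1r.
Qed.

Lemma C0_0 : C0 (fun=> 0 : R).
Proof.
split; first by move=> x; exact: cvg_cst.
by move=> e e0; exists 0 => x _; rewrite normr0.
Qed.

Lemma C0_lim f :
  (forall e, 0 < e -> exists2 g, C0 g & bounded_by e (fun x => f x - g x)) ->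
  C0 f.
Proof.
move=> fg; split.
- move=> x; apply/cvgrPdist_le => e e0.
  have e3 : 0 < e / 3 by rewrite divr_gt0.
  have [g [cg _] gf] := fg _ e3.
  have := cg x => /cvgrPdist_le/(_ _ e3); apply: filterS => y gxy.
  rewrite (_ : f x - f y = (f x - g x) + (g x - g y) - (f y - g y)); last by ring.
  rewrite (le_trans (ler_normB _ _))//.
  have := ler_normD (f x - g x) (g x - g y).
  by have := gf x; have := gf y; lra.
- move=> e e0; have e3 : 0 < e / 3 by rewrite divr_gt0.
  have [g [_ ginf] gf] := fg _ e3.
  have [M MP] := ginf _ e3; exists M => x /MP gx.
  rewrite (_ : f x = (f x - g x) + g x); last by ring.
  rewrite (le_lt_trans (ler_normD _ _))//.
  by have := gf x; lra.
Qed.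

(* A continuous function is uniformly continuous on a compact interval
   (near_covering), and small outside of it. *)
Lemma C0_modulus f e : C0 f -> 0 < e ->
  exists2 C, 0 <= C & forall x y, `|f x - f y| <= e + C * (x - y) ^+ 2.
Proof.
move=> C0f e0; have [cf finf] := C0f; have [B B0 fB] := C0_bounded C0f.
have e2 : 0 < e / 2 by rewrite divr_gt0.
have [M MP] := finf _ e2.
have /compact_near_coveringP/(_ _ (0 : R)^'+) H := @segment_compact R (- (`|M| + 1)) (`|M| + 1).
have [] := H (fun d x => forall y, `|x - y| < d -> `|f x - f y| <= e).
  move=> x _; have /cvgrPdist_le/(_ _ e2) := cf x.
  rewrite near_simpl => -[d /= d0 dP].
  have d2 : 0 < d / 2 by rewrite divr_gt0.
  exists (ball x (d / 2), [set t : R | 0 < t < d / 2]); first split => /=.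
  + exact: nbhsx_ballx.
  + exists (d / 2) => //= t /=; rewrite sub0r normrN => td t0.
    by rewrite t0/= (le_lt_trans _ td)// ler_norm.
  move=> [x' t] /= [xx' /andP[t0 td]] y xy.
  rewrite (_ : f x' - f y = (f x - f y) - (f x - f x')); last by ring.
  rewrite (le_trans (ler_normB _ _))//.
  have : `|f x - f x'| <= e / 2.
    by apply: dP => /=; rewrite (lt_trans xx')//; lra.
  have : `|f x - f y| <= e / 2.
    apply: dP => /=; rewrite (_ : x - y = (x - x') + (x' - y)); last by ring.
    rewrite (le_lt_trans (ler_normD _ _))//.
    by move: xx'; rewrite /ball/=; lra.
  by lra.
move=> d /= d0 dP.
(* The cap at 1 keeps [y] outside [[-|M|, |M|]] when [x] lies outside the interval enlarged by 1. *)
pose d' := Num.min (d / 2) 1.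
have d'0 : 0 < d' by rewrite lt_min ltr01 divr_gt0.
have [d'd d'1] : d' < d /\ d' <= 1.
  by split; [rewrite gt_min; apply/orP; left; lra|rewrite ge_min lexx orbT].
have d'P x y : `|x - y| < d' -> `|f x - f y| <= e.
  move=> xy; have [xM|xM] := leP `|x| (`|M| + 1).
    apply: (dP d') => //=.
    - by rewrite sub0r normrN gtr0_norm.
    - by rewrite in_itv/= -ler_norml.
  have yM : `|M| < `|y|.
    have := ler_normD (x - y) y; rewrite subrK; lra.
  rewrite (le_trans (ler_normB _ _))//.
  have Mn := ler_norm M.
  have : `|f x| < e / 2 by apply: MP; lra.
  have : `|f y| < e / 2 by apply: MP; lra.
  by lra.
have d'2 : 0 < d' ^+ 2 by rewrite exprn_gt0.
(* At distance [d'] or more the trivial bound [2 B] is absorbed by the quadratic term. A quadratic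
   is wanted because it is a smooth barrier for the maximum principle in [helmholtz_upper]. *)
exists (2 * B / d' ^+ 2) => [|x y]; first by rewrite divr_ge0 ?ltW// mulr_gt0.
have [xy|xy] := ltP `|x - y| d'.
  rewrite (le_trans (d'P _ _ xy))// lerDl mulr_ge0 ?sqr_ge0//.
  by rewrite divr_ge0 ?ltW// mulr_gt0.
apply: (@le_trans _ _ (2 * B)).
  by rewrite (le_trans (ler_normB _ _))//; have := fB x; have := fB y; lra.
rewrite -[leLHS]add0r lerD ?(ltW e0)// mulrAC ler_pdivlMr// ler_wpM2l//.
  by rewrite ltW// mulr_gt0.
by rewrite -(real_normK (num_real (x - y))) lerXn2r ?nnegrE// ltW.
Qed.
End C0_functions.

(** * Geometric convergence and fixed points of contractions *)

Section neumann.
Context {R : realType}.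
Implicit Types (f g h : R -> R) (x y e B : R).

(** With [d n] the tail of the geometric series, every [u n - d n] lies below every [u m + d m]; the
    supremum of the former is the limit. *)
Lemma geometric_cauchy (u : nat -> R) (D r : R) : 0 <= r < 1 -> 0 <= D ->
  (forall n, `|u n.+1 - u n| <= D * r ^+ n) ->
  exists l, forall n, `|l - u n| <= D * r ^+ n / (1 - r).
Proof.
move=> /andP[r0 r1] D0 uD; have r1' : 0 < 1 - r by rewrite subr_gt0.
pose d n := D * r ^+ n / (1 - r).
have d0 n : 0 <= d n.
  by apply: divr_ge0; [apply: mulr_ge0 => //; exact: exprn_ge0|exact: ltW].
have uk n k : `|u (n + k)%N - u n| <= d n - d (n + k)%N.
  elim: k => [|k IH]; first by rewrite addn0 !subrr normr0.
  rewrite addnS.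
  rewrite (_ : _ - u n = (u (n + k).+1 - u (n + k)%N) + (u (n + k)%N - u n)); last by ring.
  rewrite (le_trans (ler_normD _ _))//.
  have := uD (n + k)%N; rewrite (_ : D * _ = d (n + k)%N - d (n + k).+1); first lra.
  by rewrite /d exprS; field; rewrite gt_eqF.
pose E := [set u n - d n | n in [set: nat]].
have ubE m : ubound E (u m + d m).
  move=> _ [n _ <-]; have [/subnKC nm|/ltnW/subnKC mn] := leqP n m.
  - by have := uk n (m - n)%N; rewrite nm ler_norml; have := d0 m; lra.
  - by have := uk m (n - m)%N; rewrite mn ler_norml; have := d0 n; lra.
have E0 : E (u 0%N - d 0%N) by exists 0%N.
exists (sup E) => n; rewrite ler_norml; apply/andP; split.
  suff : u n - d n <= sup E by rewrite /d; lra.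
  by apply: ub_le_sup; [exists (u 0%N + d 0%N); exact: ubE|exists n].
suff : sup E <= u n + d n by rewrite /d; lra.
by apply: ge_sup; [exists (u 0%N - d 0%N)|exact: ubE].
Qed.

Lemma geometric_small (D r e : R) : 0 <= r < 1 -> 0 <= D -> 0 < e ->
  exists n, D * r ^+ n <= e.
Proof.
move=> /andP[r0 r1] D0 e0.
have : (fun n => D * r ^+ n) @ \oo --> D * 0.
  by apply: cvgMr; apply: cvg_expr; rewrite ger0_norm.
rewrite mulr0 => /cvgrPdist_le/(_ _ e0)[n _ /(_ n)]/= /(_ (leqnn _)).
rewrite sub0r normrN => nP; exists n; apply: le_trans nP; exact: ler_norm.
Qed.

(** [M] is defined on all functions but only contracts on [C0]. The Neumann iterates converge
    pointwise with a uniform rate, so the limit is again in [C0]. *)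
Lemma contraction_fixpoint (M : (R -> R) -> R -> R) (r : R) h :
  0 <= r < 1 -> C0 h -> (forall f, C0 f -> C0 (M f)) ->
  (forall f g B, C0 f -> C0 g -> bounded_by B (fun x => f x - g x) ->
     bounded_by (r * B) (fun x => M f x - M g x)) ->
  exists2 X, C0 X & forall x, X x = h x + M X x.
Proof.
move=> r01 C0h C0M Mr; have /andP[r0 r1] := r01.
have r1' : 0 < 1 - r by rewrite subr_gt0.
pose X_ n := iter n (fun f => (fun x => h x + M f x)) h.
have C0X n : C0 (X_ n) by elim: n => //= n IH; exact/C0D/C0M.
have [D D0 MD] := C0_bounded (C0M _ C0h).
have XD n : bounded_by (D * r ^+ n) (fun x => X_ n.+1 x - X_ n x).
  elim: n => [x|n IH x]; first by rewrite expr0 mulr1 /= [_ + M h x]addrC addrK.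
  rewrite exprS mulrCA; have := Mr _ _ _ (C0X n.+1) (C0X n) IH x.
  by rewrite /= (_ : h x + _ - _ = M (X_ n.+1) x - M (X_ n) x)//=; ring.
have Xl x := geometric_cauchy r01 (ltW D0) (fun n => XD n x).
have /choice[X XP] := Xl.
have D1 : 0 <= D / (1 - r) by rewrite divr_ge0 ?ltW.
have C0X' : C0 X.
  apply: C0_lim => e e0; have [n nP] := geometric_small r01 D1 e0.
  exists (X_ n) => // x; apply: le_trans nP; rewrite mulrAC; exact: XP.
exists X => // x; apply/eqP; rewrite -subr_eq0 -normr_le0.
apply/ler_addgt0Pl => e e0; rewrite addr0.
have e2 : 0 < e / 2 by rewrite divr_gt0.
have [n nP] := geometric_small r01 D1 e2.
have XXn : bounded_by (e / 2) (fun x => X x - X_ n x).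
  by move=> y; apply: le_trans nP; rewrite mulrAC; exact: XP.
have XXn1 : `|X x - X_ n.+1 x| <= e / 2.
  apply: (le_trans (XP x n.+1)); rewrite mulrAC.
  apply: le_trans nP; apply: ler_wpM2l => //; rewrite exprS.
  by apply: ler_piMl; [exact: exprn_ge0|exact: ltW].
rewrite (_ : X x - _ = (X x - X_ n.+1 x) - (M X x - M (X_ n) x)); last first.
  by rewrite /=; ring.
rewrite (le_trans (ler_normB _ _))//.
have := Mr _ _ _ C0X' (C0X n) XXn x.
have : r * (e / 2) <= 1 * (e / 2) by rewrite ler_wpM2r// ltW.
by lra.
Qed.

End neumann.

(** * Exponential integrals on half-lines and dominated integrals *)

Section exponential_integrals.
Context {R : realType}.
Notation mu := (@lebesgue_measure R).

Lemma has_derivativeP (f p : R -> R) (x : R) : has_derivative f p ->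
  derivable f x 1 /\ f^`() x = p x.
Proof. by move=> fp; have [? ?] := fp x; rewrite derive1E. Qed.

Lemma derivable_has_derivative (f : R -> R) : (forall x, derivable f x 1) ->
  has_derivative f f^`().
Proof. by move=> df x; split => //; rewrite derive1E. Qed.

Lemma cvg_expR_Ny (m : R) : 0 < m -> expR (- m * x) @[x --> +oo] --> (0 : R).
Proof.
move=> m0; rewrite (_ : (fun x => _) = (fun x => expR (- (m * x)))); last first.
  by apply/funext => x; rewrite mulNr.
apply: (@cvg_comp _ _ _ (fun x => m * x) (fun x => expR (- x))); last exact: cvgr_expR.
by apply: gt0_cvgMry => //; exact: cvg_id.
Qed.

Lemma integral_expR_y (m u : R) : 0 < m ->
  (\int[mu]_(y in `[u, +oo[) (expR (- m * y))%:E = (expR (- m * u) / m)%:E)%E.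
Proof.
move=> m0; have dF := has_derivativeZ (- m^-1) (has_derivative_exp (- m)).
have cexp : continuous (fun x : R => expR (- m * x)).
  exact: has_derivative_continuous (has_derivative_exp _).
rewrite (@ge0_continuous_FTC2y R _ (fun x => - m^-1 * expR (- m * x)) u 0).
- by rewrite -EFinB; congr EFin; ring.
- by move=> x _; exact: expR_ge0.
- exact: continuous_subspaceT.
- rewrite -(mulr0 (- m^-1)); apply: cvgMr; exact: cvg_expR_Ny.
- by move=> x _; exact: (has_derivativeP x dF).1.
- apply: cvg_at_right_filter; exact: has_derivative_continuous dF _.
- move=> x _; rewrite (has_derivativeP x dF).2.
  by rewrite mulrA mulrNN mulVf ?mul1r// gt_eqF.
Qed.

Lemma integral_expR_Ny (m u : R) : 0 < m ->
  (\int[mu]_(y in `]-oo, u]) (expR (m * y))%:E = (expR (m * u) / m)%:E)%E.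
Proof.
move=> m0; rewrite -[u]opprK ge0_integration_by_substitutionNy.
- rewrite [in RHS]mulrN -mulNr -integral_expR_y//; apply: eq_integral => x _ /=.
  by rewrite mulrN mulNr.
- apply: continuous_subspaceT.
  exact: has_derivative_continuous (has_derivative_exp _).
- by move=> x _; exact: expR_ge0.
Qed.

Lemma measurable_expRM (m : R) (D : set R) :
  measurable_fun D (fun y => (expR (m * y))).
Proof.
apply: (@measurable_funS _ _ _ _ setT) => //.
apply: continuous_measurable_fun.
exact: has_derivative_continuous (has_derivative_exp _).
Qed.

Lemma integrable_expR_Ny (m u : R) : 0 < m ->
  mu.-integrable `]-oo, u] (EFin \o (fun y => (expR (m * y)))).
Proof.
move=> m0; apply/integrableP; split.
  by apply/measurable_EFinP; exact: measurable_expRM.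
under eq_integral do rewrite /= ger0_norm ?expR_ge0//.
by rewrite integral_expR_Ny// ltry.
Qed.

Lemma integrable_expR_y (m u : R) : 0 < m ->
  mu.-integrable `[u, +oo[ (EFin \o (fun y => (expR (- m * y)))).
Proof.
move=> m0; apply/integrableP; split.
  by apply/measurable_EFinP; exact: measurable_expRM.
under eq_integral do rewrite /= ger0_norm ?expR_ge0//.
by rewrite integral_expR_y// ltry.
Qed.

End exponential_integrals.

Lemma integrable_dominated d (T : measurableType d) (R : realType)
    (mu : {measure set T -> \bar R}) (D : set T) (f g : T -> R) :
  measurable D -> measurable_fun D f -> mu.-integrable D (EFin \o g) ->
  (forall x, D x -> `|f x| <= g x) -> mu.-integrable D (EFin \o f).
Proof.
move=> mD mf ig fg; apply: (le_integrable mD _ _ ig).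
  exact/measurable_EFinP.
move=> x Dx /=; rewrite lee_fin (le_trans (fg _ Dx))// ler_norm.
by [].
Qed.

Lemma le_Rintegral_dominated d (T : measurableType d) (R : realType)
    (mu : {measure set T -> \bar R}) (D : set T) (f g : T -> R) :
  measurable D -> measurable_fun D f -> mu.-integrable D (EFin \o g) ->
  (forall x, D x -> `|f x| <= g x) ->
  `|(\int[mu]_(x in D) f x)%R| <= (\int[mu]_(x in D) g x)%R.
Proof.
move=> mD mf ig fg; have iF := integrable_dominated mD mf ig fg.
rewrite (le_trans (le_normr_Rintegral mD iF))// le_Rintegral//.
exact: (integrable_norm iF).
Qed.

(** * The equation [A' = F - m A] *)

Section first_order.
Context {R : realType}.
Notation mu := (@lebesgue_measure R).
Implicit Types (F A : R -> R) (m G : R).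

Definition exp_primitive m F x := (\int[mu]_(y in `]-oo, x]) (expR (m * y) * F y))%R.

Lemma exp_primitive_bound m F G x : 0 < m -> continuous F ->
  (forall y, y <= x -> `|F y| <= G) ->
  mu.-integrable `]-oo, x] (EFin \o (fun y => (expR (m * y) * F y))) /\
  `|exp_primitive m F x| <= G / m * expR (m * x).
Proof.
move=> m0 cF FG.
have mf : measurable_fun `]-oo, x] (fun y => expR (m * y) * F y).
  apply: measurable_funM; first exact: measurable_expRM.
  apply: (@measurable_funS _ _ _ _ setT) => //.
  exact: continuous_measurable_fun.
have ig : mu.-integrable `]-oo, x] (EFin \o (fun y => G * expR (m * y))).
  have := integrableZl _ G (@integrable_expR_Ny R m x m0).
  by apply => //; exact: measurable_itv.
have fg y : `]-oo, x] y -> `|expR (m * y) * F y| <= G * expR (m * y).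
  rewrite /= in_itv/= => yx.
  by rewrite normrM (ger0_norm (expR_ge0 _)) mulrC ler_wpM2r ?expR_ge0// FG.
split; first exact: integrable_dominated ig fg.
have le_fg := @le_Rintegral_dominated _ _ _ mu _ _ _ (measurable_itv _) mf ig fg.
rewrite /exp_primitive (le_trans le_fg)//.
rewrite RintegralZl//; last exact: integrable_expR_Ny.
by rewrite /Rintegral integral_expR_Ny//= mulrAC mulrA.
Qed.

Lemma exp_primitive_derivative m F G : 0 < m -> continuous F ->
  bounded_by G F ->
  has_derivative (exp_primitive m F) (fun x => expR (m * x) * F x).
Proof.
move=> m0 cF FG x.
have xx1 : x < x + 1 by rewrite ltrDl.
have [iF _] := @exp_primitive_bound m F G (x + 1) m0 cF (fun y _ => FG y).
have [||dE vE] := continuous_FTC1 xx1 iF.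
- by rewrite ltNyr.
- apply: cvgM; last exact: cF.
  exact: (has_derivative_continuous (has_derivative_exp m)).
- by split; [exact: dE|rewrite -derive1E; exact: vE].
Qed.

(** The convolution of [F] with [e^(-m y)] on [y >= 0], which solves [A' = F - m A]. *)
Definition exp_convolution m F x := expR (- m * x) * exp_primitive m F x.

Lemma exp_convolution_derivative m F G : 0 < m -> continuous F ->
  bounded_by G F ->
  has_derivative (exp_convolution m F) (fun x => F x - m * exp_convolution m F x).
Proof.
move=> m0 cF FG.
apply: has_derivative_eq.
  apply: has_derivativeM (has_derivative_exp (- m)) _.
  exact: exp_primitive_derivative FG.
move=> x /=; rewrite mulrA -expRD (_ : - m * x + m * x = 0) ?expR0; last by ring.
by rewrite /exp_convolution mulNr; ring.
Qed.

(** Only values of [F] to the left of [x] enter, which yields the decay at minus infinity. *)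
Lemma exp_convolution_bound m F G x : 0 < m -> continuous F ->
  (forall y, y <= x -> `|F y| <= G) -> `|exp_convolution m F x| <= G / m.
Proof.
move=> m0 cF FG; have [_] := exp_primitive_bound m0 cF FG.
rewrite /exp_convolution normrM (ger0_norm (expR_ge0 _)) mulNr expRN.
by rewrite ler_pdivrMl ?expR_gt0// mulrC.
Qed.

(** Beyond [M] the function [e^(m x) (e / m - A x)] is nondecreasing, which gives an exponentially
    small correction to [e / m]; [e^(-w) <= 1 / w] makes it rational, so that a threshold for [x]
    can be written down. *)
Lemma exp_decay_le m F A G e M x : 0 < m ->
  has_derivative A (fun x => F x - m * A x) -> bounded_by G A ->
  (forall x, M < x -> F x <= e) -> M < x ->
  A x <= e / m + (G + `|e / m|) / (m * (x - M)).
Proof.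
move=> m0 dA AG Fe Mx.
pose h x := expR (m * x) * (e / m - A x).
have dh : has_derivative h (fun x => expR (m * x) * (e - F x)).
  apply: has_derivative_eq.
    apply: has_derivativeM (has_derivative_exp m) _.
    exact: has_derivativeB (has_derivative_cst _) dA.
  by move=> y /=; field; rewrite gt_eqF.
have hMx : h M <= h x.
  apply: (derivative_ge0_le dh (ltW Mx)) => z /andP[Mz _].
  by rewrite mulr_ge0 ?expR_ge0// subr_ge0 Fe.
have {hMx} : A x - e / m <= expR (- (m * (x - M))) * (A M - e / m).
  rewrite (_ : - (m * (x - M)) = m * M - m * x); last by ring.
  rewrite expRD expRN mulrAC ler_pdivlMr ?expR_gt0//.
  by move: hMx; rewrite /h; lra.
rewrite -lerBlDl => /le_trans; apply.
have w0 : 0 < m * (x - M) by rewrite mulr_gt0// subr_gt0.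
have G0 := bounded_by_ge0 AG.
have H1 : A M - e / m <= G + `|e / m|.
  have := AG M; have := ler_norm (A M); have := ler_norm (- (e / m)).
  by rewrite normrN; lra.
apply: (@le_trans _ _ (expR (- (m * (x - M))) * (G + `|e / m|))).
  by rewrite ler_wpM2l ?expR_ge0.
rewrite mulrC ler_wpM2l//; first by rewrite addr_ge0.
rewrite expRN lef_pV2 ?posrE ?expR_gt0//.
by apply: le_trans (expR_ge1Dx _); rewrite lerDr.
Qed.

Lemma exp_convolution_C0 m F : 0 < m -> C0 F -> C0 (exp_convolution m F).
Proof.
move=> m0 C0F; have [G G0 FG] := C0_bounded C0F; have [cF Finf] := C0F.
have dA := exp_convolution_derivative m0 cF FG.
set A := exp_convolution m F in dA *.
have AG : bounded_by (G / m) A.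
  by move=> x; apply: exp_convolution_bound => // y _; exact: FG.
split; first exact: has_derivative_continuous dA.
move=> e e0.
pose e' := e * m / 4.
have e'0 : 0 < e' by rewrite divr_gt0// mulr_gt0.
have e'm : e' / m = e / 4 by rewrite /e'; field; rewrite gt_eqF.
have [M MP] := Finf _ e'0.
pose K := (G / m + `|e / 4|).
have K0 : 0 <= K by rewrite addr_ge0// divr_ge0// ltW.
(* At this distance beyond [|M|] the rational correction is at most [e / 4], as is [e' / m]. *)
pose N := `|M| + K / (m * (e / 4)) + 1.
have q0 : 0 <= K / (m * (e / 4)) by rewrite divr_ge0// ltW// mulr_gt0// divr_gt0.
exists N => x Nx.
have MM := ler_norm M; have M0 := normr_ge0 M.
have [x0|x0] := ltP x 0.
  apply: (@le_lt_trans _ _ (e' / m)); last by rewrite e'm; lra.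
  apply: exp_convolution_bound => // y yx; apply/ltW/MP.
  by move: Nx; rewrite /N (ltr0_norm x0) (@ler0_norm _ y); lra.
have NxM : `|M| < x by move: Nx; rewrite ger0_norm// /N; lra.
have xM0 : 0 < x - `|M| by rewrite subr_gt0.
have Kb : K / (m * (x - `|M|)) <= e / 4.
  have e40 : 0 < m * (e / 4) by rewrite mulr_gt0// divr_gt0.
  rewrite ler_pdivrMr ?mulr_gt0//.
  rewrite (_ : e / 4 * _ = (m * (e / 4)) * (x - `|M|)); last by ring.
  rewrite mulrC -ler_pdivrMr//.
  by move: Nx; rewrite ger0_norm// /N; lra.
have up : A x <= e / 4 + e / 4.
  have := @exp_decay_le m F A (G / m) e' `|M| x m0 dA AG.
  rewrite e'm => /(_ _ NxM) H; apply: le_trans (H _) _; last by rewrite lerD2l.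
  move=> y My; apply: le_trans (ler_norm _) _; apply/ltW/MP.
  by rewrite gtr0_norm; lra.
have lo : - A x <= e / 4 + e / 4.
  have dNA : has_derivative (fun x => - A x) (fun x => - F x - m * - A x).
    rewrite (_ : (fun x => - A x) = (fun x => -1 * A x)); last first.
      by apply/funext => y; rewrite mulN1r.
    by apply: has_derivative_eq (has_derivativeZ (-1) dA) _ => y /=; ring.
  have NAG : bounded_by (G / m) (fun x => - A x) by move=> y; rewrite normrN.
  have := @exp_decay_le m _ _ (G / m) e' `|M| x m0 dNA NAG.
  rewrite e'm => /(_ _ NxM) H; apply: le_trans (H _) _; last by rewrite lerD2l.
  move=> y My; apply: le_trans (ler_norm _) _; rewrite normrN; apply/ltW/MP.
  by rewrite gtr0_norm; lra.
by rewrite ltr_norml; lra.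
Qed.

End first_order.

(** * The equation [m^2 u - u'' = F] *)

Section helmholtz.
Context {R : realType}.
Implicit Types (F A u p : R -> R) (m G : R).

Lemma C0_norm_max (f : R -> R) : C0 f -> exists x, forall y, `|f y| <= `|f x|.
Proof.
move=> [cf finf].
have cnf : continuous (fun x => `|f x|) by move=> x; apply: cvg_norm; exact: cf.
have [[x0 fx0]|fle] := pselect (exists x0, 0 < `|f x0|).
  by have [z _ zmax] := continuous_max cnf finf fx0; exists z.
exists 0 => y; rewrite (_ : f y = 0) ?normr0//.
by apply/eqP; apply: contra_notT fle => fy0; exists y; rewrite normr_gt0.
Qed.

(** At a positive maximum of [A - G / m] the derivative [F - m A] would vanish although
    [m A > G >= F]. This covers every [C0] solution, not only the convolution. *)
Lemma first_order_le m F A G : 0 < m -> C0 A ->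
  has_derivative A (fun x => F x - m * A x) -> (forall x, F x <= G) ->
  0 <= G -> forall x, A x <= G / m.
Proof.
move=> m0 [cA Ainf] dA FG G0 x; rewrite leNgt; apply/negP => Ax.
have finf e : 0 < e -> exists M, forall x, M < `|x| -> A x - G / m < e.
  move=> e0; have [M MP] := Ainf _ e0; exists M => y /MP.
  have : 0 <= G / m by rewrite divr_ge0// ltW.
  by have := ler_norm (A y); lra.
have dB := has_derivativeB dA (has_derivative_cst (G / m)).
have Ax' : 0 < A x - G / m by rewrite subr_gt0.
have [z Az zmax] := continuous_max (has_derivative_continuous dB) finf Ax'.
have /= := interior_max (dB z) zmax; rewrite subr0.
have : G < m * A z by rewrite mulrC -ltr_pdivrMr// -subr_gt0.
by have := FG z; lra.
Qed.

Lemma first_order_bound m F A G : 0 < m -> C0 A ->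
  has_derivative A (fun x => F x - m * A x) -> bounded_by G F ->
  bounded_by (G / m) A.
Proof.
move=> m0 C0A dA FG x; have G0 := bounded_by_ge0 FG.
rewrite ler_norml; apply/andP; split; last first.
  by apply: first_order_le dA _ _ _ => // y; exact: le_trans (ler_norm _) (FG y).
rewrite lerNl -mulN1r.
have dNA : has_derivative (fun x => -1 * A x) (fun x => - F x - m * (-1 * A x)).
  by apply: has_derivative_eq (has_derivativeZ (-1) dA) _ => y /=; ring.
apply: first_order_le dNA _ _ _ => //; first exact: C0Z.
by move=> y; rewrite (le_trans (ler_norm _))// normrN.
Qed.

Lemma C0_comp_opp (f : R -> R) : C0 f -> C0 (fun x => f (- x)).
Proof.
move=> [cf finf]; split.
  move=> x; apply: continuous_comp; last exact: cf.
  exact: (@pseudometric_normed_Zmodule.oppr_continuous _ R).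
by move=> e /finf[M MP]; exists M => x; rewrite -normrN => /MP.
Qed.

Lemma has_derivative_comp_opp (f p : R -> R) : has_derivative f p ->
  has_derivative (fun x => f (- x)) (fun x => - p (- x)).
Proof.
move=> fp; have dN : has_derivative (fun x : R => - x) (fun=> - 1).
  by move=> x; exact: is_deriveNid.
by apply: has_derivative_eq (has_derivative_comp fp dN) _ => x /=; rewrite mulrN1.
Qed.

Definition helmholtz_solution m F u p :=
  [/\ C0 u, C0 p, has_derivative u p &
      has_derivative p (fun x => m ^+ 2 * u x - F x)].

(* [m * u - p] and [m * u + p] solve the first-order equations
   [A' = F - m A] and [B' = m B - F]. *)
Lemma helmholtz_bound m F u p G : 0 < m -> helmholtz_solution m F u p ->
  bounded_by G F -> bounded_by (G / m ^+ 2) u /\ bounded_by (G / m) p.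
Proof.
move=> m0 [C0u C0p du dp] FG.
have hA : bounded_by (G / m) (fun x => m * u x - p x).
  apply: (@first_order_bound m F) => //; first exact/C0B/C0p/C0Z.
  apply: has_derivative_eq (has_derivativeB (has_derivativeZ m du) dp) _ => x /=.
  by ring.
have hB : bounded_by (G / m) (fun x => m * u (- x) + p (- x)).
  have C0up : C0 (fun x => m * u x + p x) by exact/C0D/C0p/C0Z.
  have FG' : bounded_by G (fun x => F (- x)) by move=> x; exact: FG.
  apply: first_order_bound FG' => //; first exact: C0_comp_opp C0up.
  have dup := has_derivative_comp_opp (has_derivativeD (has_derivativeZ m du) dp).
  by apply: has_derivative_eq dup _ => x /=; ring.
split=> x.
- have := hA x; have := hB (- x); rewrite opprK => hBx hAx.
  rewrite (_ : u x = (m * u x - p x + (m * u x + p x)) / (2 * m)); last first.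
    by field; rewrite gt_eqF.
  rewrite normrM (@ger0_norm _ (2 * m)^-1); last by rewrite invr_ge0; lra.
  rewrite ler_pdivrMr; last lra.
  rewrite (_ : G / m ^+ 2 * (2 * m) = G / m + G / m); last first.
    by field; rewrite gt_eqF.
  by rewrite (le_trans (ler_normD _ _))// lerD.
- have := hA x; have := hB (- x); rewrite opprK => hBx hAx.
  rewrite (_ : p x = (m * u x + p x - (m * u x - p x)) / 2); last by field.
  rewrite normrM (@ger0_norm _ 2^-1)// ler_pdivrMr//.
  rewrite (_ : G / m * 2 = G / m + G / m); last by ring.
  by rewrite (le_trans (ler_normB _ _))// lerD.
Qed.

(** [u] is the convolution of [F] with the Green function [e^(-m |x|) / (2 m)]: [A] is the
    contribution from the left of [x], and [B], obtained by reflection, the one from the right. *)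
Lemma helmholtz_solvable m F : 0 < m -> C0 F ->
  exists u p, helmholtz_solution m F u p.
Proof.
move=> m0 C0F; have [G G0 FG] := C0_bounded C0F; have [cF Finf] := C0F.
have C0F' := C0_comp_opp C0F.
pose A := exp_convolution m F.
pose B x := exp_convolution m (fun x => F (- x)) (- x).
have C0A : C0 A by exact: exp_convolution_C0.
have C0B' : C0 B by apply: C0_comp_opp; exact: exp_convolution_C0.
have dA := exp_convolution_derivative m0 cF FG.
have dB : has_derivative B (fun x => m * B x - F x).
  have dB' := exp_convolution_derivative m0 C0F'.1 (fun x => FG (- x)).
  apply: has_derivative_eq (has_derivative_comp_opp dB') _ => x /=.
  by rewrite opprK /B; ring.
exists (fun x => (2 * m)^-1 * (A x + B x)), (fun x => 2^-1 * (B x - A x)).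
split.
- exact/C0Z/C0D.
- exact/C0Z/C0B.
- apply: has_derivative_eq (has_derivativeZ _ (has_derivativeD dA dB)) _ => x /=.
  by rewrite /A; field; rewrite gt_eqF.
- apply: has_derivative_eq (has_derivativeZ _ (has_derivativeB dB dA)) _ => x /=.
  by rewrite /A; field; rewrite gt_eqF.
Qed.

End helmholtz.

(** * Uniform continuity in affine form *)

Section modulus.
Context {R : realType}.
Implicit Types (f g : R -> R).

(* Uniform continuity, for functions of at most linear growth. *)
Definition modulus f := forall e : R, 0 < e ->
  exists2 K, 0 <= K & forall x y, `|f x - f y| <= e + K * `|x - y|.

Lemma modulus_continuous f : modulus f -> continuous f.
Proof.
move=> fm x; apply/cvgrPdist_le => e e0.
have e2 : 0 < e / 2 by rewrite divr_gt0.
have [K K0 KP] := fm _ e2.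
have K1 : 0 < K + 1 by lra.
exists (e / 2 / (K + 1)) => /=; first by rewrite divr_gt0.
move=> y /=; rewrite ltr_pdivlMr// => xy; apply: le_trans (KP x y) _.
have : 0 <= `|x - y| by [].
by lra.
Qed.

End modulus.

(** * The resolvent of [L] *)

Section resolvent.
Context {R : realType}.
Implicit Types (a b c f g h v w p q : R -> R) (A B C G K lambda : R).

Record admissible a b c (a0 : R) A B C : Prop := Admissible {
  adm_a0_gt0 : 0 < a0;
  adm_a_gt : forall x, a0 < a x;
  adm_a_le : forall x, a x <= A;
  adm_b_le : bounded_by B b;
  adm_c_ge : forall x, - C <= c x;
  adm_c_le0 : forall x, c x <= 0;
  adm_a_modulus : modulus a;
  adm_b_modulus : modulus b;
  adm_c_modulus : modulus c }.

Variables (a b c : R -> R) (a0 A B C : R).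
Hypothesis adm : admissible a b c a0 A B C.

Let a0_gt0 : 0 < a0. Proof. exact: adm_a0_gt0 adm. Qed.
Let a_gt : forall x, a0 < a x. Proof. exact: adm_a_gt adm. Qed.
Let a_le : forall x, a x <= A. Proof. exact: adm_a_le adm. Qed.
Let b_le : bounded_by B b. Proof. exact: adm_b_le adm. Qed.
Let c_ge : forall x, - C <= c x. Proof. exact: adm_c_ge adm. Qed.
Let c_le0 : forall x, c x <= 0. Proof. exact: adm_c_le0 adm. Qed.
Let ca : continuous a. Proof. exact/modulus_continuous/(adm_a_modulus adm). Qed.
Let cb : continuous b. Proof. exact/modulus_continuous/(adm_b_modulus adm). Qed.
Let cc : continuous c. Proof. exact/modulus_continuous/(adm_c_modulus adm). Qed.

(* [v] is in the domain of [L v = a v'' + b v' + c v], and [w = L v]. *)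
Definition in_graph v w :=
  [/\ C0 v, C0 w & exists p q, [/\ has_derivative v p, has_derivative p q &
    forall x, w x = a x * q x + b x * p x + c x * v x]].

Lemma in_graph_lin k v w v' w' : in_graph v w -> in_graph v' w' ->
  in_graph (fun x => k * v x + v' x) (fun x => k * w x + w' x).
Proof.
move=> [C0v C0w [p [q [dp dq e]]]] [C0v' C0w' [p' [q' [dp' dq' e']]]].
split; [exact/C0D/C0v'/C0Z|exact/C0D/C0w'/C0Z|].
exists (fun x => k * p x + p' x), (fun x => k * q x + q' x); split.
- exact/has_derivativeD/dp'/has_derivativeZ.
- exact/has_derivativeD/dq'/has_derivativeZ.
- by move=> x; rewrite e e'; ring.
Qed.

Lemma a_gt0 x : 0 < a x. Proof. exact: lt_trans a0_gt0 (a_gt x). Qed.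

(** Where [v > G / lambda] one has [v > 0], hence [c v <= 0]; if also [v' = 0], the inequality
    forces [a v'' > 0], which the maximum principle excludes. *)
Lemma resolvent_le lambda v w G : 0 < lambda -> in_graph v w ->
  0 <= G -> (forall x, lambda * v x - w x <= G) -> forall x, v x <= G / lambda.
Proof.
move=> l0 [[_ vinf] _ [p [q [dp dq e]]]] G0 vwG x; rewrite -subr_le0.
move: x; apply: max_principle.
- exact: has_derivativeB dp (has_derivative_cst _).
- exact: has_derivativeB dq (has_derivative_cst _).
- move=> eps /vinf[M MP]; exists M => x /MP.
  have : 0 <= G / lambda by rewrite divr_ge0// ltW.
  by have := ler_norm (v x); lra.
- move=> x; rewrite subr_gt0 ltr_pdivrMr// !subr0 => vx px.
  have := vwG x; rewrite e px mulr0 addr0 => H.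
  have v0 : 0 < v x by rewrite -(pmulr_lgt0 _ l0); exact: le_lt_trans vx.
  have : c x * v x <= 0 by rewrite mulr_le0_ge0// ltW.
  move=> cv; have : 0 < a x * q x by lra.
  by rewrite pmulr_rgt0// a_gt0.
Qed.

Lemma in_graph0 : in_graph (fun=> 0) (fun=> 0).
Proof.
split; [exact: C0_0|exact: C0_0|].
exists (fun=> 0), (fun=> 0); split; [exact: has_derivative_cst..|].
by move=> x; rewrite !mulr0 !addr0.
Qed.

Lemma in_graphZ k v w : in_graph v w ->
  in_graph (fun x => k * v x) (fun x => k * w x).
Proof.
move=> vw; have := in_graph_lin k vw in_graph0.
by under eq_fun do rewrite addr0; under [X in in_graph _ X]eq_fun do rewrite addr0.
Qed.

Lemma in_graphB v w v' w' : in_graph v w -> in_graph v' w' ->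
  in_graph (fun x => v x - v' x) (fun x => w x - w' x).
Proof.
move=> vw vw'; have := in_graph_lin (-1) vw' vw.
rewrite (_ : (fun x => -1 * v' x + _) = (fun x => v x - v' x)); last first.
  by apply/funext => x; ring.
rewrite (_ : (fun x => -1 * w' x + _) = (fun x => w x - w' x))//.
by apply/funext => x; ring.
Qed.

Lemma resolvent_bound lambda v w G : 0 < lambda -> in_graph v w ->
  bounded_by G (fun x => lambda * v x - w x) -> bounded_by (G / lambda) v.
Proof.
move=> l0 vw vwG x; have G0 := bounded_by_ge0 vwG.
rewrite ler_norml; apply/andP; split; last first.
  apply: resolvent_le vw _ _ _ => // y; exact: le_trans (ler_norm _) (vwG y).
rewrite lerNl -mulN1r.
apply: (resolvent_le l0 (in_graphZ (-1) vw)) => // y.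
rewrite (_ : _ - _ = - (lambda * v y - w y)); last by ring.
by rewrite (le_trans (ler_norm _))// normrN.
Qed.

Lemma resolvent_inj lambda v w v' w' : 0 < lambda ->
  in_graph v w -> in_graph v' w' ->
  (forall x, lambda * v x - w x = lambda * v' x - w' x) -> v = v' /\ w = w'.
Proof.
move=> l0 vw vw' e.
have H : bounded_by 0 (fun x => lambda * (v x - v' x) - (w x - w' x)).
  move=> x; rewrite (_ : _ - _ = (lambda * v x - w x) - (lambda * v' x - w' x)).
    by rewrite e subrr normr0.
  by ring.
have := resolvent_bound l0 (in_graphB vw vw') H; rewrite mul0r => vv'.
have vv'E : v = v'.
  by apply/funext => x; apply/eqP; rewrite -subr_eq0 -normr_le0 vv'.
split=> //; apply/funext => x; have := e x; rewrite vv'E; lra.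
Qed.

Let P := B / a0.
Let theta := a0 / (2 * A).

Lemma B_ge0 : 0 <= B. Proof. exact: bounded_by_ge0 b_le. Qed.

Lemma A_gt0 : 0 < A. Proof. exact: lt_le_trans (a_gt0 0) (a_le 0). Qed.

Lemma theta_itv : 0 < theta <= 2^-1.
Proof.
have A0 := A_gt0; apply/andP; split; first by rewrite divr_gt0// mulr_gt0.
rewrite ler_pdivrMr ?mulr_gt0// mulrA mulVf// mul1r.
exact: le_trans (ltW (a_gt 0)) (a_le 0).
Qed.

Lemma C_ge0 : 0 <= C. Proof. by have := c_ge 0; have := c_le0 0; lra. Qed.

(** For [m^2 = (lambda + C) / a0], the summand [1 + C] gives [(lambda - c) / a >= theta m^2], and
    the last summand gives [P / m <= theta / 2], with [P] a bound for [b / a]. *)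
Definition resolvent_threshold := 1 + C + a0 * (2 * P / theta) ^+ 2.

Lemma resolvent_threshold_ge1 : 1 <= resolvent_threshold.
Proof.
rewrite /resolvent_threshold -addrA lerDl addr_ge0 ?C_ge0//.
by rewrite mulr_ge0 ?sqr_ge0// ltW.
Qed.

Lemma continuous_ratio (d : R -> R) : continuous d -> continuous (fun x => d x / a x).
Proof.
move=> cd x; apply: cvgM; first exact: cd.
by apply: cvgV; [rewrite gt_eqF// a_gt0|exact: ca].
Qed.

Lemma ratio_le (d : R) x : 0 <= d -> d / a x <= d / a0.
Proof.
move=> d0; rewrite ler_wpM2l// lef_pV2 ?posrE ?a_gt0//; exact/ltW.
Qed.

(* With [F = m^2 v - v''] as the unknown, the equation
   [a v'' + b v' + (c - lambda) v = -g] reads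
   [F = g / a + (b / a) v' + (m^2 - (lambda - c) / a) v], where [v] and [v'] are
   recovered from [F] by the Helmholtz equation; for large [lambda] the right
   hand side is a contraction. *)
Lemma resolvent_large lambda : resolvent_threshold <= lambda ->
  exists2 K, 0 <= K & forall g G, C0 g -> bounded_by G g ->
  exists v p q, [/\ C0 v, has_derivative v p, has_derivative p q,
    bounded_by (K * G) p /\ bounded_by (K * G) q &
    forall x, lambda * v x - (a x * q x + b x * p x + c x * v x) = g x].
Proof.
move=> lam; have /andP[th0 th1] := theta_itv.
have B0 := B_ge0; have A0 := A_gt0; have Cge0 := C_ge0.
have P0 : 0 <= P by rewrite divr_ge0// ltW.
have sq0 : 0 <= a0 * (2 * P / theta) ^+ 2 by rewrite mulr_ge0 ?sqr_ge0// ltW.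
have lC : 1 + C <= lambda by move: lam; rewrite /resolvent_threshold; lra.
have l0 : 0 < lambda by lra.
(* [m^2] is an upper bound for [(lambda - c) / a], so the zeroth-order coefficient [d] is
   nonnegative. *)
pose m := Num.sqrt ((lambda + C) / a0).
have m2 : m ^+ 2 = (lambda + C) / a0.
  by rewrite sqr_sqrtr// divr_ge0 ?(ltW a0_gt0)//; lra.
have m0 : 0 < m by rewrite sqrtr_gt0 divr_gt0//; lra.
have mP : P / m <= theta / 2.
  suff : 2 * P / theta <= m.
    rewrite ler_pdivrMr// => H; rewrite ler_pdivrMr//.
    by move: H; rewrite [m * _]mulrC; lra.
  rewrite -(@ler_pXn2r _ 2) ?nnegrE ?(ltW m0)//; last first.
    by rewrite divr_ge0 ?(ltW th0)// mulr_ge0.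
  rewrite m2 ler_pdivlMr// mulrC.
  by move: lam; rewrite /resolvent_threshold; lra.
(* The zeroth-order term contributes at most [1 - theta], the first-order term [theta / 2]. *)
pose r := 1 - theta / 2.
have r01 : 0 <= r < 1 by rewrite /r; lra.
pose d x := m ^+ 2 - (lambda - c x) / a x.
have dP : bounded_by (m ^+ 2 * (1 - theta)) d.
  move=> x; have c0 := c_le0 x; have cC := c_ge x.
  have lc0 : 0 <= lambda - c x by lra.
  have up : (lambda - c x) / a x <= m ^+ 2.
    by rewrite m2 (le_trans (ratio_le _ lc0))// ler_pM2r ?invr_gt0//; lra.
  rewrite ger0_norm; last by rewrite /d subr_ge0.
  rewrite /d mulrBr mulr1 lerB//.
  apply: (@le_trans _ _ (lambda / A)).
    rewrite m2 /theta.
    rewrite (_ : _ / a0 * _ = (lambda + C) / 2 / A); last first.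
      by field; rewrite !gt_eqF.
    by rewrite ler_pM2r ?invr_gt0//; lra.
  apply: (@le_trans _ _ (lambda / a x)).
    by rewrite ler_wpM2l ?(ltW l0)// lef_pV2 ?posrE ?a_gt0.
  by rewrite ler_pM2r ?invr_gt0 ?a_gt0//; lra.
have cd : continuous d.
  move=> x; apply: cvgB; first exact: cvg_cst.
  apply: (@continuous_ratio (fun x => lambda - c x)) => y.
  by apply: cvgB; [exact: cvg_cst|exact: cc].
have cba : continuous (fun x => b x / a x) by exact: continuous_ratio.
have baP : bounded_by P (fun x => b x / a x).
  move=> x; rewrite normrM normfV (gtr0_norm (a_gt0 x)).
  apply: (@le_trans _ _ (B / a x)).
    by rewrite ler_wpM2r ?invr_ge0 ?(ltW (a_gt0 x)).
  exact: ratio_le.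
have c1a : continuous (fun x => 1 / a x) by apply: continuous_ratio => x; exact: cvg_cst.
have b1a : bounded_by (1 / a0) (fun x => 1 / a x).
  by move=> x; rewrite ger0_norm ?divr_ge0 ?(ltW (a_gt0 x))//; exact: ratio_le.
have C0ga g : C0 g -> C0 (fun x => 1 / a x * g x) by exact: C0M.
(* Outside [C0] the chosen pair is arbitrary. *)
have /choice[sol solP] : forall F, exists up : (R -> R) * (R -> R),
    C0 F -> helmholtz_solution m F up.1 up.2.
  move=> F; have [C0F|nC0F] := pselect (C0 F); last by exists (F, F).
  by have [u [p H]] := helmholtz_solvable m0 C0F; exists (u, p).
pose M F x := b x / a x * (sol F).2 x + d x * (sol F).1 x.
have MC0 F : C0 F -> C0 (M F).
  move=> /solP[C0u C0p _ _]; apply: C0D; first exact: C0M baP C0p.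
  exact: C0M dP C0u.
have Mr F F' D : C0 F -> C0 F' -> bounded_by D (fun x => F x - F' x) ->
    bounded_by (r * D) (fun x => M F x - M F' x).
  move=> C0F C0F' FD x; have D0 := bounded_by_ge0 FD.
  have [C0u C0p du dp] := solP _ C0F; have [C0u' C0p' du' dp'] := solP _ C0F'.
  have H : helmholtz_solution m (fun x => F x - F' x)
      (fun x => (sol F).1 x - (sol F').1 x) (fun x => (sol F).2 x - (sol F').2 x).
    split; [exact: C0B|exact: C0B|exact: has_derivativeB|].
    by apply: has_derivative_eq (has_derivativeB dp dp') _ => y /=; ring.
  have [/(_ x) uD /(_ x) pD] := helmholtz_bound m0 H FD.
  rewrite /M (_ : _ - _ = b x / a x * ((sol F).2 x - (sol F').2 x) +
    d x * ((sol F).1 x - (sol F').1 x)); last by ring.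
  rewrite (le_trans (ler_normD _ _))//.
  have m20 : 0 < m ^+ 2 by rewrite exprn_gt0.
  have H1 : `|b x / a x * ((sol F).2 x - (sol F').2 x)| <= P * (D / m).
    by rewrite normrM ler_pM//; exact: baP.
  have H2 : `|d x * ((sol F).1 x - (sol F').1 x)| <=
      m ^+ 2 * (1 - theta) * (D / m ^+ 2).
    by rewrite normrM ler_pM//; exact: dP.
  have E : m ^+ 2 * (1 - theta) * (D / m ^+ 2) = (1 - theta) * D.
    by field; rewrite gt_eqF.
  have H3 : P * (D / m) <= theta / 2 * D.
    by rewrite mulrCA mulrC ler_wpM2r.
  by rewrite E in H2; rewrite /r; lra.
(* With [N = G / (a0 (1 - r))] bounding [F], the derivatives are bounded by [N / m] and [2 N]; this
   constant is a common majorant. *)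
exists ((2 * m + 2) / (a0 * (1 - r)) * (1 / m + 1)) => [|g G C0g gG].
  have r1 : 0 < 1 - r by case/andP: r01; lra.
  have am0 : 0 < a0 * (1 - r) by rewrite mulr_gt0.
  have im0 : 0 < 1 / m by rewrite divr_gt0.
  by rewrite mulr_ge0 ?divr_ge0 ?ltW//; lra.
have r1 : 0 < 1 - r by case/andP: r01; lra.
have G0 := bounded_by_ge0 gG.
have [F C0F FE] := contraction_fixpoint r01 (C0ga _ C0g) MC0 Mr.
(* At a maximum point [z] of [|F|] the fixed-point equation gives [|F z| <= G / a0 + r |F z|], using
   that [M] maps 0 to 0. *)
have FB : bounded_by (G / (a0 * (1 - r))) F.
  have [z zmax] := C0_norm_max C0F.
  have C0F0 : C0 (fun=> 0 : R) := C0_0.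
  have H0 : bounded_by `|F z| (fun x => F x - 0) by move=> y; rewrite subr0.
  have M0 x : M (fun=> 0) x = 0.
    have H00 : bounded_by 0 (fun=> 0 : R) by move=> y; rewrite normr0.
    have [/(_ x) u0 /(_ x) p0] := helmholtz_bound m0 (solP _ C0F0) H00.
    rewrite !mul0r !normr_le0 in u0 p0.
    by rewrite /M (eqP u0) (eqP p0) !mulr0 addr0.
  move=> x; apply: le_trans (zmax x) _.
  have := Mr _ _ _ C0F C0F0 H0 z; rewrite M0 subr0 => MF.
  have gz : `|1 / a z * g z| <= G / a0.
    rewrite normrM (_ : G / a0 = 1 / a0 * G); last by ring.
    by rewrite ler_pM//; exact: b1a.
  have : `|F z| <= G / a0 + r * `|F z|.
    by rewrite [F z in leLHS]FE (le_trans (ler_normD _ _))// lerD.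
  rewrite invfM mulrA ler_pdivlMr//; lra.
have [C0u C0p du dp] := solP _ C0F.
have [uB pB] := helmholtz_bound m0 (solP _ C0F) FB.
exists (sol F).1, (sol F).2, (fun x => m ^+ 2 * (sol F).1 x - F x); split=> //.
- set N := G / (a0 * (1 - r)) in FB uB pB.
  have N0 : 0 <= N := bounded_by_ge0 FB.
  have KE : (2 * m + 2) / (a0 * (1 - r)) * (1 / m + 1) * G =
      (2 * m + 2) * (1 / m + 1) * N.
    by rewrite /N; ring.
  have Nm : 0 <= N / m by rewrite divr_ge0// ltW.
  have mN : 0 <= m * N by rewrite mulr_ge0// ltW.
  have E : (2 * m + 2) * (1 / m + 1) * N = 4 * N + 2 * (m * N) + 2 * (N / m).
    by field; rewrite gt_eqF.
  rewrite KE E; split.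
    by apply: bounded_byW pB; lra.
  move=> x; rewrite (le_trans (ler_normB _ _))//.
  have := uB x; rewrite ler_pdivlMr ?exprn_gt0// => ux.
  have := FB x; rewrite normrM (@ger0_norm _ (m ^+ 2)) ?exprn_ge0 ?(ltW m0)//.
  by rewrite [X in X + _]mulrC; lra.
- move=> x; have := FE x; rewrite /M /d => Fx.
  rewrite {1}Fx; have ax := a_gt0 x; field; by rewrite gt_eqF.
Qed.

(** Below the threshold [t] the unknown is [X = (t - L) v], which satisfies
    [X = g + (t - lambda) (t - L)^-1 X]. Since [(t - L)^-1] is bounded by [1 / t], the factor
    [1 - lambda / t] is less than 1 for every [lambda] in [(0, t)], so a single comparison point
    suffices. *)
Lemma resolvent_solvable lambda g : 0 < lambda -> C0 g ->
  exists v w, in_graph v w /\ forall x, lambda * v x - w x = g x.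
Proof.
have large l h : resolvent_threshold <= l -> C0 h ->
    exists v w, in_graph v w /\ forall x, l * v x - w x = h x.
  move=> lP C0h; have [G _ hG] := C0_bounded C0h.
  have [K _ /(_ _ _ C0h hG)[v [p [q [C0v dp dq _ e]]]]] := resolvent_large lP.
  exists v, (fun x => a x * q x + b x * p x + c x * v x); split=> //.
  split=> //; last by exists p, q.
  rewrite (_ : (fun _ => _) = (fun x => l * v x - h x)); last first.
    by apply/funext => x; have := e x; lra.
  exact/C0B/C0h/C0Z.
move=> l0 C0g; have [|lsmall] := leP resolvent_threshold lambda.
  by move=> /large/(_ C0g).
set t := resolvent_threshold in lsmall.
have t0 : 0 < t := lt_le_trans ltr01 resolvent_threshold_ge1.
have /choice[sol solP] : forall h, exists vw : (R -> R) * (R -> R), C0 h ->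
    in_graph vw.1 vw.2 /\ forall x, t * vw.1 x - vw.2 x = h x.
  move=> h; have [C0h|nC0h] := pselect (C0 h); last by exists (h, h).
  by have [v [w H]] := large _ _ (lexx t) C0h; exists (v, w).
pose r := (t - lambda) / t.
have r01 : 0 <= r < 1.
  by rewrite /r divr_ge0 ?ltr_pdivrMr//=; lra.
have [||X C0X XE] := @contraction_fixpoint _
    (fun f x => (t - lambda) * (sol f).1 x) r g r01 C0g.
- by move=> f /solP[[C0f _ _] _]; exact: C0Z.
- move=> f f' D C0f C0f' ffD x.
  have [gf ef] := solP _ C0f; have [gf' ef'] := solP _ C0f'.
  have H : bounded_by D (fun x => t * ((sol f).1 x - (sol f').1 x) -
      ((sol f).2 x - (sol f').2 x)).
    by move=> y; have := ffD y; rewrite -ef -ef'; congr (`|_| <= _); ring.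
  have := resolvent_bound t0 (in_graphB gf gf') H x.
  rewrite -mulrBr normrM ger0_norm; last by lra.
  by rewrite /r -mulrA [t^-1 * D]mulrC => HH; rewrite ler_wpM2l//; lra.
have [gX eX] := solP _ C0X.
exists (sol X).1, (sol X).2; split=> // x.
by have := eX x; rewrite XE; lra.
Qed.

Lemma is_derive_inj (f : R -> R) p q : has_derivative f p -> has_derivative f q ->
  p = q.
Proof.
by move=> fp fq; apply/funext => x; have [_ <-] := fp x; have [_ <-] := fq x.
Qed.

(** [resolvent_large] bounds the derivatives of the solution it constructs; for [t v - w] on the
    right-hand side this solution is [v], by injectivity. *)
Lemma derivative_bound : exists2 K, 0 <= K & forall v w p q V W,
  C0 v -> has_derivative v p -> has_derivative p q ->
  (forall x, w x = a x * q x + b x * p x + c x * v x) -> C0 w ->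
  bounded_by V v -> bounded_by W w ->
  bounded_by (K * (V + W)) p /\ bounded_by (K * (V + W)) q.
Proof.
set t := resolvent_threshold.
have t1 : 1 <= t := resolvent_threshold_ge1.
have t0 : 0 < t := lt_le_trans ltr01 t1.
have [K K0 KP] := resolvent_large (lexx t).
exists (K * t) => [|v w p q V W C0v dp dq e C0w vV wW].
  by rewrite mulr_ge0// ltW.
have C0g : C0 (fun x => t * v x - w x) by exact/C0B/C0w/C0Z.
have gG : bounded_by (t * (V + W)) (fun x => t * v x - w x).
  move=> x; rewrite (le_trans (ler_normB _ _))// normrM gtr0_norm// mulrDr.
  have W0 := bounded_by_ge0 wW.
  rewrite lerD ?ler_pM2l//; apply: le_trans (wW x) _.
  by rewrite ler_peMl.
have [v' [p' [q' [C0v' dp' dq' [pB qB] e']]]] := KP _ _ C0g gG.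
have gr' : in_graph v' (fun x => a x * q' x + b x * p' x + c x * v' x).
  split=> //; last by exists p', q'.
  rewrite (_ : (fun _ => _) = (fun x => t * v' x - (t * v x - w x))); last first.
    by apply/funext => x; have := e' x; lra.
  exact/C0B/C0g/C0Z.
have gr : in_graph v w by split=> //; exists p, q.
have [vv' _] := resolvent_inj t0 gr' gr e'.
have pp' : p = p' by apply: is_derive_inj dp _; rewrite -vv'.
have qq' : q = q' by apply: is_derive_inj dq _; rewrite pp'.
by rewrite pp' qq' -mulrA.
Qed.

End resolvent.

(** * Implicit Euler steps and their dependence on the step size *)

Section implicit_euler.
Context {R : realType}.
Implicit Types (f g h v w : R -> R) (r s t : R).
Variables (a b c : R -> R) (a0 A B C : R).
Hypothesis adm : admissible a b c a0 A B C.
Notation in_graph := (in_graph a b c).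

(* [(I - s L)^-1 h]; for [s = 0], and whenever the equation has no solution,
   this is [h] itself. *)
Definition implicit_step s h : R -> R :=
  xget h [set v | exists2 w, in_graph v w & forall x, v x - s * w x = h x].
Notation J := implicit_step.

Lemma implicit_step0 h : J 0 h = h.
Proof.
rewrite /J; case: xgetP => // v _ [w _ e].
by apply/funext => x; rewrite -e mul0r subr0.
Qed.

Lemma implicit_step_unique s h v w : 0 < s -> in_graph v w ->
  (forall x, v x - s * w x = h x) -> J s h = v.
Proof.
move=> s0 vw e; rewrite /J; case: xgetP => [v' _ [w' vw' e']|]; last first.
  by move=> /(_ v) []; exists w.
have is0 : 0 < s^-1 by rewrite invr_gt0.
have [] // := resolvent_inj adm is0 vw' vw.
move=> x; apply: (mulfI (lt0r_neq0 s0)).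
by rewrite !mulrBr !mulrA divff ?gt_eqF// !mul1r e e'.
Qed.

Lemma implicit_step_graph s h : 0 < s -> C0 h ->
  in_graph (J s h) (fun x => (J s h x - h x) / s).
Proof.
move=> s0 C0h; have is0 : 0 < s^-1 by rewrite invr_gt0.
have [v [w [vw e]]] := resolvent_solvable adm is0 (C0Z s^-1 C0h).
have e' x : v x - s * w x = h x.
  have := congr1 ( *%R s) (e x).
  by rewrite mulrBr !mulrA divff ?gt_eqF// !mul1r.
rewrite (implicit_step_unique s0 vw e') (_ : (fun _ => _) = w)//.
apply/funext => x; rewrite -e'; field; by rewrite gt_eqF.
Qed.

Lemma implicit_step_C0 s h : 0 < s -> C0 h -> C0 (J s h).
Proof. by move=> s0 C0h; have [] := implicit_step_graph s0 C0h. Qed.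

Lemma implicit_step_bound s h H : 0 < s -> C0 h -> bounded_by H h ->
  bounded_by H (J s h).
Proof.
move=> s0 C0h hH; have is0 : 0 < s^-1 by rewrite invr_gt0.
rewrite -[H](_ : H / s / s^-1 = H); last by field; rewrite gt_eqF.
apply: (resolvent_bound adm is0 (implicit_step_graph s0 C0h)) => x.
rewrite (_ : _ - _ = h x / s); last by ring.
by rewrite normrM (gtr0_norm is0) ler_pM2r.
Qed.

Lemma implicit_step_lin s k h h' : 0 < s -> C0 h -> C0 h' ->
  J s (fun x => k * h x + h' x) = (fun x => k * J s h x + J s h' x).
Proof.
move=> s0 C0h C0h'; apply: implicit_step_unique => //.
  by apply: in_graph_lin; exact: implicit_step_graph.
by move=> x /=; field; rewrite gt_eqF.
Qed.

Lemma implicit_stepB s h h' : 0 < s -> C0 h -> C0 h' ->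
  J s (fun x => h x - h' x) = (fun x => J s h x - J s h' x).
Proof.
move=> s0 C0h C0h'.
rewrite (_ : (fun _ => _) = (fun x => -1 * h' x + h x)); last first.
  by apply/funext => x; ring.
by rewrite implicit_step_lin//; apply/funext => x; ring.
Qed.

(** [u = L J_s v] is a combination of [J_s v] and [v], hence in the domain, with
    [L u = (u - w) / s]; this says [u = J_s w]. *)
Lemma implicit_step_comm s v w : 0 < s -> in_graph v w ->
  in_graph (J s v) (J s w) /\ forall x, J s v x - v x = s * J s w x.
Proof.
move=> s0 vw; have [C0v C0w _] := vw.
pose u x := (J s v x - v x) / s.
have Jvu : in_graph (J s v) u by exact: implicit_step_graph.
have uE : J s w = u.
  apply: (@implicit_step_unique s w u (fun x => s^-1 * (u x - w x))) => //.
    have := in_graphZ s^-1 (in_graphB Jvu vw).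
    rewrite (_ : (fun x => s^-1 * (J s v x - v x)) = u)//.
    by apply/funext => x; rewrite /u mulrC.
  by move=> x; field; rewrite gt_eqF.
rewrite uE; split => // x; rewrite /u; field; by rewrite gt_eqF.
Qed.

(** The resolvent identity, with [L] moved onto [v]. *)
Lemma implicit_step_diff r s v w : 0 < r -> 0 < s -> in_graph v w ->
  forall x, J r v x - J s v x = (r - s) * J r (J s w) x.
Proof.
move=> r0 s0 vw; have [C0v C0w _] := vw.
have [Jvw e] := implicit_step_comm s0 vw.
have C0y := implicit_step_C0 s0 C0w.
have gy := implicit_step_graph r0 C0y.
have -> : J r v = (fun x => (r - s) * J r (J s w) x + J s v x).
  apply: (implicit_step_unique r0 (in_graph_lin (r - s) gy Jvw)) => x.
  have := e x; set y := J s w x; set z := J r (J s w) x => ex.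
  rewrite (_ : v x = J s v x - s * y); last by lra.
  by field; rewrite gt_eqF.
by move=> x; rewrite addrK.
Qed.

Lemma implicit_step_lipschitz r s v w W : 0 < r -> 0 < s -> in_graph v w ->
  bounded_by W w -> bounded_by (`|r - s| * W) (fun x => J r v x - J s v x).
Proof.
move=> r0 s0 vw wW x; have [C0v C0w _] := vw.
rewrite (implicit_step_diff r0 s0 vw) normrM ler_wpM2l//.
by apply: implicit_step_bound => //;
  [exact: implicit_step_C0|exact: implicit_step_bound].
Qed.

Lemma implicit_stepZ s k h : 0 < s -> C0 h ->
  J s (fun x => k * h x) = (fun x => k * J s h x).
Proof.
move=> s0 C0h; apply: implicit_step_unique => //.
  exact/in_graphZ/implicit_step_graph.
by move=> x /=; field; rewrite gt_eqF.
Qed.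

Notation Jn n s := (iter n (J s)).

Lemma implicit_steps_graph n s v w : 0 < s -> in_graph v w ->
  in_graph (Jn n s v) (Jn n s w).
Proof.
move=> s0 vw; elim: n => //= n IH.
by have [] := implicit_step_comm s0 IH.
Qed.

Lemma implicit_steps_C0 n s h : 0 < s -> C0 h -> C0 (Jn n s h).
Proof. by move=> s0 C0h; elim: n => //= n; exact: implicit_step_C0. Qed.

Lemma implicit_steps_bound n s h H : 0 < s -> C0 h -> bounded_by H h ->
  bounded_by H (Jn n s h).
Proof.
move=> s0 C0h hH; elim: n => //= n IH; apply: implicit_step_bound => //.
exact: implicit_steps_C0.
Qed.

Lemma implicit_stepsB n s h h' : 0 < s -> C0 h -> C0 h' ->
  Jn n s (fun x => h x - h' x) = (fun x => Jn n s h x - Jn n s h' x).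
Proof.
move=> s0 C0h C0h'; elim: n => //= n ->.
by rewrite implicit_stepB//; exact: implicit_steps_C0.
Qed.

Lemma implicit_steps0 n h : Jn n 0 h = h.
Proof. by elim: n => //= n ->; exact: implicit_step0. Qed.

Lemma implicit_steps_lipschitz n r s v w W : 0 <= r -> 0 <= s ->
  in_graph v w -> bounded_by W w ->
  bounded_by (n%:R * (`|r - s| * W)) (fun x => Jn n r v x - Jn n s v x).
Proof.
have step0 t v' w' : 0 < t -> in_graph v' w' -> bounded_by W w' ->
    bounded_by (t * W) (fun x => J t v' x - v' x).
  move=> t0 vw wW x; have [_ ->] := implicit_step_comm t0 vw.
  rewrite normrM gtr0_norm// ler_pM2l//; have [_ C0w' _] := vw.
  exact: implicit_step_bound.
have steps0 t v' w' : 0 < t -> in_graph v' w' -> bounded_by W w' ->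
    bounded_by (n%:R * (t * W)) (fun x => Jn n t v' x - v' x).
  move=> t0 vw wW; elim: n => [|m IH] x /=; first by rewrite subrr normr0 mul0r.
  rewrite (_ : _ - _ = (J t (Jn m t v') x - Jn m t v' x) + (Jn m t v' x - v' x));
    last by ring.
  rewrite (le_trans (ler_normD _ _))// -natr1 mulrDl mul1r addrC lerD//.
  apply: (step0 _ _ _ t0 (implicit_steps_graph m t0 vw)).
  by apply: implicit_steps_bound => //; case: vw.
(* Step size 0 is treated apart, as [J 0] is the identity while the estimates on [J] ask for a
   positive step; it is needed for continuity at time 0. *)
rewrite [0 <= r]le_eqVlt [0 <= s]le_eqVlt => /predU1P[<-|r0] /predU1P[<-|s0] vw wW x.
- by rewrite !implicit_steps0 !subrr !normr0 mul0r mulr0.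
- rewrite /= implicit_steps0 sub0r normrN (gtr0_norm s0) distrC; exact: steps0 vw wW x.
- by rewrite /= implicit_steps0 subr0 (gtr0_norm r0); exact: steps0 vw wW x.
have [C0v C0w _] := vw.
elim: n x {steps0} => [|n IH] x /=; first by rewrite subrr normr0 mul0r.
rewrite (_ : _ - _ = (J r (Jn n r v) x - J r (Jn n s v) x) +
  (J r (Jn n s v) x - J s (Jn n s v) x)); last by ring.
rewrite (le_trans (ler_normD _ _))// -natr1 mulrDl mul1r lerD//.
  have := @implicit_step_bound r (fun x => Jn n r v x - Jn n s v x) _ r0 _ IH x.
  rewrite implicit_stepB//; [|exact: implicit_steps_C0..].
  by apply; apply: C0B; exact: implicit_steps_C0.
apply: (implicit_step_lipschitz r0 s0 (implicit_steps_graph n s0 vw)).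
exact: implicit_steps_bound.
Qed.

(* The derivative of [s |-> (I - s L)^-n h] is [n (I - s L)^-(n+1) L h]. *)
Lemma implicit_steps_expansion n r s h h1 h2 H : 0 < r -> 0 < s ->
  in_graph h h1 -> in_graph h1 h2 -> bounded_by H h2 ->
  bounded_by (n%:R ^+ 2 * H * (r - s) ^+ 2)
    (fun x => Jn n r h x - Jn n s h x - (r - s) * n%:R * Jn n.+1 s h1 x).
Proof.
move=> r0 s0 hh1 h1h2 hH; have [C0h C0h1 _] := hh1; have [_ C0h2 _] := h1h2.
have H0 := bounded_by_ge0 hH.
elim: n => [|n IH] x.
  by rewrite /= subrr mulr0 mul0r subr0 normr0 expr0n/= !mul0r.
(* [E] is the remainder for [n]. Applying [J r] keeps its bound, and the new error
   [(r - s) (n + 1) (J_r - J_s) J_s^(n+1) h1] is at most [(n + 1) H (r - s)^2]; finally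
   [n^2 + (n + 1) <= (n + 1)^2]. *)
pose E x := Jn n r h x - Jn n s h x - (r - s) * n%:R * Jn n.+1 s h1 x.
have C0n q' g m : 0 < q' -> C0 g -> C0 (Jn m q' g) by exact: implicit_steps_C0.
have JE : J r E x = J r (Jn n r h) x - J r (Jn n s h) x -
    (r - s) * n%:R * J r (Jn n.+1 s h1) x.
  rewrite /E implicit_stepB//; [|exact/C0B/C0n/C0h/s0/C0n|exact/C0Z/C0n].
  rewrite implicit_stepB//; [|exact: C0n..].
  by rewrite implicit_stepZ//; exact: C0n.
have EB : `|J r E x| <= n%:R ^+ 2 * H * (r - s) ^+ 2.
  apply: implicit_step_bound => //; apply: C0B; last exact/C0Z/C0n.
  by apply: C0B; exact: C0n.
have D1 := implicit_step_diff r0 s0 (implicit_steps_graph n s0 hh1) x.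
have D2 := @implicit_step_lipschitz r s _ _ H r0 s0
  (implicit_steps_graph n.+1 s0 h1h2) (implicit_steps_bound n.+1 s0 C0h2 hH) x.
rewrite (_ : _ - _ = J r E x + (r - s) * (n%:R + 1) *
    (J r (Jn n.+1 s h1) x - J s (Jn n.+1 s h1) x)); last first.
  rewrite JE -natr1 [Jn n.+1 r h]iterS [Jn n.+1 s h]iterS [Jn n.+2 s h1]iterS.
  rewrite (_ : J s (Jn n s h) x =
    J r (Jn n s h) x - (r - s) * J r (J s (Jn n s h1)) x); last by lra.
  by rewrite [Jn n.+1 s h1]iterS; ring.
rewrite (le_trans (ler_normD _ _))//.
have -> : n.+1%:R ^+ 2 * H * (r - s) ^+ 2 = n%:R ^+ 2 * H * (r - s) ^+ 2 +
   (n%:R + n%:R + 1) * H * (r - s) ^+ 2 by rewrite -natr1; ring.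
rewrite lerD// !normrM.
have n0 : 0 <= n%:R :> R by [].
apply: (@le_trans _ _ (`|r - s| * (n%:R + 1) * (`|r - s| * H))).
  rewrite (@ger0_norm _ (n%:R + 1)) ?addr_ge0//.
  by rewrite ler_wpM2l// mulr_ge0// addr_ge0.
rewrite (_ : _ * (_ * H) = (n%:R + 1) * H * `|r - s| ^+ 2); last by ring.
rewrite real_normK ?num_real// ler_wpM2r ?sqr_ge0// ler_wpM2r//.
by lra.
Qed.

Lemma is_derive_quadratic f (d D s : R) : 0 < s -> 0 <= D ->
  (forall r, 0 < r -> `|f r - f s - (r - s) * d| <= D * (r - s) ^+ 2) ->
  is_derive s (1 : R) f d.
Proof.
move=> s0 D0 fD.
have H : h^-1 *: (f (h *: 1 + s) - f s) @[h --> (0:R)^'] --> d.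
  apply/cvgrPdist_le => e e0.
  have D1 : 0 < D + 1 by lra.
  (* The bound by [s] keeps [h + s] positive, where the expansion is assumed. *)
  exists (Num.min s (e / (D + 1))) => /=; first by rewrite lt_min s0 divr_gt0.
  move=> h /=; rewrite sub0r normrN lt_min => /andP[hs he] h0.
  have r0 : 0 < h + s by move: hs; rewrite ltr_norml; lra.
  rewrite /GRing.scale /= mulr1.
  rewrite (_ : d - _ = - h^-1 * (f (h + s) - f s - h * d)); last by field.
  rewrite normrM normrN normfV mulrC ler_pdivrMr ?normr_gt0//.
  have := fD _ r0; rewrite addrK => /le_trans; apply.
  rewrite -(real_normK (num_real h)) expr2 mulrA ler_wpM2r//.
  move: he; rewrite ltr_pdivlMr// => he.
  have : 0 <= `|h| by [].
  by lra.
split; first by apply/cvg_ex; exists d.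
by apply/cvg_lim => //; exact: Rhausdorff.
Qed.

End implicit_euler.

(** * Gaussian means and moments *)

Section gaussian_moments.
Context {R : realType}.
Notation mu := (@lebesgue_measure R).
Implicit Types (m s y : R) (f F : R -> R).

(** Gives the first two moments of the normal density [N]: [(y - m) N] and [(s^2 - (y - m)^2) N] are
    the derivatives of [- s^2 N] and [s^2 (y - m) N]. *)
Lemma integral_derivative0 F f m (K : R) : has_derivative F f -> continuous f ->
  mu.-integrable setT (EFin \o f) ->
  (forall n, `|F (m + n.+1%:R)| <= K / n.+1%:R) ->
  (forall n, `|F (m - n.+1%:R)| <= K / n.+1%:R) ->
  (\int[mu]_y f y)%R = 0.
Proof.
move=> dF cf iF Fp Fm.
pose I n : set R := `[m - n.+1%:R, m + n.+1%:R].
pose g n := (EFin \o f) \_ (I n).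
have gE n : (\int[mu]_y g n y = (F (m + n.+1%:R) - F (m - n.+1%:R))%:E)%E.
  rewrite /g -integral_mkcond (@continuous_FTC2 _ f F) ?EFinB//.
  - by rewrite ltrD2l gtrN.
  - exact: continuous_subspaceT.
  - have cF := has_derivative_continuous dF.
    split; [|by apply: cvg_at_right_filter; exact: cF|by apply: cvg_at_left_filter; exact: cF].
    by move=> x _; exact: (has_derivativeP x dF).1.
  - by move=> x _; exact: (has_derivativeP x dF).2.
have mf : measurable_fun setT (EFin \o f).
  by apply/measurable_EFinP; exact: continuous_measurable_fun.
have cvgg : (\int[mu]_y g n y)%E @[n --> \oo] --> (\int[mu]_y (f y)%:E)%E.
  apply: (@dominated_cvg _ _ _ mu setT measurableT g (EFin \o f) (abse \o EFin \o f)).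
  - move=> n; apply/(measurable_restrictT _ _).1; first exact: measurable_itv.
    exact: measurable_funS mf.
  - move=> x _; apply: cvg_near_cst; near=> n.
    rewrite /g patchE ifT// inE /I /= in_itv/=.
    have : `|x - m| <= n.+1%:R.
      apply: (@le_trans _ _ n%:R); last by rewrite ler_nat.
      by near: n; exact: nbhs_infty_ger.
    by rewrite ler_norml; lra.
  - by [].
  - exact: integrable_abse.
  - move=> n x _; rewrite /g patchE; case: ifPn => // _.
    by rewrite abse0 abse_ge0.
have cvg0 : (\int[mu]_y g n y)%E @[n --> \oo] --> 0%:E.
  rewrite (_ : (fun n => _) = (fun n => (F (m + n.+1%:R) - F (m - n.+1%:R))%:E)); last first.
    by apply/funext => n; exact: gE.
  apply: cvg_EFin; first by apply: nearW.
  rewrite (_ : fine \o _ = (fun n => F (m + n.+1%:R) - F (m - n.+1%:R)))//.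
  apply/norm_cvg0P.
  apply: (@squeeze_cvgr _ _ _ _ (fun=> 0) (fun n => 2 * K * n.+1%:R^-1)).
  - near=> n; rewrite normr_ge0/= (le_trans (ler_normB _ _))//.
    rewrite (_ : 2 * K * _ = K / n.+1%:R + K / n.+1%:R); last by ring.
    by rewrite lerD.
  - exact: cvg_cst.
  - rewrite -(mulr0 (2 * K)); apply: cvgMr; exact: cvg_harmonic.
rewrite /Rintegral.
by have -> := cvg_unique _ cvgg cvg0.
Unshelve. all: by end_near.
Qed.

Lemma normal_pdf_expE m s y : 0 < s ->
  normal_pdf m s y = normal_peak s * expR (- (y - m) ^+ 2 / (s ^+ 2 *+ 2)).
Proof. by move=> s0; rewrite normal_pdfE ?gt_eqF. Qed.

Lemma normal_pdf_derivative m s : 0 < s ->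
  has_derivative (normal_pdf m s)
    (fun y => - (y - m) / s ^+ 2 * normal_pdf m s y).
Proof.
move=> s0; have s2 : 0 < s ^+ 2 by rewrite exprn_gt0.
rewrite (_ : normal_pdf m s = (fun y => normal_peak s *
    expR ((- (s ^+ 2 *+ 2)^-1) * ((y - m) * (y - m))))); last first.
  apply/funext => y; rewrite normal_pdf_expE//; congr (_ * expR _).
  by rewrite expr2 mulr2n; field; rewrite gt_eqF//; lra.
have dy := has_derivativeB (@has_derivative_id R) (has_derivative_cst m).
have dyy := has_derivativeZ (- (s ^+ 2 *+ 2)^-1) (has_derivativeM dy dy).
have dexp : has_derivative (@expR R) (@expR R).
  by move=> x; exact: is_derive_expR.
have := has_derivativeZ (normal_peak s) (has_derivative_comp dexp dyy).
move=> /has_derivative_eq; apply => y /=.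
by rewrite mulr2n; field; rewrite gt_eqF//; lra.
Qed.

Lemma sqrt2_lt2 : Num.sqrt 2 < 2 :> R.
Proof.
rewrite -(@ltr_pXn2r _ 2) ?nnegrE// sqr_sqrtr//; lra.
Qed.

(* [w^2 <= 2 e^w] trades the polynomial for a doubling of the variance. *)
Lemma normal_pdf_pow4 m s y : 0 < s ->
  (y - m) ^+ 4 * normal_pdf m s y <=
  64 * s ^+ 4 * normal_pdf m (s * Num.sqrt 2) y.
Proof.
move=> s0; have s2 : 0 < s ^+ 2 by rewrite exprn_gt0.
have q0 : 0 < Num.sqrt 2 :> R by rewrite sqrtr_gt0.
have q2 : Num.sqrt 2 ^+ 2 = 2 :> R by rewrite sqr_sqrtr.
rewrite !normal_pdf_expE ?mulr_gt0//.
(* The exponent is [- 2 w] for the original variance and [- w] for the doubled one, so one factor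
   [e^(-w)] is left to absorb [w^2]. *)
pose w := (y - m) ^+ 2 / (s ^+ 2 *+ 4).
have w0 : 0 <= w by rewrite divr_ge0 ?sqr_ge0// mulrn_wge0// ltW.
have -> : - (y - m) ^+ 2 / (s ^+ 2 *+ 2) = - w - w.
  by rewrite /w !mulr2n !mulrS mulr0n; field; rewrite gt_eqF//; lra.
have -> : - (y - m) ^+ 2 / ((s * Num.sqrt 2) ^+ 2 *+ 2) = - w.
  by rewrite /w exprMn q2 !mulr2n !mulrS mulr0n; field; rewrite gt_eqF//; lra.
have -> : (y - m) ^+ 4 = 16 * s ^+ 4 * w ^+ 2.
  by rewrite /w !mulrS mulr0n; field; rewrite gt_eqF//; lra.
have -> : normal_peak (s * Num.sqrt 2) = normal_peak s / Num.sqrt 2.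
  rewrite /normal_peak -invfM; congr (_^-1).
  rewrite exprMn (_ : _ *+ 2 = (s ^+ 2 * pi *+ 2) * Num.sqrt 2 ^+ 2).
    rewrite sqrtrM; last by rewrite mulrn_wge0// mulr_ge0 ?ltW// pi_gt0.
    by rewrite sqrtr_sqr ger0_norm// ltW.
  by rewrite mulr2n; ring.
have pk0 := normal_peak_ge0 s.
rewrite expRD.
have we : w ^+ 2 * expR (- w) <= 2.
  rewrite expRN ler_pdivrMr ?expR_gt0//.
  by have := @expR_ge1Dxn R w 1 w0; rewrite (_ : 2`! = 2)%N//; lra.
apply: (@le_trans _ _ (32 * s ^+ 4 * normal_peak s * expR (- w))).
  rewrite (_ : _ * (normal_peak s * _) = (w ^+ 2 * expR (- w)) *
     (16 * s ^+ 4 * normal_peak s * expR (- w))); last by ring.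
  rewrite (_ : 32 * _ * _ * _ = 2 * (16 * s ^+ 4 * normal_peak s * expR (- w)));
    last by ring.
  rewrite ler_wpM2r// mulr_ge0 ?expR_ge0// mulr_ge0// mulr_ge0// exprn_ge0//.
  exact: ltW.
rewrite (_ : 64 * _ * _ = (64 / Num.sqrt 2) * (s ^+ 4 * normal_peak s * expR (- w)));
  last by ring.
rewrite (_ : 32 * _ * _ * _ = 32 * (s ^+ 4 * normal_peak s * expR (- w)));
  last by ring.
rewrite ler_wpM2r//.
  by rewrite mulr_ge0 ?expR_ge0// mulr_ge0// exprn_ge0// ltW.
by rewrite ler_pdivlMr//; have := sqrt2_lt2; lra.
Qed.

Definition gauss_mean m s f : R := (\int[mu]_y (normal_pdf m s y * f y))%R.

Lemma integrable_normal_pow4 m s (K : R) : 0 < s ->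
  mu.-integrable setT
    (EFin \o (fun y => normal_pdf m s y * (K * (1 + (y - m) ^+ 4)))).
Proof.
move=> s0; have s20 : 0 < s * Num.sqrt 2 by rewrite mulr_gt0// sqrtr_gt0.
have i1 := integrable_normal_pdf m s.
have i2 := integrableZl measurableT (64 * s ^+ 4) (integrable_normal_pdf m (s * Num.sqrt 2)).
have i3 : mu.-integrable setT (EFin \o
    (fun y => `|K| * (normal_pdf m s y + 64 * s ^+ 4 * normal_pdf m (s * Num.sqrt 2) y))).
  by have := integrableZl measurableT `|K| (integrableD measurableT i1 i2).
have ci : continuous (fun y => normal_pdf m s y * (K * (1 + (y - m) ^+ 4))).
  move=> y; apply: cvgM; first by apply: continuous_normal_pdf; rewrite gt_eqF.
  apply: cvgM; first exact: cvg_cst.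
  apply: cvgD; first exact: cvg_cst.
  apply: (@cvg_comp _ _ _ (fun y => y - m) (fun y => y ^+ 4)); last exact: exprn_continuous.
  by apply: cvgB; [exact: cvg_id|exact: cvg_cst].
apply: (integrable_dominated (mu := mu) measurableT _ i3).
  exact: continuous_measurable_fun.
move=> y _; have p0 := normal_pdf_ge0 m s y.
have y4 : 0 <= (y - m) ^+ 4 by rewrite exprn_even_ge0.
rewrite !normrM (ger0_norm p0) (@ger0_norm _ (1 + _)) ?addr_ge0//.
rewrite mulrCA ler_wpM2l// mulrDr mulr1 lerD2l mulrC.
exact: normal_pdf_pow4.
Qed.

Lemma gauss_integrable m s f (K : R) : 0 < s -> measurable_fun setT f ->
  (forall y, `|f y| <= K * (1 + (y - m) ^+ 4)) ->
  mu.-integrable setT (EFin \o (fun y => normal_pdf m s y * f y)).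
Proof.
move=> s0 mf fK; apply: (integrable_dominated (mu := mu) measurableT _
  (integrable_normal_pow4 m K s0)).
  by apply: measurable_funM => //; exact: measurable_normal_pdf.
move=> y _; rewrite normrM (ger0_norm (normal_pdf_ge0 _ _ _)).
by rewrite ler_wpM2l// normal_pdf_ge0.
Qed.

Lemma gauss_integrable_bounded m s f (K : R) : 0 < s -> measurable_fun setT f ->
  bounded_by K f -> mu.-integrable setT (EFin \o (fun y => normal_pdf m s y * f y)).
Proof.
move=> s0 mf fK; have K0 := bounded_by_ge0 fK.
apply: (@gauss_integrable _ _ _ K) => // y; apply: le_trans (fK y) _.
by rewrite ler_peMr// lerDl exprn_even_ge0.
Qed.

Lemma gauss_mean_cst m s (k : R) : 0 < s -> gauss_mean m s (fun=> k) = k.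
Proof.
move=> s0; rewrite /gauss_mean RintegralZr//; last exact: integrable_normal_pdf.
by rewrite /Rintegral integral_normal_pdf /= mul1r.
Qed.

Lemma gauss_mean_norm m s f g :
  mu.-integrable setT (EFin \o (fun y => normal_pdf m s y * f y)) ->
  mu.-integrable setT (EFin \o (fun y => normal_pdf m s y * g y)) ->
  (forall y, `|f y| <= g y) -> `|gauss_mean m s f| <= gauss_mean m s g.
Proof.
move=> iF iG fg; have mf : measurable_fun setT (fun y => normal_pdf m s y * f y).
  by apply/measurable_EFinP; case/integrableP: iF.
apply: (@le_Rintegral_dominated _ _ _ mu _ _ _ measurableT mf iG) => y _.
rewrite normrM (ger0_norm (normal_pdf_ge0 _ _ _)).
by rewrite ler_wpM2l// normal_pdf_ge0.
Qed.

Lemma gauss_mean_lin m s k f g :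
  mu.-integrable setT (EFin \o (fun y => normal_pdf m s y * f y)) ->
  mu.-integrable setT (EFin \o (fun y => normal_pdf m s y * g y)) ->
  gauss_mean m s (fun y => k * f y + g y) = k * gauss_mean m s f + gauss_mean m s g.
Proof.
move=> iF iG; rewrite /gauss_mean -RintegralZl// -RintegralD//; last first.
  exact: (integrableZl measurableT k iF).
by apply: eq_Rintegral => y _; ring.
Qed.

Lemma gauss_integrable_lin m s k f g :
  mu.-integrable setT (EFin \o (fun y => normal_pdf m s y * f y)) ->
  mu.-integrable setT (EFin \o (fun y => normal_pdf m s y * g y)) ->
  mu.-integrable setT (EFin \o (fun y => normal_pdf m s y * (k * f y + g y))).
Proof.
move=> iF iG.
rewrite (_ : (fun y => _) = (fun y => k * (normal_pdf m s y * f y) + normal_pdf m s y * g y)).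
  exact: (integrableD measurableT (integrableZl measurableT k iF) iG).
by apply/funext => y; ring.
Qed.

Lemma measurable_center m n : measurable_fun setT (fun y : R => (y - m) ^+ n).
Proof.
apply: measurable_funX; apply: measurable_funB => //.
Qed.

Lemma pow_le_pow4 (z : R) n : (n <= 4)%N -> `|z ^+ n| <= 1 + z ^+ 4.
Proof.
move=> n4; rewrite normrX.
have z4 : z ^+ 4 = `|z| ^+ 4 by rewrite -normrX ger0_norm// exprn_even_ge0.
have [z1|z1] := leP `|z| 1.
  rewrite -[leLHS]addr0 lerD ?exprn_even_ge0//; exact: exprn_ile1.
rewrite z4 -[leLHS]add0r lerD// ler_eXn2l//.
Qed.

Lemma gauss_integrable_pow m s n : 0 < s -> (n <= 4)%N ->
  mu.-integrable setT (EFin \o (fun y => normal_pdf m s y * (y - m) ^+ n)).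
Proof.
move=> s0 n4; apply: (@gauss_integrable _ _ _ 1) => //.
  exact: measurable_center.
by move=> y; rewrite mul1r pow_le_pow4.
Qed.

(** The exact value is [3 s^4]; the order in [s] is all that matters below. *)
Lemma gauss_mean_pow4 m s : 0 < s ->
  gauss_mean m s (fun y => (y - m) ^+ 4) <= 64 * s ^+ 4.
Proof.
move=> s0.
have i2 := integrable_normal_pdf m (s * Num.sqrt 2).
have -> : 64 * s ^+ 4 = (\int[mu]_y (64 * s ^+ 4 * normal_pdf m (s * Num.sqrt 2) y))%R.
  by rewrite RintegralZl// /Rintegral integral_normal_pdf mulr1.
apply: le_Rintegral => //.
- exact: gauss_integrable_pow.
- exact: (integrableZl measurableT _ i2).
- by move=> y _; rewrite mulrC; exact: normal_pdf_pow4.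
Qed.

Lemma normal_pdf_pow_decay m s n k : 0 < s -> (k <= 3)%N ->
  `|normal_pdf m s (m + n.+1%:R) * n.+1%:R ^+ k| <=
     (64 * s ^+ 4 * normal_peak (s * Num.sqrt 2)) / n.+1%:R.
Proof.
move=> s0 k3; have n1 : 1 <= n.+1%:R :> R by rewrite ler1n.
have n0 : 0 < n.+1%:R :> R by [].
have := @normal_pdf_pow4 m s (m + n.+1%:R) s0.
rewrite addrAC subrr add0r => H.
rewrite ger0_norm; last by rewrite mulr_ge0 ?normal_pdf_ge0// exprn_ge0// ltW.
rewrite ler_pdivlMr//.
rewrite (_ : _ * n.+1%:R = normal_pdf m s (m + n.+1%:R) * n.+1%:R ^+ k.+1); last first.
  by rewrite exprSr mulrA.
apply: (@le_trans _ _ (normal_pdf m s (m + n.+1%:R) * n.+1%:R ^+ 4)).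
  by rewrite ler_wpM2l ?normal_pdf_ge0// ler_weXn2l.
rewrite mulrC; apply: le_trans H _.
rewrite ler_wpM2l ?mulr_ge0 ?exprn_ge0 ?(ltW s0)//.
by apply: normal_pdf_ub; rewrite mulf_neq0// gt_eqF// sqrtr_gt0.
Qed.

Lemma normal_pdf_sym m s z : 0 < s -> normal_pdf m s (m - z) = normal_pdf m s (m + z).
Proof.
move=> s0; rewrite (normal_pdf_expE m (m - z) s0) (normal_pdf_expE m (m + z) s0).
by rewrite (_ : (m - z - m) ^+ 2 = (m + z - m) ^+ 2)//; ring.
Qed.

Lemma gauss_mean_pow1 m s : 0 < s -> gauss_mean m s (fun y => y - m) = 0.
Proof.
move=> s0; have s2 : 0 < s ^+ 2 by rewrite exprn_gt0.
have dN := has_derivativeZ (- s ^+ 2) (normal_pdf_derivative m s0).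
have d1 : has_derivative (fun y => - s ^+ 2 * normal_pdf m s y)
    (fun y => normal_pdf m s y * (y - m)).
  by apply: has_derivative_eq dN _ => y; field; rewrite gt_eqF.
rewrite /gauss_mean.
apply: (@integral_derivative0 _ _ m (s ^+ 2 * (64 * s ^+ 4 * normal_peak (s * Num.sqrt 2))) d1).
- move=> y; apply: cvgM; first by apply: continuous_normal_pdf; rewrite gt_eqF.
  by apply: cvgB; [exact: cvg_id|exact: cvg_cst].
- by have := @gauss_integrable_pow m s 1 s0 isT.
- move=> n; rewrite normrM normrN (gtr0_norm s2) -mulrA ler_pM2l//.
  by have := @normal_pdf_pow_decay m s n 0 s0 isT; rewrite expr0 mulr1.
- move=> n; rewrite normal_pdf_sym// normrM normrN (gtr0_norm s2) -mulrA ler_pM2l//.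
  by have := @normal_pdf_pow_decay m s n 0 s0 isT; rewrite expr0 mulr1.
Qed.

Lemma gauss_mean_pow2 m s : 0 < s ->
  gauss_mean m s (fun y => (y - m) ^+ 2) = s ^+ 2.
Proof.
move=> s0; have s2 : 0 < s ^+ 2 by rewrite exprn_gt0.
have i2 := @gauss_integrable_pow m s 2 s0 isT.
have i1 : mu.-integrable setT (EFin \o (fun y => normal_pdf m s y * s ^+ 2)).
  apply: (@gauss_integrable_bounded m s (fun=> s ^+ 2) (s ^+ 2)) => // y.
  by rewrite gtr0_norm.
suff : gauss_mean m s (fun y => -1 * (y - m) ^+ 2 + s ^+ 2) = 0.
  by rewrite (gauss_mean_lin (-1) i2 i1) (gauss_mean_cst m (s ^+ 2) s0); lra.
have dy := has_derivativeB (@has_derivative_id R) (has_derivative_cst m).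
have dM := has_derivativeM (has_derivativeZ (s ^+ 2) dy) (normal_pdf_derivative m s0).
have d1 : has_derivative (fun y => s ^+ 2 * (y - m) * normal_pdf m s y)
    (fun y => normal_pdf m s y * (-1 * (y - m) ^+ 2 + s ^+ 2)).
  by apply: has_derivative_eq dM _ => y /=; field; rewrite gt_eqF.
rewrite /gauss_mean.
apply: (@integral_derivative0 _ _ m (s ^+ 2 * (64 * s ^+ 4 * normal_peak (s * Num.sqrt 2))) d1).
- move=> y; apply: cvgM; first by apply: continuous_normal_pdf; rewrite gt_eqF.
  apply: cvgD; last exact: cvg_cst.
  apply: cvgM; first exact: cvg_cst.
  apply: (@cvg_comp _ _ _ (fun y => y - m) (fun y => y ^+ 2)); last exact: exprn_continuous.
  by apply: cvgB; [exact: cvg_id|exact: cvg_cst].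
- exact: gauss_integrable_lin.
- move=> n; rewrite addrAC subrr add0r -mulrA normrM (gtr0_norm s2) -mulrA ler_pM2l//.
  by have := @normal_pdf_pow_decay m s n 1 s0 isT; rewrite expr1 mulrC.
- move=> n; rewrite normal_pdf_sym// addrAC subrr add0r.
  rewrite mulrN mulNr normrN -mulrA normrM (gtr0_norm s2) -mulrA ler_pM2l//.
  by have := @normal_pdf_pow_decay m s n 1 s0 isT; rewrite expr1 mulrC.
Qed.

End gaussian_moments.

(** * The one-step operator: Taylor expansion and measurability *)

Section chernoff_function.
Context {R : realType}.
Notation mu := (@lebesgue_measure R).
Implicit Types (a b c f g h v w p q : R -> R) (r s t x y : R).

(* For [s > 0] this is the Gaussian density with mean [x + s b(x)] and variance
   [2 s a(x)]; powers are used instead of inverses so that measurability in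
   [(s, x, y)] is immediate. *)
Definition heat_kernel a b s x y :=
  (4 * pi * s * a x) `^ (- 2^-1) *
  expR (- ((y - x - b x * s) ^+ 2 * (4 * s * a x) `^ (- 1))).

Definition chernoff_step a b c s v x :=
  expR (s * c x) * (\int[mu]_y (heat_kernel a b s x y * v y))%R.

Lemma heat_kernelE a b s x y : 0 < s -> 0 < a x ->
  heat_kernel a b s x y = normal_pdf (x + b x * s) (Num.sqrt (2 * s * a x)) y.
Proof.
move=> s0 ax; have sa : 0 < 2 * s * a x by rewrite !mulr_gt0.
rewrite normal_pdf_expE ?sqrtr_gt0// /normal_peak sqr_sqrtr ?(ltW sa)//.
rewrite /heat_kernel; congr (_ * expR _).
  have -> : 4 * pi * s * a x = 2 * s * a x * pi *+ 2 by rewrite mulr2n; ring.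
  have pos : 0 <= 2 * s * a x * pi *+ 2.
    by rewrite mulrn_wge0// mulr_ge0 ?pi_ge0// ltW.
  by rewrite powRN powR12_sqrt.
rewrite powR_inv1; last by rewrite !mulr_ge0// ltW.
rewrite mulNr; congr (- (_ * _^-1)); first by congr (_ ^+ 2); ring.
by rewrite mulr2n; ring.
Qed.

Lemma chernoff_stepE a b c s v x : 0 < s -> 0 < a x ->
  chernoff_step a b c s v x =
  expR (s * c x) * gauss_mean (x + b x * s) (Num.sqrt (2 * s * a x)) v.
Proof.
move=> s0 ax; congr (_ * _); apply: eq_Rintegral => y _.
by rewrite heat_kernelE.
Qed.

(** The mean value theorem is applied to the remainder and then to [p], so that only the modulus of
    continuity of [q] enters. *)
Lemma taylor2 v p q x y (e M : R) : has_derivative v p -> has_derivative p q ->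
  (forall x y, `|q x - q y| <= e + M * `|x - y|) -> 0 <= M ->
  `|v y - v x - p x * (y - x) - 2^-1 * q x * (y - x) ^+ 2| <=
  (e + M * `|y - x|) * (y - x) ^+ 2.
Proof.
move=> dv dp qM M0.
have di := has_derivativeB (@has_derivative_id R) (has_derivative_cst x).
have d1 := has_derivativeB (has_derivativeB dv (has_derivative_cst (v x)))
   (has_derivativeZ (p x) di).
have d2 := has_derivativeB d1 (has_derivativeZ (2^-1 * q x) (has_derivativeM di di)).
have [z zx] := mean_value_sym x y d2.
rewrite !subrr !(mulr0, mul0r) !subr0 -expr2 => ->.
have [xi xiz e2] := mean_value_sym x z dp.
rewrite (_ : p z - _ - _ = (q xi - q x) * (z - x)); last first.
  by move: e2; lra.
rewrite !normrM -(real_normK (num_real (y - x))) expr2 mulrA.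
rewrite ler_wpM2r// ler_pM//.
apply: le_trans (qM _ _) _; rewrite lerD2l ler_wpM2l//.
exact: le_trans xiz zx.
Qed.

(** The first-order term has mean zero. The cubic remainder is split by [M z <= e + (M^2 / e) z^2],
    leaving the second and fourth moments. *)
Lemma gauss_mean_taylor v p q m s (e M V : R) : 0 < s -> 0 < e -> 0 <= M ->
  has_derivative v p -> has_derivative p q -> bounded_by V v ->
  (forall x y, `|q x - q y| <= e + M * `|x - y|) ->
  `|gauss_mean m s v - v m - 2^-1 * s ^+ 2 * q m| <=
  2 * e * s ^+ 2 + 64 * (M ^+ 2 / e) * s ^+ 4.
Proof.
move=> s0 e0 M0 dv dp vV qM.
have i1 := @gauss_integrable_pow R m s 1 s0 isT.
have i2 := @gauss_integrable_pow R m s 2 s0 isT.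
have i4 := @gauss_integrable_pow R m s 4 s0 isT.
have mv : measurable_fun setT v.
  apply: continuous_measurable_fun; exact: has_derivative_continuous dv.
have iv := gauss_integrable_bounded m s0 mv vV.
have ic k : mu.-integrable setT (EFin \o (fun y => normal_pdf m s y * k)).
  apply: (@gauss_integrable_bounded R m s (fun=> k) `|k|) => //.
have E1 := gauss_integrable_lin (- p m) i1 iv.
have E2 := gauss_integrable_lin (- (2^-1 * q m)) i2 E1.
have E3 := gauss_integrable_lin (-1) (ic (v m)) E2.
have F1 := gauss_integrable_lin (M ^+ 2 / e) i4 (ic 0).
have F2 := gauss_integrable_lin (2 * e) i2 F1.
have := gauss_mean_norm E3 F2.
rewrite (gauss_mean_lin (-1) (ic (v m)) E2) (gauss_mean_lin _ i2 E1).
rewrite (gauss_mean_lin _ i1 iv) (gauss_mean_lin _ i2 F1) (gauss_mean_lin _ i4 (ic 0)).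
rewrite !(gauss_mean_cst _ _ s0) (gauss_mean_pow2 _ s0).
rewrite (_ : (fun y => (y - m) ^+ 1) = (fun y => y - m)) ?(gauss_mean_pow1 _ s0); last first.
  by apply/funext => y; rewrite expr1.
have M4 : M ^+ 2 / e * gauss_mean m s (fun y => (y - m) ^+ 4) <= M ^+ 2 / e * (64 * s ^+ 4).
  by rewrite ler_wpM2l ?gauss_mean_pow4// divr_ge0 ?sqr_ge0// ltW.
move=> H; rewrite (_ : gauss_mean m s v - v m - _ = -1 * v m +
  (- (2^-1 * q m) * s ^+ 2 + (- p m * 0 + gauss_mean m s v))); last by ring.
apply: le_trans (H _) _; last by lra.
move=> y; rewrite (_ : -1 * v m + _ =
  v y - v m - p m * (y - m) - 2^-1 * q m * (y - m) ^+ 2); last by ring.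
apply: le_trans (taylor2 m y dv dp qM M0) _.
rewrite addr0 (_ : _ + _ = (2 * e + M ^+ 2 / e * (y - m) ^+ 2) * (y - m) ^+ 2); last by ring.
rewrite ler_wpM2r ?sqr_ge0//.
rewrite -(real_normK (num_real (y - m))); set z := `|y - m|.
have : 0 <= (M * z / e - 1) ^+ 2 * e by rewrite mulr_ge0 ?sqr_ge0// ltW.
rewrite (_ : _ * e = M ^+ 2 / e * z ^+ 2 - 2 * (M * z) + e); last by field; rewrite gt_eqF.
have : 0 <= M ^+ 2 / e * z ^+ 2 by rewrite mulr_ge0 ?sqr_ge0// divr_ge0 ?sqr_ge0// ltW.
by lra.
Qed.

Lemma expR_le0_bounds (u : R) : u <= 0 ->
  [/\ 0 <= 1 - expR u, 1 - expR u <= - u & 0 <= expR u - 1 - u <= u ^+ 2].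
Proof.
move=> u0; have H := expR_ge1Dx u; have H' := expR_ge1Dx (- u).
have e0 := expR_gt0 u.
rewrite expRN in H'.
have e1 : expR u <= 1 by rewrite -expR0 ler_expR.
have e2 : expR u * (1 - u) <= 1 by rewrite -ler_pdivlMl// mulr1.
split; [lra|lra|apply/andP; split; first lra].
have u1 : 0 < 1 - u by lra.
have : expR u <= (1 - u)^-1 by rewrite -[leRHS]mul1r ler_pdivlMr.
suff : (1 - u)^-1 <= 1 + u + u ^+ 2 by lra.
rewrite -[leLHS]mul1r ler_pdivrMr//.
rewrite (_ : (1 + u + u ^+ 2) * (1 - u) = 1 - u ^+ 3); last by ring.
by rewrite lerDl oppr_ge0 exprS mulr_le0_ge0 ?sqr_ge0.
Qed.

(** Tonelli applies to the positive and negative parts separately; as [fine] is measurable, no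
    integrability is required. *)
Lemma measurable_Rintegral_param d (T : measurableType d) (F : T * R -> R) :
  measurable_fun setT F ->
  measurable_fun setT (fun p : T => (\int[mu]_y F (p, y))%R).
Proof.
move=> mF; have mEF : measurable_fun setT (EFin \o F) by exact/measurable_EFinP.
have H := @measurable_fun_fubini_tonelli_F _ _ T _ R mu ((EFin \o F)^\+)%E.
have H' := @measurable_fun_fubini_tonelli_F _ _ T _ R mu ((EFin \o F)^\-)%E.
have mp := H (measurable_funepos mEF) (@funepos_ge0 _ _ _).
have mn := H' (measurable_funeneg mEF) (@funeneg_ge0 _ _ _).
have := emeasurable_funB mp mn => mB.
have mfB := measurableT_comp (fine_measurable measurableT) mB.
apply: eq_measurable_fun mfB => p _ /=; rewrite /Rintegral [in RHS]integralE.
rewrite /fubini_F; congr (fine (_ - _)%E).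
all: by apply: eq_integral => y _; rewrite ?funeposE ?funenegE.
Qed.

(** Both the step and the function depend on the parameter, so that the statement can be
    iterated. *)
Lemma measurable_chernoff_step a b c d (T : measurableType d)
    (s : T -> R) (v : T -> R -> R) :
  measurable_fun setT a -> measurable_fun setT b -> measurable_fun setT c ->
  measurable_fun setT s -> measurable_fun setT (fun p : T * R => v p.1 p.2) ->
  measurable_fun setT (fun p : T * R => chernoff_step a b c (s p.1) (v p.1) p.2).
Proof.
move=> ma mb mc ms mv.
have ms1 d' (T' : measurableType d') (f : T' -> T) : measurable_fun setT f ->
    measurable_fun setT (fun z => s (f z)).
  by move=> mf; exact: measurableT_comp.
apply: measurable_funM.
  apply: measurableT_comp => //; apply: measurable_funM.
    exact: (ms1 _ _ _ measurable_fst).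
  by apply: measurableT_comp => //; exact: measurable_snd.
apply: (@measurable_Rintegral_param _ (T * R)%type
  (fun z => heat_kernel a b (s z.1.1) z.1.2 z.2 * v z.1.1 z.2)).
have m11 : measurable_fun setT (fun z : T * R * R => z.1.1).
  exact: measurableT_comp measurable_fst measurable_fst.
have m12 : measurable_fun setT (fun z : T * R * R => z.1.2).
  exact: measurableT_comp measurable_snd measurable_fst.
have m2 : measurable_fun setT (fun z : T * R * R => z.2) by exact: measurable_snd.
have ms' := ms1 _ _ _ m11.
have ma' : measurable_fun setT (fun z : T * R * R => a z.1.2) by exact: measurableT_comp.
have mb' : measurable_fun setT (fun z : T * R * R => b z.1.2) by exact: measurableT_comp.
apply: measurable_funM; last first.
  apply: (measurableT_comp (f := fun p : T * R => v p.1 p.2)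
    (g := fun z : T * R * R => (z.1.1, z.2))) => //.
  exact: measurable_fun_pair.
apply: measurable_funM.
  apply: (measurableT_comp (measurable_powR _)).
  by apply: measurable_funM => //; apply: measurable_funM.
apply: measurableT_comp => //; apply: measurableT_comp => //.
apply: measurable_funM.
  apply: measurable_funX; apply: measurable_funB; first exact: measurable_funB.
  exact: measurable_funM.
apply: (measurableT_comp (measurable_powR _)).
by apply: measurable_funM => //; apply: measurable_funM.
Qed.

End chernoff_function.

(** * Consistency of one step and comparison with implicit Euler *)

Section consistency.
Context {R : realType}.
Notation mu := (@lebesgue_measure R).
Implicit Types (f g h v w z p q : R -> R) (r s t x y : R).
Variables (a b c : R -> R) (a0 A B C : R).
Hypothesis adm : admissible a b c a0 A B C.
Notation in_graph := (in_graph a b c).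
Notation S := (chernoff_step a b c).
Notation J := (implicit_step a b c).

Let a0_gt0 : 0 < a0. Proof. exact: adm_a0_gt0 adm. Qed.
Let a_gt : forall x, a0 < a x. Proof. exact: adm_a_gt adm. Qed.
Let ax_gt0 x : 0 < a x. Proof. exact: lt_trans a0_gt0 (a_gt x). Qed.
Let a_le : forall x, a x <= A. Proof. exact: adm_a_le adm. Qed.
Let b_le : bounded_by B b. Proof. exact: adm_b_le adm. Qed.
Let c_ge : forall x, - C <= c x. Proof. exact: adm_c_ge adm. Qed.
Let c_le0 : forall x, c x <= 0. Proof. exact: adm_c_le0 adm. Qed.
Let ma : measurable_fun setT a.
Proof.
by apply: continuous_measurable_fun; exact: modulus_continuous (adm_a_modulus adm).
Qed.
Let mb : measurable_fun setT b.
Proof.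
by apply: continuous_measurable_fun; exact: modulus_continuous (adm_b_modulus adm).
Qed.
Let mc : measurable_fun setT c.
Proof.
by apply: continuous_measurable_fun; exact: modulus_continuous (adm_c_modulus adm).
Qed.

Let cB : bounded_by C c.
Proof. by move=> x; have := c_ge x; have := c_le0 x; rewrite ler_norml; lra. Qed.

Lemma sigma_gt0 s x : 0 < s -> 0 < Num.sqrt (2 * s * a x).
Proof. by move=> s0; rewrite sqrtr_gt0 !mulr_gt0. Qed.

Lemma chernoff_step_integrable s x v V : 0 < s -> measurable_fun setT v ->
  bounded_by V v ->
  mu.-integrable setT (EFin \o (fun y => heat_kernel a b s x y * v y)).
Proof.
move=> s0 mv vV.
under [X in EFin \o X]eq_fun do rewrite (heat_kernelE _ _ s0 (ax_gt0 x)).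
exact: gauss_integrable_bounded (sigma_gt0 x s0) mv vV.
Qed.

(** The kernel is a probability density and [e^(s c) <= 1]. *)
Lemma chernoff_step_bound s v V : 0 < s -> measurable_fun setT v ->
  bounded_by V v -> bounded_by V (S s v).
Proof.
move=> s0 mv vV x; have V0 := bounded_by_ge0 vV.
rewrite chernoff_stepE// normrM (ger0_norm (expR_ge0 _)).
have e1 : expR (s * c x) <= 1.
  by rewrite -expR0 ler_expR mulr_ge0_le0 ?(ltW s0).
rewrite -[leRHS]mul1r ler_pM ?expR_ge0//.
rewrite -[leRHS](@gauss_mean_cst _ (x + b x * s) (Num.sqrt (2 * s * a x))).
  apply: gauss_mean_norm => //.
    exact: gauss_integrable_bounded (sigma_gt0 x s0) mv vV.
  apply: (@gauss_integrable_bounded _ _ _ (fun=> V) V) => //.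
    exact: sigma_gt0.
  by move=> y; rewrite ger0_norm.
exact: sigma_gt0.
Qed.

Lemma chernoff_stepB s v v' V V' x : 0 < s -> measurable_fun setT v ->
  measurable_fun setT v' -> bounded_by V v -> bounded_by V' v' ->
  S s v x - S s v' x = S s (fun y => v y - v' y) x.
Proof.
move=> s0 mv mv' vV vV'; rewrite /chernoff_step -mulrBr -RintegralB//.
- by congr (_ * _); apply: eq_Rintegral => y _; ring.
- exact: chernoff_step_integrable s0 mv vV.
- exact: chernoff_step_integrable s0 mv' vV'.
Qed.

Lemma measurable_chernoff_step1 s v : measurable_fun setT v ->
  measurable_fun setT (S s v).
Proof.
move=> mv.
have := @measurable_chernoff_step R a b c _ R (fun=> s) (fun=> v) ma mb mc
  (measurable_cst _) (measurableT_comp mv measurable_snd).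
move=> H; have := measurableT_comp (f := fun p : R * R => S s v p.2)
  (g := fun x : R => (0 : R, x)) H; apply.
by apply: measurable_fun_pair.
Qed.

Lemma measurable_chernoff_steps n s v : measurable_fun setT v ->
  measurable_fun setT (iter n (S s) v).
Proof. by move=> mv; elim: n => //= n; exact: measurable_chernoff_step1. Qed.

Lemma chernoff_steps_bound n s v V : 0 < s -> measurable_fun setT v ->
  bounded_by V v -> bounded_by V (iter n (S s) v).
Proof.
move=> s0 mv vV; elim: n => //= n; apply: chernoff_step_bound => //.
exact: measurable_chernoff_steps.
Qed.

Lemma chernoff_stepsB n s v v' V V' D : 0 < s -> measurable_fun setT v ->
  measurable_fun setT v' -> bounded_by V v -> bounded_by V' v' ->
  bounded_by D (fun x => v x - v' x) ->
  bounded_by D (fun x => iter n (S s) v x - iter n (S s) v' x).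
Proof.
move=> s0 mv mv' vV vV' vD; elim: n => //= n IH x.
have mn f : measurable_fun setT f -> measurable_fun setT (iter n (S s) f).
  exact: measurable_chernoff_steps.
have bn f F : measurable_fun setT f -> bounded_by F f ->
  bounded_by F (iter n (S s) f) by exact: chernoff_steps_bound.
rewrite (chernoff_stepB _ s0 (mn _ mv) (mn _ mv') (bn _ _ mv vV) (bn _ _ mv' vV')).
by apply: chernoff_step_bound => //; apply: measurable_funB; exact: mn.
Qed.

(* The second derivative is read off from the equation, so that its modulus of
   continuity is controlled by the coefficients, by [v] and by [L v]. *)
Lemma second_derivative_modulus V W Z (e : R) : 0 < e ->
  exists2 M, 0 <= M & forall v w z p q, in_graph v w -> in_graph w z ->
  bounded_by V v -> bounded_by W w -> bounded_by Z z ->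
  has_derivative v p -> has_derivative p q ->
  (forall x, w x = a x * q x + b x * p x + c x * v x) ->
  forall x y, `|q x - q y| <= e + M * `|x - y|.
Proof.
(* A negative bound makes the claim vacuous; the constants below use nonnegative ones. *)
move=> e0; have [V0|V0] := ltP V 0.
  exists 0 => // v w z p q _ _ vV.
  by have := bounded_by_ge0 vV; rewrite leNgt V0.
have [W0|W0] := ltP W 0.
  exists 0 => // v w z p q _ _ _ wW.
  by have := bounded_by_ge0 wW; rewrite leNgt W0.
have [Z0|Z0] := ltP Z 0.
  exists 0 => // v w z p q _ _ _ _ zZ.
  by have := bounded_by_ge0 zZ; rewrite leNgt Z0.
have [K K0 KP] := derivative_bound adm.
pose K1 := K * (V + W); pose K2 := K * (W + Z).
have K10 : 0 <= K1 by rewrite mulr_ge0// addr_ge0.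
have K20 : 0 <= K2 by rewrite mulr_ge0// addr_ge0.
have B0 : 0 <= B := bounded_by_ge0 b_le.
have C0' : 0 <= C := bounded_by_ge0 cB.
(* The moduli of [a] and [b] come with a factor [K1], that of [c] with [V]; the factor [a0]
   anticipates the division by [a x]. *)
pose e' := e * a0 / (2 * K1 + V + 1).
have D0 : 0 < 2 * K1 + V + 1 by lra.
have e'0 : 0 < e' by rewrite divr_gt0// mulr_gt0.
have [Ma Ma0 aM] := adm_a_modulus adm e'0.
have [Mb Mb0 bM] := adm_b_modulus adm e'0.
have [Mc Mc0 cM] := adm_c_modulus adm e'0.
pose M := K2 + (B * K1 + K1 * Mb) + (C * K1 + V * Mc) + K1 * Ma.
have M0 : 0 <= M by rewrite /M !addr_ge0// mulr_ge0.
exists (M / a0) => [|v w z p q vw wz vV wW zZ dv dp we x y].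
  by rewrite divr_ge0// ltW.
have [C0v C0w _] := vw; have [_ C0z [pw [qw [dw dpw wze]]]] := wz.
have [pK qK] := KP _ _ _ _ _ _ C0v dv dp we C0w vV wW.
(* This is where [z = L^2 v] is used: it makes [w = L v] Lipschitz. *)
have [pwK _] := KP _ _ _ _ _ _ C0w dw dpw wze C0z wW zZ.
rewrite -/K1 in pK qK; rewrite -/K2 in pwK.
have n0 : 0 <= `|x - y| by [].
have lw := lipschitz_of_derivative dw pwK x y.
have lp := lipschitz_of_derivative dp qK x y.
have lv := lipschitz_of_derivative dv pK x y.
have h1 : `|b x * (p x - p y)| <= B * (K1 * `|x - y|).
  by rewrite normrM ler_pM//; exact: b_le.
have h2 : `|(b x - b y) * p y| <= (e' + Mb * `|x - y|) * K1.
  by rewrite normrM ler_pM//.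
have h3 : `|c x * (v x - v y)| <= C * (K1 * `|x - y|).
  by rewrite normrM ler_pM//; exact: cB.
have h4 : `|(c x - c y) * v y| <= (e' + Mc * `|x - y|) * V.
  by rewrite normrM ler_pM//.
have h5 : `|(a x - a y) * q y| <= (e' + Ma * `|x - y|) * K1.
  by rewrite normrM ler_pM//.
have E : a x * (q x - q y) = (w x - w y) - b x * (p x - p y) - (b x - b y) * p y
    - c x * (v x - v y) - (c x - c y) * v y - (a x - a y) * q y.
  by rewrite (we x) (we y); ring.
have : a x * `|q x - q y| <= (2 * K1 + V) * e' + M * `|x - y|.
  rewrite -(gtr0_norm (ax_gt0 x)) -normrM E /M.
  move: lw h1 h2 h3 h4 h5; rewrite (ler_norml (w x - w y)).
  rewrite !(ler_norml (_ * _)) (ler_norml (_ - _ - _)).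
  by lra.
have e'D : (2 * K1 + V) * e' <= e * a0.
  rewrite /e' mulrCA ler_piMr//; first by rewrite mulr_ge0// ltW.
  by rewrite ler_pdivrMr// mul1r; lra.
have : a0 * `|q x - q y| <= a x * `|q x - q y| by rewrite ler_wpM2r// ltW.
move=> H1 H2; rewrite -(ler_pM2l a0_gt0).
rewrite (_ : a0 * (e + _) = e * a0 + M * `|x - y|); last first.
  by field; rewrite gt_eqF.
by lra.
Qed.

Lemma chernoff_step_consistent V W Z (e : R) : 0 < e ->
  exists2 D, 0 <= D & forall v w z, in_graph v w -> in_graph w z ->
  bounded_by V v -> bounded_by W w -> bounded_by Z z ->
  forall s, 0 < s -> bounded_by (s * (e + D * s)) (fun x => S s v x - v x - s * w x).
Proof.
move=> e0; have [V0|V0] := ltP V 0.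
  exists 0 => // v w z _ _ vV.
  by have := bounded_by_ge0 vV; rewrite leNgt V0.
have [W0|W0] := ltP W 0.
  exists 0 => // v w z _ _ _ wW.
  by have := bounded_by_ge0 wW; rewrite leNgt W0.
have [K K0 KP] := derivative_bound adm.
pose K1 := K * (V + W).
have K10 : 0 <= K1 by rewrite mulr_ge0// addr_ge0.
have B0 : 0 <= B := bounded_by_ge0 b_le.
have C0' : 0 <= C := bounded_by_ge0 cB.
have A0 : 0 < A := lt_le_trans (ax_gt0 0) (a_le 0).
(* Of the five parts, four come from the Taylor expansion at the centre [m], one from moving [q]
   from [m] back to [x]. *)
pose e' := e / (5 * A).
have e'0 : 0 < e' by rewrite divr_gt0// mulr_gt0.
have [M M0 MP] := second_derivative_modulus V W Z e'0.
pose D := B ^+ 2 * K1 + A * M * B + 256 * (M ^+ 2 / e') * A ^+ 2 +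
  C * ((B + A) * K1) + C ^+ 2 * V.
have Me0 : 0 <= M ^+ 2 / e' by rewrite divr_ge0 ?sqr_ge0// ltW.
exists D => [|v w z vw wz vV wW zZ s s0 x].
  have Ap := ltW A0.
  by rewrite /D; repeat (apply: addr_ge0 || apply: mulr_ge0);
     rewrite ?sqr_ge0 ?invr_ge0 ?(ltW e'0).
have [C0v C0w [p [q [dv dp we]]]] := vw.
have [pK qK] := KP _ _ _ _ _ _ C0v dv dp we C0w vV wW.
rewrite -/K1 in pK qK.
have qM := MP _ _ _ _ _ vw wz vV wW zZ dv dp we.
pose m := x + b x * s; pose sg := Num.sqrt (2 * s * a x).
have sg2 : sg ^+ 2 = 2 * s * a x by rewrite sqr_sqrtr// !mulr_ge0// ltW.
have sg4 : sg ^+ 4 = (2 * s * a x) ^+ 2 by rewrite -sg2 -exprM.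
have sg0 : 0 < sg := sigma_gt0 x s0.
have sx := ax_gt0 x; have sA := a_le x.
have bs : `|b x * s| <= B * s by rewrite normrM (gtr0_norm s0) ler_wpM2r ?(ltW s0)//; exact: b_le.
have T1 : `|gauss_mean m sg v - v m - s * (a x * q m)| <=
    s * (4 * A * e' + 256 * (M ^+ 2 / e') * A ^+ 2 * s).
  have := gauss_mean_taylor m sg0 e'0 M0 dv dp vV qM; rewrite sg4 sg2.
  rewrite (_ : 2^-1 * (2 * s * a x) * q m = s * (a x * q m)); last by field.
  move=> /le_trans; apply.
  rewrite (_ : 2 * e' * _ + _ = s * (4 * a x * e' + 256 * (M ^+ 2 / e') * a x ^+ 2 * s));
    last by ring.
  rewrite ler_pM2l// lerD//.
    by rewrite ler_wpM2r ?(ltW e'0)// ler_wpM2l.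
  have Me0' : 0 <= 256 * (M ^+ 2 / e') by apply: mulr_ge0; [exact: ler0n|exact: Me0].
  rewrite ler_wpM2r ?(ltW s0)// ler_wpM2l//.
  by rewrite lerXn2r// nnegrE ltW.
have T2 : `|v m - v x - s * (b x * p x)| <= s * (B ^+ 2 * K1 * s).
  have [xi xix e1] := mean_value_sym x m dv.
  have mx : m - x = b x * s by rewrite /m; ring.
  rewrite mx in xix e1.
  rewrite e1 (_ : _ - _ = (p xi - p x) * (b x * s)); last by ring.
  have := lipschitz_of_derivative dp qK xi x => px.
  rewrite normrM (_ : s * _ = K1 * (B * s) * (B * s)); last by ring.
  rewrite ler_pM//; apply: le_trans px _; rewrite ler_wpM2l//.
  exact: le_trans xix bs.
have T3 : `|s * (a x * q m) - s * (a x * q x)| <= s * (A * e' + A * M * B * s).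
  rewrite -!mulrBr !normrM (gtr0_norm s0) (gtr0_norm sx) ler_pM2l//.
  rewrite (_ : A * e' + _ = A * (e' + M * (B * s))); last by ring.
  rewrite ler_pM// ?(ltW sx)//; apply: le_trans (qM _ _) _.
  by rewrite lerD2l ler_wpM2l// /m addrAC subrr add0r.
pose l := b x * p x + a x * q x.
have lK : `|l| <= (B + A) * K1.
  rewrite mulrDl (le_trans (ler_normD _ _))// lerD// normrM ler_pM//.
  by rewrite gtr0_norm.
have {T1 T2 T3} T : `|gauss_mean m sg v - v x - s * l| <=
    s * (5 * A * e' + (B ^+ 2 * K1 + A * M * B + 256 * (M ^+ 2 / e') * A ^+ 2) * s).
  rewrite (_ : _ - _ - _ = (gauss_mean m sg v - v m - s * (a x * q m)) +
     (v m - v x - s * (b x * p x)) + (s * (a x * q m) - s * (a x * q x))); last first.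
    by rewrite /l; ring.
  rewrite (le_trans (ler_normD _ _))//.
  have := ler_normD (gauss_mean m sg v - v m - s * (a x * q m))
     (v m - v x - s * (b x * p x)).
  by move: T1 T2 T3; lra.
have u0 : s * c x <= 0 by rewrite mulr_ge0_le0// ltW.
have [h0 h1 /andP[h2 h3]] := expR_le0_bounds u0.
set E := expR (s * c x) in h0 h1 h2 h3.
have E0 : 0 <= E := expR_ge0 _.
have cC := c_ge x; have sC : - (s * c x) <= s * C.
  by rewrite -mulrN ler_pM2l//; lra.
have sC2 : (s * c x) ^+ 2 <= (s * C) ^+ 2.
  by rewrite -[(s * c x) ^+ 2]sqrrN lerXn2r ?nnegrE// ?oppr_ge0// mulr_ge0// ltW.
rewrite chernoff_stepE// -/m -/sg -/E we.
(* The three terms are the error of the Gaussian mean, the interaction of [c] with the differential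
   part [l], and the second-order error of the exponential. *)
rewrite (_ : _ - _ - _ = E * (gauss_mean m sg v - v x - s * l) + (E - 1) * (s * l) +
  (E - 1 - s * c x) * v x); last by rewrite /l; ring.
have G1 : `|E * (gauss_mean m sg v - v x - s * l)| <= s * (5 * A * e' +
    (B ^+ 2 * K1 + A * M * B + 256 * (M ^+ 2 / e') * A ^+ 2) * s).
  rewrite normrM -[leRHS]mul1r ler_pM//; rewrite ger0_norm//; lra.
have G2 : `|(E - 1) * (s * l)| <= s * C * (s * ((B + A) * K1)).
  rewrite normrM ler_pM//.
    by rewrite ler0_norm; lra.
  by rewrite normrM (gtr0_norm s0) ler_pM2l.
have G3 : `|(E - 1 - s * c x) * v x| <= (s * C) ^+ 2 * V.
  by rewrite normrM ler_pM//; rewrite ger0_norm//; lra.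
have e'E : 5 * A * e' = e by rewrite /e'; field; rewrite gt_eqF.
rewrite e'E in G1.
rewrite (_ : s * (e + D * s) = s * (e + (B ^+ 2 * K1 + A * M * B +
  256 * (M ^+ 2 / e') * A ^+ 2) * s) + s * C * (s * ((B + A) * K1)) + (s * C) ^+ 2 * V);
  last by rewrite /D; ring.
rewrite (le_trans (ler_normD _ _))// lerD// (le_trans (ler_normD _ _))//.
by rewrite lerD.
Qed.

Lemma C0_measurable v : C0 v -> measurable_fun setT v.
Proof. by case=> cv _; exact: continuous_measurable_fun. Qed.

(** In the telescoping sum the steps [S] stand outside, where only contractivity is used, and the
    steps [J] inside, where they preserve the bounds [V], [W], [Z] under which the one-step error is
    known. *)
Lemma chernoff_steps_implicit_steps V W Z (e : R) : 0 < e ->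
  exists2 D, 0 <= D & forall v w z, in_graph v w -> in_graph w z ->
  bounded_by V v -> bounded_by W w -> bounded_by Z z ->
  forall n s, 0 < s -> bounded_by (n%:R * (s * (e + D * s)))
    (fun x => iter n (S s) v x - iter n (J s) v x).
Proof.
move=> e0; have [Z0|Z0] := ltP Z 0.
  exists 0 => // v w z _ _ _ _ zZ.
  by have := bounded_by_ge0 zZ; rewrite leNgt Z0.
have [D D0 DP] := chernoff_step_consistent V W Z e0.
(* [Z] pays for the implicit step, as [J_s u - u - s L u = s^2 J_s L^2 u]. *)
exists (D + Z) => [|v w z vw wz vV wW zZ n s s0]; first by rewrite addr_ge0.
have [C0v C0w _] := vw; have [_ C0z _] := wz.
have step u u1 u2 : in_graph u u1 -> in_graph u1 u2 -> bounded_by V u ->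
    bounded_by W u1 -> bounded_by Z u2 ->
    bounded_by (s * (e + (D + Z) * s)) (fun x => S s u x - J s u x).
  move=> uu1 u1u2 uV uW uZ x; have [_ C0u2 _] := u1u2.
  have H := DP _ _ _ uu1 u1u2 uV uW uZ s s0 x.
  have [_ e1] := implicit_step_comm adm s0 uu1.
  have [_ e2] := implicit_step_comm adm s0 u1u2.
  rewrite (_ : _ - _ = (S s u x - u x - s * u1 x) - s * (s * J s u2 x)); last first.
    by rewrite -e2 mulrBr -e1; ring.
  rewrite (le_trans (ler_normB _ _))//.
  have : `|s * (s * J s u2 x)| <= s * (s * Z).
    by rewrite !normrM (gtr0_norm s0) !ler_pM2l//; exact: (implicit_step_bound adm).
  by move: H; lra.
elim: n => [|n IH] x; first by rewrite /= subrr normr0 mul0r.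
have gn := implicit_steps_graph adm n s0 vw.
have gn1 := implicit_steps_graph adm n s0 wz.
have [C0n _ _] := gn.
have bn := implicit_steps_bound adm n s0 C0v vV.
have mv := C0_measurable C0v; have mn := C0_measurable C0n.
rewrite 2!iterS (_ : _ - _ = (S s (iter n (S s) v) x - S s (iter n (J s) v) x) +
  (S s (iter n (J s) v) x - J s (iter n (J s) v) x)); last by ring.
rewrite (le_trans (ler_normD _ _))// -natr1 mulrDl mul1r lerD//.
  have mSn := measurable_chernoff_steps n s mv.
  rewrite (chernoff_stepB _ s0 mSn mn (chernoff_steps_bound n s0 mv vV) bn).
  by apply: chernoff_step_bound => //; exact: measurable_funB.
apply: (step _ _ _ gn gn1) => //.
- exact: (implicit_steps_bound adm).
- exact: (implicit_steps_bound adm).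
Qed.

End consistency.

(** * Density of the domain of [L^2] *)

Section density.
Context {R : realType}.
Implicit Types (f g u v w p q : R -> R) (m e r x y : R).

(** The parabola [Cm (y - x0)^2] is a barrier: wherever [m^2 u] exceeds it by more than [k], the
    second derivative of the difference is positive, contrary to the maximum principle. *)
Lemma helmholtz_upper m F u p (e Cm G : R) : 0 < m -> 0 <= e -> 1 <= Cm ->
  bounded_by G F -> helmholtz_solution m F u p ->
  (forall x y, F y <= F x + e + Cm * (x - y) ^+ 2) ->
  forall x, m ^+ 2 * u x - F x <= e + 2 * Cm / m ^+ 2.
Proof.
move=> m0 e0 Cm1 FG [C0u _ du dp] FC x0.
have m2 : 0 < m ^+ 2 by rewrite exprn_gt0.
have di := has_derivativeB (@has_derivative_id R) (has_derivative_cst x0).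
have dsq := has_derivativeZ Cm (has_derivativeM di di).
pose k := F x0 + e + 2 * Cm / m ^+ 2.
have d1 := has_derivativeB (has_derivativeB (has_derivativeZ (m ^+ 2) du) dsq)
  (has_derivative_cst k).
have d2 : has_derivative (fun y => m ^+ 2 * p y - 2 * Cm * (y - x0))
    (fun y => m ^+ 2 * (m ^+ 2 * u y - F y) - 2 * Cm).
  have := has_derivativeB (has_derivativeZ (m ^+ 2) dp) (has_derivativeZ (2 * Cm) di).
  by move=> /has_derivative_eq; apply => y /=; rewrite subr0 mulr1.
have {}d1 : has_derivative
    (fun y => m ^+ 2 * u y - Cm * ((y - x0) * (y - x0)) - k)
    (fun y => m ^+ 2 * p y - 2 * Cm * (y - x0)).
  by apply: has_derivative_eq d1 _ => y /=; ring.
have Ck : 0 <= 2 * Cm / m ^+ 2 by rewrite divr_ge0 ?(ltW m2)//; lra.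
have [_ uinf] := C0Z (m ^+ 2) C0u.
have := max_principle d1 d2 => /(_ _ _ x0) H.
suff : m ^+ 2 * u x0 - Cm * ((x0 - x0) * (x0 - x0)) - k <= 0.
  by rewrite subrr mul0r mulr0 /k; lra.
apply: H.
- move=> e1 e10; have [M MP] := uinf _ e10.
  (* So far out, [|y - x0| >= 1 + G] and [Cm >= 1] make the parabola at least [G >= - F x0]. *)
  exists (`|M| + `|x0| + 1 + G) => y yM.
  have G0 := bounded_by_ge0 FG.
  have n0 : 0 <= `|M| by []. have nx : 0 <= `|x0| by [].
  have : `|m ^+ 2 * u y| < e1 by apply: MP; have := ler_norm M; lra.
  have yx : `|y| <= `|y - x0| + `|x0| by rewrite -{1}(subrK x0 y) ler_normD.
  have gy : 1 + G <= `|y - x0| by lra.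
  have : G <= Cm * ((y - x0) * (y - x0)).
    rewrite -expr2 -(real_normK (num_real (y - x0))) expr2.
    apply: (@le_trans _ _ (1 * (1 * `|y - x0|))); first lra.
    by rewrite ler_pM// ler_wpM2r//; lra.
  have := FG x0; rewrite ler_norml /k.
  by have := ler_norm (m ^+ 2 * u y); lra.
- move=> y; rewrite /k => dy _.
  have H1 := FC x0 y; rewrite (_ : (x0 - y) ^+ 2 = (y - x0) * (y - x0)) in H1; last by ring.
  have H2 : 2 * Cm / m ^+ 2 < m ^+ 2 * u y - F y by lra.
  move: H2; rewrite ltr_pdivrMr// mulrC; lra.
Qed.

(** [m^2 (m^2 - d^2/dx^2)^-1] tends to the identity as [m] grows. *)
Lemma helmholtz_approx F (e : R) : C0 F -> 0 < e ->
  exists u p q, [/\ C0 u, C0 p, C0 q, has_derivative u p /\ has_derivative p q &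
    bounded_by e (fun x => u x - F x)].
Proof.
move=> C0F e0; have e2 : 0 < e / 2 by rewrite divr_gt0.
have [G G0 FG] := C0_bounded C0F.
have [Cm Cm0 CmP] := C0_modulus C0F e2.
(* As [m >= 1], [m <= m^2], and a linear choice makes [2 (Cm + 1) / m^2] at most [e / 2]. *)
pose m := 1 + 4 * (Cm + 1) / e.
have q0 : 0 <= 4 * (Cm + 1) / e by rewrite divr_ge0 ?(ltW e0)//; lra.
have m0 : 0 < m by rewrite /m; lra.
have m2 : 0 < m ^+ 2 by rewrite exprn_gt0.
have m2e : 2 * (Cm + 1) / m ^+ 2 <= e / 2.
  rewrite ler_pdivrMr//; apply: (@le_trans _ _ (e / 2 * m)).
    have -> : e / 2 * m = e / 2 + 2 * (Cm + 1).
      by rewrite /m; field; rewrite gt_eqF.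
    by lra.
  rewrite ler_pM2l// expr2 ler_peMl ?(ltW m0)// /m; lra.
have Cm1 : 1 <= Cm + 1 by lra.
have sq x y : 0 <= (x - y) ^+ 2 by exact: sqr_ge0.
have [u [p sol]] := helmholtz_solvable m0 C0F; have [C0u C0p du dp] := sol.
exists (fun x => m ^+ 2 * u x), (fun x => m ^+ 2 * p x),
  (fun x => m ^+ 2 * (m ^+ 2 * u x - F x)); split.
- exact: C0Z.
- exact: C0Z.
- exact/C0Z/C0B/C0F/C0Z.
- by split; exact: has_derivativeZ.
- move=> x; rewrite ler_norml; apply/andP; split.
    have nsol : helmholtz_solution m (fun x => -1 * F x) (fun x => -1 * u x) (fun x => -1 * p x).
      split; [exact: C0Z|exact: C0Z|exact: has_derivativeZ|].
      by apply: has_derivative_eq (has_derivativeZ (-1) dp) _ => y /=; ring.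
    have nG : bounded_by G (fun x => -1 * F x).
      by move=> y; rewrite mulN1r normrN.
    have := helmholtz_upper m0 (ltW e2) Cm1 nG nsol => /(_ _ x) H.
    have : m ^+ 2 * (-1 * u x) - -1 * F x <= e / 2 + 2 * (Cm + 1) / m ^+ 2.
      apply: H => y z; have := CmP z y; rewrite ler_norml.
      by have := sq z y; have := sq y z; rewrite -(sqrrN (z - y)) opprB; lra.
    by lra.
  have := helmholtz_upper m0 (ltW e2) Cm1 FG sol => /(_ _ x) H.
  have : m ^+ 2 * u x - F x <= e / 2 + 2 * (Cm + 1) / m ^+ 2.
    apply: H => y z; have := CmP z y; rewrite ler_norml.
    by have := sq z y; have := sq y z; rewrite -(sqrrN (z - y)) opprB; lra.
  by lra.
Qed.

Variables (a b c : R -> R) (a0 A B C : R).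
Hypothesis adm : admissible a b c a0 A B C.
Notation in_graph := (in_graph a b c).

(** The smooth approximation [u] has [L u] merely in [C0]; one implicit Euler step moves it into the
    domain of [L^2] at the cost of at most [r] times the sup norm of [L u]. *)
Lemma domain2_dense g e : C0 g -> 0 < e ->
  exists v v1 v2, [/\ in_graph v v1, in_graph v1 v2 & bounded_by e (fun x => v x - g x)].
Proof.
move=> C0g e0; have e2 : 0 < e / 2 by rewrite divr_gt0.
have [u [p [q [C0u C0p C0q [du dp] ug]]]] := helmholtz_approx C0g e2.
pose w x := a x * q x + b x * p x + c x * u x.
have aA : bounded_by A a.
  move=> x; rewrite ger0_norm ?(adm_a_le adm)// ltW//.
  exact: a_gt0 adm x.
have cC : bounded_by C c.
  by move=> x; have := adm_c_ge adm x; have := adm_c_le0 adm x; rewrite ler_norml; lra.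
have ca := modulus_continuous (adm_a_modulus adm).
have cb := modulus_continuous (adm_b_modulus adm).
have cc := modulus_continuous (adm_c_modulus adm).
have uw : in_graph u w.
  split=> //; last by exists p, q.
  apply: C0D; last exact: C0M cC C0u.
  by apply: C0D; [exact: C0M aA C0q|exact: C0M (adm_b_le adm) C0p].
have [_ C0w _] := uw; have [W W0 wW] := C0_bounded C0w.
pose r := e / 2 / W.
have r0 : 0 < r by rewrite divr_gt0.
have [Juw Je] := implicit_step_comm adm r0 uw.
exists (implicit_step a b c r u), (implicit_step a b c r w), (fun x =>
  (implicit_step a b c r w x - w x) / r); split => //.
  exact (implicit_step_graph adm r0 C0w).

move=> x; rewrite (_ : _ - _ = (implicit_step a b c r u x - u x) + (u x - g x)); last by ring.
rewrite (le_trans (ler_normD _ _))// [e]splitr lerD//.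
rewrite Je normrM (gtr0_norm r0).
apply: (@le_trans _ _ (r * W)).
  by rewrite ler_pM2l//; exact: (implicit_step_bound adm).
by rewrite /r divfK// gt_eqF.
Qed.

End density.

(** * Laplace transforms in time *)

Section laplace.
Context {R : realType}.
Notation mu := (@lebesgue_measure R).
Implicit Types (f g h u v w p q : R -> R) (e r s t x y : R) (n : nat).
Variables (a b c : R -> R) (a0 A B C lambda : R).
Hypothesis adm : admissible a b c a0 A B C.
Hypothesis lambda_gt0 : 0 < lambda.
Notation in_graph := (in_graph a b c).
Notation S := (chernoff_step a b c).
Notation J := (implicit_step a b c).

Definition laplace_chernoff n g x :=
  (\int[mu]_(t in `]0, +oo[) (expR (- lambda * t) * iter n (S (t / n%:R)) g x))%R.

Let ma : measurable_fun setT a.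
Proof.
by apply: continuous_measurable_fun; exact: modulus_continuous (adm_a_modulus adm).
Qed.
Let mb : measurable_fun setT b.
Proof.
by apply: continuous_measurable_fun; exact: modulus_continuous (adm_b_modulus adm).
Qed.
Let mc : measurable_fun setT c.
Proof.
by apply: continuous_measurable_fun; exact: modulus_continuous (adm_c_modulus adm).
Qed.

Lemma measurable_chernoff_steps_time n g x : measurable_fun setT g ->
  measurable_fun setT (fun t => iter n (S (t / n%:R)) g x).
Proof.
move=> mg.
(* The induction is on the number [k] of steps with [n] fixed, since every step has size [t / n]; it
   needs joint measurability in time and space. *)
have H k : measurable_fun setT (fun p : R * R => iter k (S (p.1 / n%:R)) g p.2).
  elim: k => [|k IH] /=; first exact: measurableT_comp mg measurable_snd.
  apply: (@measurable_chernoff_step R a b c _ R (fun t => t / n%:R)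
    (fun t => iter k (S (t / n%:R)) g)) => //.
  exact: measurable_funM.
apply: (measurableT_comp (f := fun p : R * R => iter n (S (p.1 / n%:R)) g p.2)
  (g := fun t : R => (t, x))) => //.
Qed.

Lemma integrable_expR_oy (k K : R) : 0 < k ->
  mu.-integrable `]0, +oo[ (EFin \o (fun t => K * expR (- k * t))).
Proof.
move=> k0; have i0 := integrable_expR_y 0 k0.
apply: (@integrableS _ _ _ mu `[0, +oo[) => //.
- by apply: subset_itvr; rewrite bnd_simp.
- by have := integrableZl _ K i0; apply => //; exact: measurable_itv.
Qed.

Lemma Rintegral_expR_oy (k K : R) : 0 < k ->
  (\int[mu]_(t in `]0, +oo[) (K * expR (- k * t)))%R = K / k.
Proof.
move=> k0; rewrite Rintegral_itv_obnd_cbnd; last exact: integrable_expR_oy.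
rewrite RintegralZl//; last exact: integrable_expR_y.
by rewrite /Rintegral integral_expR_y//= mulr0 expR0 mul1r.
Qed.

Lemma chernoff_steps_integrand_bound n g G t x : (0 < n)%N -> 0 < t ->
  measurable_fun setT g -> bounded_by G g ->
  `|expR (- lambda * t) * iter n (S (t / n%:R)) g x| <= G * expR (- lambda * t).
Proof.
move=> n0 t0 mg gG; rewrite normrM (ger0_norm (expR_ge0 _)) mulrC.
rewrite ler_wpM2r ?expR_ge0//; apply: (chernoff_steps_bound adm) => //.
by rewrite divr_gt0// ltr0n.
Qed.

Lemma laplace_chernoff_integrable n g G x : (0 < n)%N ->
  measurable_fun setT g -> bounded_by G g ->
  mu.-integrable `]0, +oo[
    (EFin \o (fun t => expR (- lambda * t) * iter n (S (t / n%:R)) g x)).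
Proof.
move=> n0 mg gG.
apply: (integrable_dominated (mu := mu) _ _ (integrable_expR_oy G lambda_gt0)) => //.
  apply: measurable_funM; first exact: measurable_expRM.
  apply: (@measurable_funS _ _ _ _ setT) => //.
  exact: measurable_chernoff_steps_time.
move=> t; rewrite /= in_itv/= andbT => t0.
exact: chernoff_steps_integrand_bound.
Qed.

Lemma laplace_chernoff_diff n g g' G G' D : (0 < n)%N ->
  measurable_fun setT g -> measurable_fun setT g' ->
  bounded_by G g -> bounded_by G' g' -> bounded_by D (fun x => g x - g' x) ->
  bounded_by (D / lambda) (fun x => laplace_chernoff n g x - laplace_chernoff n g' x).
Proof.
move=> n0 mg mg' gG gG' gD x.
have i1 := laplace_chernoff_integrable x n0 mg gG.
have i2 := laplace_chernoff_integrable x n0 mg' gG'.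
rewrite /laplace_chernoff -RintegralB// -(Rintegral_expR_oy D lambda_gt0).
apply: (@le_Rintegral_dominated _ _ _ mu) => //.
- have /integrableP[/measurable_EFinP m1 _] := i1.
  have /integrableP[/measurable_EFinP m2 _] := i2.
  exact: measurable_funB.
- exact: integrable_expR_oy.
- move=> t; rewrite /= in_itv/= andbT => t0.
  rewrite -mulrBr normrM (ger0_norm (expR_ge0 _)) mulrC.
  rewrite ler_wpM2r ?expR_ge0//; apply: (chernoff_stepsB adm n _ mg mg' gG gG' gD).
  by rewrite divr_gt0// ltr0n.
Qed.

Lemma lipschitz_within f (K : R) : (forall r s, 0 <= r -> 0 <= s ->
  `|f r - f s| <= K * `|r - s|) -> {within `[0, +oo[, continuous f}.
Proof.
move=> fK; apply/subspace_continuousP => x /=; rewrite in_itv/= andbT => x0.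
apply/cvgrPdist_le => e e0.
have K1 : 0 < `|K| + 1 by have : 0 <= `|K| by []; lra.
exists (e / (`|K| + 1)) => /=; first by rewrite divr_gt0.
move=> y /= + y0; rewrite ltr_pdivlMr// => xy.
move: y0; rewrite in_itv/= andbT => y0.
apply: le_trans (fK _ _ x0 y0) _.
have n0 : 0 <= `|x - y| by [].
have : K * `|x - y| <= `|K| * `|x - y| by rewrite ler_wpM2r// ler_norm.
by lra.
Qed.

Lemma implicit_steps_time_within n k v w W x : in_graph v w -> bounded_by W w ->
  {within `[0, +oo[, continuous (fun t => iter k (J (t / n%:R)) v x)}.
Proof.
move=> vw wW; apply: (@lipschitz_within _ (k%:R * (n%:R^-1 * W))) => r s r0 s0.
have rn0 : 0 <= r / n%:R by rewrite divr_ge0.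
have sn0 : 0 <= s / n%:R by rewrite divr_ge0.
have := implicit_steps_lipschitz adm k rn0 sn0 vw wW x.
by rewrite -mulrBl normrM (ger0_norm (_ : 0 <= n%:R^-1)) ?invr_ge0//; lra.
Qed.

Lemma implicit_steps_time_derivative n h h1 h2 H x t : (0 < n)%N -> 0 < t ->
  in_graph h h1 -> in_graph h1 h2 -> bounded_by H h2 ->
  is_derive t (1 : R) (fun t => iter n (J (t / n%:R)) h x)
    (iter n.+1 (J (t / n%:R)) h1 x).
Proof.
move=> n0 t0 hh1 h1h2 hH; have n0' : 0 < n%:R :> R by rewrite ltr0n.
apply: (@is_derive_quadratic _ _ _ H t) => //; first exact: bounded_by_ge0 hH.
move=> r r0.
have rn : 0 < r / n%:R by rewrite divr_gt0.
have tn : 0 < t / n%:R by rewrite divr_gt0.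
have := implicit_steps_expansion adm n rn tn hh1 h1h2 hH x.
rewrite -mulrBl (_ : (r - t) / n%:R * n%:R = r - t) ?divfK ?gt_eqF//.
rewrite (_ : n%:R ^+ 2 * H * ((r - t) / n%:R) ^+ 2 = H * (r - t) ^+ 2)//.
by field; rewrite gt_eqF.
Qed.

Definition laplace_implicit_integrand n h h1 x t :=
  expR (- lambda * t) *
  (lambda * iter n (J (t / n%:R)) h x - iter n.+1 (J (t / n%:R)) h1 x).

(* [- e^(-lambda t) (I - t/n L)^-n h] is a primitive of the integrand. *)
Lemma laplace_implicit n h h1 h2 x : (0 < n)%N -> in_graph h h1 -> in_graph h1 h2 ->
  mu.-integrable `]0, +oo[ (EFin \o laplace_implicit_integrand n h h1 x) /\
  (\int[mu]_(t in `]0, +oo[) laplace_implicit_integrand n h h1 x t)%R = h x.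
Proof.
move=> n0 hh1 h1h2; have n0' : 0 < n%:R :> R by rewrite ltr0n.
have [C0h C0h1 _] := hh1; have [_ C0h2 _] := h1h2.
have [H H0 hH] := C0_bounded C0h; have [H1 H10 hH1] := C0_bounded C0h1.
have [H2 H20 hH2] := C0_bounded C0h2.
pose M := lambda * H + H1.
have M0 : 0 <= M by rewrite addr_ge0 ?(ltW H10)// mulr_ge0// ltW.
pose k := laplace_implicit_integrand n h h1 x.
(* The integrand may change sign, while [ge0_continuous_FTC2y] asks for a nonnegative one. [M]
   dominates the bracket in the integrand, so adding [E] suffices; its integral [M / lambda] is
   cancelled at the end. *)
pose E t := M * expR (- lambda * t).
pose F t := - (expR (- lambda * t) * iter n (J (t / n%:R)) h x + M / lambda * expR (- lambda * t)).
have Jb t : 0 <= t -> `|iter n (J (t / n%:R)) h x| <= H.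
  rewrite le_eqVlt => /predU1P[<-|t0]; first by rewrite mul0r implicit_steps0.
  by apply: (implicit_steps_bound adm) => //; rewrite divr_gt0.
have Jb1 t : 0 <= t -> `|iter n.+1 (J (t / n%:R)) h1 x| <= H1.
  rewrite le_eqVlt => /predU1P[<-|t0]; first by rewrite mul0r implicit_steps0.
  by apply: (implicit_steps_bound adm) => //; rewrite divr_gt0.
have c1 := @implicit_steps_time_within n n _ _ _ x hh1 hH1.
have c2 := @implicit_steps_time_within n n.+1 _ _ _ x h1h2 hH2.
have c3 : {within `[0, +oo[, continuous (fun t : R => expR (- lambda * t))}.
  apply: continuous_subspaceT; exact: has_derivative_continuous (has_derivative_exp _).
have ck : {within `[0, +oo[, continuous k}.
  move=> t; apply: cvgM; first exact: c3.
  apply: cvgB; last exact: c2.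
  by apply: cvgM; [exact: cvg_cst|exact: c1].
have cE : {within `[0, +oo[, continuous E}.
  apply: continuous_subspaceT; apply: has_derivative_continuous.
  exact: has_derivativeZ (has_derivative_exp _).
have k0 t : 0 <= t -> 0 <= k t + E t.
  move=> t0; rewrite /k /laplace_implicit_integrand /E [M * _]mulrC -mulrDr.
  rewrite mulr_ge0 ?expR_ge0// /M.
  have : - H <= iter n (J (t / n%:R)) h x.
    by have := Jb _ t0; rewrite ler_norml => /andP[].
  rewrite -(ler_pM2l lambda_gt0).
  by have := Jb1 _ t0; rewrite ler_norml => /andP[_]; lra.
have dF t : 0 < t -> is_derive t (1 : R) F (k t + E t).
  move=> t0; have d1 := implicit_steps_time_derivative x n0 t0 hh1 h1h2 hH2.
  have d2 := has_derivative_exp (- lambda) t.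
  rewrite /k /laplace_implicit_integrand /F.
  set y1 := iter n.+1 _ _ _ in d1 *; set y0 := iter n _ _ _.
  have d3 := is_deriveM d2 d1; have d4 := is_deriveZ (M / lambda) d2.
  apply: (@is_derive_eq _ _ _ _ _ _ _ _ (is_deriveN (is_deriveD d3 d4))).
  rewrite /GRing.scale /= -/y0 /E.
  by field; rewrite gt_eqF.
have Fb t : 0 <= t -> `|F t| <= (H + M / lambda) * expR (- lambda * t).
  move=> t0; rewrite normrN (le_trans (ler_normD _ _))// [leRHS]mulrDl lerD//.
    by rewrite normrM (ger0_norm (expR_ge0 _)) mulrC ler_wpM2r ?expR_ge0// Jb.
  by rewrite ger0_norm// mulr_ge0 ?expR_ge0// divr_ge0// ltW.
have cF : {within `[0, +oo[, continuous F}.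
  move=> t; apply: cvgN; apply: cvgD.
    apply: cvgM; last exact: c1.
    exact: c3.
  by apply: cvgM; [exact: cvg_cst|exact: c3].
have int : (\int[mu]_(t in `[0%R, +oo[) (k t + E t)%:E = (h x + M / lambda)%:E)%E.
  rewrite (@ge0_continuous_FTC2y R (fun t => k t + E t) F 0 0).
  - by rewrite -EFinB /F mulr0 expR0 mul0r implicit_steps0; congr EFin; ring.
  - by move=> t; exact: k0.
  - by move=> t; apply: cvgD; [exact: ck|exact: cE].
  - apply/norm_cvg0P.
    apply: (@squeeze_cvgr _ _ _ _ (fun=> 0) (fun t => (H + M / lambda) * expR (- lambda * t))).
    + by near=> t; rewrite normr_ge0/= Fb.
    + exact: cvg_cst.
    + rewrite -(mulr0 (H + M / lambda)); apply: cvgMr; exact: cvg_expR_Ny.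
  - by move=> t t0; have [] := dF _ t0.
  - by have /continuous_within_itvcyP[] := cF.
  - move=> t; rewrite in_itv/= andbT => t0; rewrite derive1E.
    by have [_ ->] := dF _ t0.
have mkE : measurable_fun (`[0, +oo[ : set R) (fun t : R => k t + E t).
  apply: subspace_continuous_measurable_fun => //.
  by move=> t; apply: cvgD; [exact: ck|exact: cE].
pose kE (t : R) := (k t + E t)%R.
have ikE : mu.-integrable `[0, +oo[ (EFin \o kE).
  apply/integrableP; split; first exact/measurable_EFinP.
  suff -> : (\int[mu]_(t in `[0%R, +oo[) `|(EFin \o kE) t| =
      \int[mu]_(t in `[0%R, +oo[) (kE t)%:E)%E by rewrite int ltry.
  apply: eq_integral => t; rewrite inE /= in_itv/= andbT => t0.
  by rewrite ger0_norm// /kE k0.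
have sub : (`]0, +oo[%classic : set R) `<=` `[0, +oo[%classic.
  by apply: subset_itvr; rewrite bnd_simp.
have ikE' : mu.-integrable `]0, +oo[ (EFin \o kE).
  by apply: (@integrableS _ _ _ mu `[0, +oo[).
have iE := integrable_expR_oy M lambda_gt0.
have ik : mu.-integrable `]0, +oo[ (EFin \o k).
  have := @integrableB _ _ _ mu `]0, +oo[ _ _ _ ikE' iE.
  move=> /(_ (measurable_itv _)); apply: eq_integrable => // t _ /=.
  by rewrite -EFinB addrK.
split=> //.
have : (\int[mu]_(t in `]0, +oo[) (k t + E t))%R = h x + M / lambda.
  by rewrite Rintegral_itv_obnd_cbnd// /Rintegral int.
rewrite RintegralD// Rintegral_expR_oy// => e1.
by apply: (addIr (M / lambda)).
Unshelve. all: by end_near.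
Qed.

End laplace.

(** * Convergence to the resolvent *)

Section convergence.
Context {R : realType}.
Notation mu := (@lebesgue_measure R).
Implicit Types (f g h u v w p q : R -> R) (e r s t x y : R) (n : nat).
Variables (a b c : R -> R) (a0 A B C lambda : R).
Hypothesis adm : admissible a b c a0 A B C.
Hypothesis lambda_gt0 : 0 < lambda.
Notation in_graph := (in_graph a b c).
Notation S := (chernoff_step a b c).
Notation J := (implicit_step a b c).
Notation I := (laplace_chernoff a b c lambda).

(** Half of the decay of [e^(-lambda t)] is spent on the growth of the error in time; the constants
    come from [u <= e^u] and [u^2 / 2 <= e^u] at [u = lambda t / 2]. *)
Lemma polynomial_le_expR t : 0 <= t ->
  t + t ^+ 2 <= (2 / lambda + 8 / lambda ^+ 2) * expR (lambda / 2 * t).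
Proof.
move=> t0; set u := lambda / 2 * t.
have u0 : 0 <= u by rewrite mulr_ge0// divr_ge0// ltW.
have e1 := expR_ge1Dx u.
have e2 := @expR_ge1Dxn R u 1 u0; rewrite (_ : 2`! = 2)%N// in e2.
have -> : t + t ^+ 2 = 2 / lambda * u + 8 / lambda ^+ 2 * (u ^+ 2 / 2).
  by rewrite /u; field; rewrite gt_eqF.
by rewrite [leRHS]mulrDl lerD// ler_wpM2l// ?divr_ge0 ?exprn_ge0 ?(ltW lambda_gt0)//; lra.
Qed.

Lemma implicit_stepsZ n s k h : 0 < s -> C0 h ->
  iter n (J s) (fun x => k * h x) = (fun x => k * iter n (J s) h x).
Proof.
move=> s0 C0h; elim: n => //= n ->; rewrite (implicit_stepZ adm)//.
exact: (implicit_steps_C0 adm).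
Qed.

Lemma laplace_chernoff_cvg_smooth h h1 h2 h3 e : 0 < e ->
  in_graph h h1 -> in_graph h1 h2 -> in_graph h2 h3 ->
  exists2 N, (0 < N)%N & forall n, (N <= n)%N ->
    bounded_by e (fun x => I n (fun y => lambda * h y - h1 y) x - h x).
Proof.
move=> e0 hh1 h1h2 h2h3.
have [C0h C0h1 _] := hh1; have [_ C0h2 _] := h1h2.
pose g y := lambda * h y - h1 y.
pose g1 y := lambda * h1 y - h2 y.
pose g2 y := lambda * h2 y - h3 y.
have gg1 : in_graph g g1 by exact/in_graphB/h1h2/in_graphZ.
have g1g2 : in_graph g1 g2 by exact/in_graphB/h2h3/in_graphZ.
have [C0g C0g1 _] := gg1; have [_ C0g2 _] := g1g2.
have [G G0 gG] := C0_bounded C0g; have [G1 G10 g1G] := C0_bounded C0g1.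
have [G2 G20 g2G] := C0_bounded C0g2; have [H2 H20 h2H] := C0_bounded C0h2.
pose Q := 2 / lambda + 8 / lambda ^+ 2.
have Q0 : 0 < Q by rewrite addr_gt0// divr_gt0// exprn_gt0.
(* Chosen so that the dominating integral [2 d Q / (lambda / 2)] equals [e]; one [d] bounds the
   consistency error, the other the terms of order [1 / n]. *)
pose d := e / 2 * (lambda / 2) / Q.
have l20 : 0 < lambda / 2 by rewrite divr_gt0.
have d0 : 0 < d by rewrite divr_gt0// mulr_gt0// divr_gt0.
have [D D0 DP] := chernoff_steps_implicit_steps adm G G1 G2 d0.
pose N := (Num.truncn ((D + H2) / d)).+1.
exists N => // n Nn x.
have n0 : (0 < n)%N by exact: leq_trans Nn.
have n0' : 0 < n%:R :> R by rewrite ltr0n.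
have DHd : (D + H2) / n%:R <= d.
  rewrite ler_pdivrMr// mulrC -ler_pdivrMr//.
  apply: (@le_trans _ _ N%:R); last by rewrite ler_nat.
  by rewrite ltW// truncnS_gt.
have mg : measurable_fun setT g by exact: C0_measurable.
have iS := laplace_chernoff_integrable adm lambda_gt0 x n0 mg gG.
have [iJ Jh] := laplace_implicit adm lambda_gt0 x n0 hh1 h1h2.
rewrite -[X in _ - X]Jh /laplace_chernoff -RintegralB//.
rewrite (_ : e = (2 * d * Q) / (lambda / 2)); last first.
  rewrite /d; field; rewrite !gt_eqF//=.
rewrite -Rintegral_expR_oy//.
apply: (@le_Rintegral_dominated _ _ _ mu) => //.
- have /integrableP[/measurable_EFinP m1 _] := iS.
  have /integrableP[/measurable_EFinP m2 _] := iJ.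
  exact: measurable_funB.
- exact: integrable_expR_oy.
move=> t; rewrite /= in_itv/= andbT => t0.
set s := t / n%:R; have s0 : 0 < s by rewrite divr_gt0.
rewrite /laplace_implicit_integrand -/s -mulrBr normrM (ger0_norm (expR_ge0 _)).
have T1 := DP _ _ _ gg1 g1g2 gG g1G g2G n s s0 x.
have JgE : iter n (J s) g x = lambda * iter n (J s) h x - iter n (J s) h1 x.
  rewrite /g (implicit_stepsB adm n s0 (C0Z lambda C0h) C0h1).
  by rewrite implicit_stepsZ.
have [_ T2] := implicit_step_comm adm s0 (implicit_steps_graph adm n s0 h1h2).
have T3 : `|J s (iter n (J s) h2) x| <= H2.
  apply: (implicit_step_bound adm) => //; first exact: (implicit_steps_C0 adm).
  exact: (implicit_steps_bound adm).
have nsE : n%:R * s = t by rewrite /s mulrC divfK// gt_eqF.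
have {}T1 : `|iter n (S s) g x - iter n (J s) g x| <= t * (d + D * s).
  by rewrite -nsE -mulrA.
(* The explicit primitive involves [J^(n+1) h1], whereas [J^n g] contains [J^n h1]; the extra step
   costs [s H2]. *)
have T4 : `|iter n (S s) g x - (lambda * iter n (J s) h x - iter n.+1 (J s) h1 x)|
    <= t * (d + D * s) + s * H2.
  rewrite (_ : _ - _ = (iter n (S s) g x - iter n (J s) g x) +
    (J s (iter n (J s) h1) x - iter n (J s) h1 x)); last by rewrite JgE iterS; ring.
  rewrite (le_trans (ler_normD _ _))// lerD// T2 normrM (gtr0_norm s0).
  by rewrite ler_pM2l.
apply: (@le_trans _ _ (expR (- lambda * t) * (2 * d * (Q * expR (lambda / 2 * t))))).
  rewrite ler_wpM2l ?expR_ge0//; apply: le_trans T4 _.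
  apply: (@le_trans _ _ (2 * d * (t + t ^+ 2))); last first.
    apply: ler_wpM2l; first by rewrite mulr_ge0// ltW.
    exact/polynomial_le_expR/ltW.
  have t2 : 0 <= t ^+ 2 by exact: sqr_ge0.
  have in0 : 0 <= n%:R^-1 :> R by rewrite invr_ge0.
  have q1 : 0 <= D / n%:R by rewrite divr_ge0.
  have q2 : 0 <= H2 / n%:R by rewrite divr_ge0// ltW.
  rewrite (_ : t * (d + D * s) + s * H2 = t * d + D / n%:R * t ^+ 2 + H2 / n%:R * t);
    last by rewrite /s; ring.
  have p1 : 0 <= D / n%:R * t by rewrite mulr_ge0// ltW.
  have p2 : 0 <= H2 / n%:R * t ^+ 2 by rewrite mulr_ge0.
  have p3 : (D + H2) / n%:R * (t + t ^+ 2) <= d * (t + t ^+ 2).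
    by rewrite ler_wpM2r// addr_ge0// ltW.
  have p4 : 0 <= d * t ^+ 2 by rewrite mulr_ge0// ltW.
  by move: p3; rewrite !mulrDl; lra.
rewrite (_ : - lambda * t = - (lambda / 2) * t + - (lambda / 2 * t)); last by field.
rewrite expRD expRN le_eqVlt; apply/orP; left; apply/eqP.
by field; rewrite gt_eqF// expR_gt0.
Qed.

Lemma laplace_chernoff_cvg f w e : 0 < e -> in_graph f w ->
  exists2 N, (0 < N)%N & forall n, (N <= n)%N ->
    bounded_by e (fun x => I n (fun y => lambda * f y - w y) x - f x).
Proof.
move=> e0 fw; have [C0f C0w _] := fw.
pose g y := lambda * f y - w y.
have C0g : C0 g by exact/C0B/C0w/C0Z.
pose d := e / 3 * lambda.
have e3 : 0 < e / 3 by rewrite divr_gt0.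
have d0 : 0 < d by rewrite mulr_gt0.
have dl : d / lambda = e / 3 by rewrite /d mulfK// gt_eqF.
have [y [y1 [y2 [yy1 y1y2 yg]]]] := domain2_dense adm C0g d0.
have [C0y C0y1 _] := yy1.
have [h [h1 [hh1 hE]]] := resolvent_solvable adm lambda_gt0 C0y.
(* [h1 = lambda h - y] inherits the regularity of [h] and [y], so [L h1 = lambda h1 - y1]; repeating
   this puts [h] in the domain of [L^3]. *)
pose h2 x := lambda * h1 x - y1 x.
pose h3 x := lambda * h2 x - y2 x.
have h1h2 : in_graph h1 h2.
  rewrite (_ : h1 = (fun x => lambda * h x - y x)); last first.
    by apply/funext => x; rewrite -hE; ring.
  exact/in_graphB/yy1/in_graphZ.
have h2h3 : in_graph h2 h3 by exact/in_graphB/y1y2/in_graphZ.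
have [N N0 NP] := laplace_chernoff_cvg_smooth e3 hh1 h1h2 h2h3.
have yE : (fun x => lambda * h x - h1 x) = y by apply/funext => x; rewrite hE.
rewrite yE in NP.
exists N => // n Nn x.
have n0 : (0 < n)%N by exact: leq_trans Nn.
have fh : `|h x - f x| <= e / 3.
  rewrite -dl; apply: (resolvent_bound adm lambda_gt0 (in_graphB hh1 fw)) => z.
  have := yg z; rewrite /g -hE; congr (`|_| <= _); ring.
have [Y Y0 yY] := C0_bounded C0y; have [G G0 gG] := C0_bounded C0g.
have := laplace_chernoff_diff adm lambda_gt0 n0 (C0_measurable C0y) (C0_measurable C0g)
  yY gG yg x.
rewrite dl => H1; have H2 := NP _ Nn x.
rewrite -/g (_ : _ - f x = (I n y x - h x) + (h x - f x) - (I n y x - I n g x)); last by ring.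
rewrite (le_trans (ler_normB _ _))//.
have := ler_normD (I n y x - h x) (h x - f x).
by lra.
Qed.

End convergence.

(** * The n-fold integral as an iterated step *)

Section feynman.
Context {R : realType}.
Notation mu := (@lebesgue_measure R).
Implicit Types (a b c f g h : R -> R) (r s t x y omega lambda : R) (n : nat)
  (l : seq R) (K : R -> R -> R).

(** The recursion peels off the first point, as [iter_integral] does with its outermost variable. *)
Fixpoint path_product K g x l : R :=
  if l is y :: l' then K x y * path_product K g y l' else g x.

Lemma path_productE K g x l :
  \prod_(0 <= j < size l) K (x :: l)`_j l`_j * g (x :: l)`_(size l) =
  path_product K g x l.
Proof.
elim: l x => [|y l IH] x /=; first by rewrite big_geq// mul1r.
by rewrite big_nat_recl//= -mulrA IH.
Qed.

Lemma path_product_norm K g x l : (forall x y, 0 <= K x y) ->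
  `|path_product K g x l| = path_product K (fun x => `|g x|) x l.
Proof.
by move=> K0; elim: l x => //= y l IH x; rewrite normrM IH ger0_norm.
Qed.

Lemma iter_integral_eq n (F G : seq R -> \bar R) :
  (forall l, size l = n -> F l = G l) -> iter_integral n F = iter_integral n G.
Proof.
elim: n F G => [|n IH] F G FG /=; first exact: FG.
by apply: eq_integral => y _; apply: IH => l ln; apply: FG; rewrite /= ln.
Qed.

Lemma prod_powR n (f : nat -> R) r : (forall j, 0 <= f j) ->
  (\prod_(0 <= j < n) f j) `^ r = \prod_(0 <= j < n) f j `^ r.
Proof.
move=> f0; elim: n => [|n IH]; first by rewrite !big_geq// powR1.
by rewrite !big_nat_recr//= powRM ?IH// prodr_ge0.
Qed.

(** Completing the square: the [b^2] term, the linear term and the quadratic term combine to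
    [- (y - x - s b)^2 / (4 s a)]. The factor [e^(omega s)] accounts for replacing [c] by
    [c - omega]. *)
Lemma feynman_kernelE a b c omega s x y : 0 < s -> 0 < a x ->
  expR (s * (c x - b x ^+ 2 / (4 * a x))) * expR (b x * (y - x) / (2 * a x)) *
  (4 * pi * s) `^ (- 2^-1) * a x `^ (- 2^-1) *
  expR (- (4 * s)^-1 * ((x - y) ^+ 2 / a x)) =
  expR (omega * s) * (expR (s * (c x - omega)) * heat_kernel a b s x y).
Proof.
move=> s0 ax; rewrite /heat_kernel powR_inv1; last by rewrite !mulr_ge0// ltW.
rewrite (@powRM _ (4 * pi * s)); [|by rewrite !mulr_ge0 ?pi_ge0// ltW|exact: ltW].
rewrite (_ : expR (s * (c x - _)) * _ * _ * _ * _ =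
  (expR (s * (c x - b x ^+ 2 / (4 * a x))) * expR (b x * (y - x) / (2 * a x)) *
   expR (- (4 * s)^-1 * ((x - y) ^+ 2 / a x))) *
  ((4 * pi * s) `^ (- 2^-1) * a x `^ (- 2^-1))); last by ring.
rewrite (_ : expR (omega * s) * _ = (expR (omega * s) * expR (s * (c x - omega)) *
  expR (- ((y - x - b x * s) ^+ 2 * (4 * s * a x)^-1))) *
  ((4 * pi * s) `^ (- 2^-1) * a x `^ (- 2^-1))); last by ring.
rewrite -!expRD; congr (expR _ * _).
by field; rewrite !gt_eqF.
Qed.

Lemma feynman_integrandE a b c g omega n t x l : (0 < n)%N -> 0 < t ->
  (forall x, 0 < a x) -> size l = n ->
  feynman_integrand a b c g n t (x :: l) =
  expR (omega * t) * path_product (fun x y => expR (t / n%:R * (c x - omega)) *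
    heat_kernel a b (t / n%:R) x y) g x l.
Proof.
move=> n0 t0 a_gt0 ln; have n0' : 0 < n%:R :> R by rewrite ltr0n.
pose s := t / n%:R; have s0 : 0 < s by rewrite divr_gt0.
have sE : n%:R / (4 * t) = (4 * s)^-1.
  by rewrite /s; field; rewrite !gt_eqF.
rewrite -/s -path_productE ln mulrA; congr (_ * _).
rewrite [X in _ = X * _](_ : _ = \prod_(0 <= j < n) expR (omega * s)); last first.
  rewrite prodr_const_nat subn0 -[RHS]expRM_natl.
  by congr (expR _); rewrite /s; field; rewrite gt_eqF.
rewrite -big_split/=.
rewrite [RHS](eq_bigr (fun j =>
   expR (s * (c (x :: l)`_j - b (x :: l)`_j ^+ 2 / (4 * a (x :: l)`_j))) *
   expR (b (x :: l)`_j * (l`_j - (x :: l)`_j) / (2 * a (x :: l)`_j)) *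
  (4 * pi * s) `^ (- 2^-1) * a (x :: l)`_j `^ (- 2^-1) *
  expR (- (4 * s)^-1 * (((x :: l)`_j - l`_j) ^+ 2 / a (x :: l)`_j)))); last first.
  by move=> j _; rewrite (feynman_kernelE b c omega _ s0).
rewrite !big_split/= -!expR_sum -!mulr_sumr.
rewrite !big_add1/=; congr (_ * _ * _ * _ * _).
- by rewrite -big_split.
- rewrite prodr_const_nat subn0; congr (_ ^+ _).
  rewrite powRN powR12_sqrt; last by rewrite !mulr_ge0 ?pi_ge0// ltW.
  rewrite /s (_ : 4 * pi * (t / n%:R) = (4 * pi * t) * n%:R^-1); last by ring.
  rewrite [in RHS]sqrtrM; last by rewrite !mulr_ge0 ?pi_ge0// ltW.
  by rewrite sqrtrV// invfM invrK mulrC.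
- by rewrite prod_powR// => j; exact: ltW.
- by rewrite -sE.
Qed.

Variables (a b c : R -> R) (a0 A B C : R).
Hypothesis adm : admissible a b c a0 A B C.
Notation S := (chernoff_step a b c).

(** The scalar [r] is general because each integration leaves a kernel value of the outer variables
    in front of the inner integral. *)
Lemma iter_integral_path_product n s r g G x : 0 < s -> measurable_fun setT g ->
  bounded_by G g ->
  iter_integral n (fun l => (r * path_product
    (fun x y => expR (s * c x) * heat_kernel a b s x y) g x l)%:E) =
  (r * iter n (S s) g x)%:E.
Proof.
move=> s0 mg gG; elim: n r x => [//|n IH] r x /=.
pose v := iter n (S s) g.
have mv : measurable_fun setT v := measurable_chernoff_steps adm n s mg.
have bv : bounded_by G v := chernoff_steps_bound adm n s0 mg gG.
have iv := chernoff_step_integrable adm x s0 mv bv.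
transitivity (\int[mu]_y (r * expR (s * c x) * (heat_kernel a b s x y * v y))%:E)%E.
  apply: eq_integral => y _.
  rewrite -[RHS](_ : ((r * (expR (s * c x) * heat_kernel a b s x y)) * v y)%:E = _).
    by rewrite -IH; congr iter_integral; apply/funext => l; rewrite mulrA.
  by congr EFin; ring.
under eq_integral do rewrite EFinM.
rewrite integralZl// -[X in (_ * X)%E]fineK ?integrable_fin_num//.
by rewrite -EFinM mulrA.
Qed.

End feynman.

(** * From Hölder continuity to moduli *)

Section hoelder.
Context {R : realType}.
Implicit Types (f : R -> R) (x y : R).

(** By scaling, this is [u^beta <= 1 + u]. *)
Lemma powR_le_affine (beta d r : R) : 0 < beta <= 1 -> 0 < d -> 0 <= r ->
  r `^ beta <= d `^ beta * (1 + r / d).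
Proof.
move=> /andP[b0 b1] d0 r0; set u := r / d.
have u0 : 0 <= u by rewrite divr_ge0// ltW.
have -> : r = d * u by rewrite /u mulrC divfK// gt_eqF.
rewrite powRM ?(ltW d0)// ler_wpM2l ?powR_ge0//.
have [u1|u1] := leP u 1.
  rewrite (@le_trans _ _ (1 `^ beta))//; last by rewrite powR1 lerDl.
  by rewrite ge0_ler_powR// ?nnegrE// ltW.
rewrite (@le_trans _ _ (u `^ 1))//; last by rewrite powRr1// lerDr.
by rewrite ler_powR// ltW.
Qed.

Lemma hoelder_modulus beta f : 0 < beta <= 1 -> hoelder_continuous beta f ->
  modulus f.
Proof.
move=> b01 [K KP] e e0; have /andP[b0 b1] := b01.
pose K' := `|K| + 1.
have K'0 : 0 < K' by rewrite /K'; have : 0 <= `|K| by []; lra.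
(* The scale at which [K' d^beta = e]. *)
pose d := (e / K') `^ beta^-1.
have d0 : 0 < d by rewrite powR_gt0// divr_gt0.
have dE : d `^ beta = e / K'.
  by rewrite /d -powRrM mulVf ?gt_eqF// powRr1// divr_ge0// ltW.
exists (e / d) => [|x y]; first by rewrite divr_ge0// ltW.
apply: le_trans (KP x y) _.
apply: (@le_trans _ _ (K' * `|x - y| `^ beta)).
  by rewrite ler_wpM2r ?powR_ge0// /K'; have := ler_norm K; lra.
have := powR_le_affine b01 d0 (normr_ge0 (x - y)); rewrite dE => H.
apply: (@le_trans _ _ (K' * (e / K' * (1 + `|x - y| / d)))).
  by rewrite ler_wpM2l// ltW.
rewrite le_eqVlt; apply/orP; left; apply/eqP.
by field; rewrite !gt_eqF.
Qed.

Lemma bounded_fun_bound f : bounded_fun f -> exists B, bounded_by B f.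
Proof.
move=> [M [_ MP]]; exists (M + 1) => x; apply: (MP (M + 1)) => //.
by rewrite ltrDl.
Qed.

Lemma has_derivative_twice f : twice_differentiable f ->
  has_derivative f f^`() /\ has_derivative f^`() f^`(2)%classic.
Proof.
move=> [df ddf]; split; first exact: derivable_has_derivative.
exact: derivable_has_derivative.
Qed.

End hoelder.

(** * Reduction to nonpositive [c], well-posedness and uniform convergence *)

Theorem theorem5 (R : realType) (a b c g : R -> R) (lambda : R)
  (ha0 : exists2 a0 : R, 0 < a0 & forall x : R, a0 < a x)
  (hcoef : exists2 beta : R, 0 < beta <= 1 &
     [/\ bounded_hoelder beta c,
         bounded_hoelder2 beta a,
         bounded_hoelder2 beta (fun x => 1 / a x) &
         bounded_hoelder2 beta b])
  (hg : continuous g)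
  (hg0 : vanishes_at_infinity g)
  (hlambda : Num.max 0 (sup (range c)) < lambda) :
  exists f : R -> R,
    [/\ unique (fun h : R -> R =>
          [/\ continuous h, vanishes_at_infinity h &
              is_solution a b c g lambda h]) f,
        forall (n : nat) (x0 : R), (0 < n)%N ->
          chernoff_approximation_exists a b c g lambda n x0 &
        {uniform, chernoff_approximation a b c g lambda @ \oo --> f}].
Proof.
have [a0 a0_gt0 a_gt] := ha0.
have [beta b01 [[bdc hc] [_ [bda ha] _ _] _ [_ [bdb hb] _ _]]] := hcoef.
have [C cC] := bounded_fun_bound bdc.
have [A aA] := bounded_fun_bound bda.
have [B bB] := bounded_fun_bound bdb.
pose omega := sup (range c).
have c_le x : c x <= omega.
  apply: ub_le_sup; last by exists x.
  by exists C => _ [y _ <-]; exact: le_trans (ler_norm _) (cC y).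
have l0 : 0 < lambda - omega.
  by rewrite subr_gt0; move: hlambda; rewrite gt_max => /andP[].
pose c' x := c x - omega.
have adm : admissible a b c' a0 A B (C + `|omega|).
  split=> //.
  - by move=> x; exact: le_trans (ler_norm _) (aA x).
  - move=> x; have := cC x; have := ler_norm omega; rewrite /c' ler_norml.
    by move=> ? /andP[]; lra.
  - by move=> x; rewrite subr_le0.
  - exact: hoelder_modulus b01 ha.
  - exact: hoelder_modulus b01 hb.
  - move=> e e0; have [K K0 KP] := hoelder_modulus b01 hc e0.
    by exists K => // x y; rewrite /c' opprB addrA subrK.
have ax x : 0 < a x := lt_trans a0_gt0 (a_gt x).
have C0g : C0 g by [].
have mg := C0_measurable C0g.
have [G G0 gG] := C0_bounded C0g.
(* The shift of [c] leaves the n-fold integral as a factor [e^(omega t)], which replaces [lambda] by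
   [lambda - omega]. *)
have S_laplace n t x : (0 < n)%N -> 0 < t ->
    laplace_integrand a b c g lambda n x t =
    (expR (- (lambda - omega) * t) *
      iter n (chernoff_step a b c' (t / n%:R)) g x)%:E.
  move=> n0 t0; rewrite /laplace_integrand /feynman_integral.
  have s0 : 0 < t / n%:R by rewrite divr_gt0// ltr0n.
  rewrite (@iter_integral_eq _ n _ (fun l => (expR (omega * t) * path_product
     (fun x y => expR (t / n%:R * c' x) * heat_kernel a b (t / n%:R) x y) g x l)%:E)); last first.
    by move=> l ln; rewrite (@feynman_integrandE _ a b c g omega n t x l n0 t0 ax ln).
  rewrite (iter_integral_path_product adm n (expR (omega * t)) x s0 mg gG).
  by rewrite -EFinM mulrA -expRD; congr (expR _ * _)%:E; ring.
have approxE n x : (0 < n)%N ->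
    chernoff_approximation a b c g lambda n x =
    laplace_chernoff a b c' (lambda - omega) n g x.
  move=> n0; congr fine; apply: eq_integral => t.
  by rewrite inE /= in_itv/= andbT => t0; exact: S_laplace.
(* [L h] is in [C0] by the equation itself, so uniqueness in the graph covers solutions whose
   derivatives are not assumed to decay. *)
have solution_graph h : C0 h -> is_solution a b c g lambda h ->
    in_graph a b c' h (fun x => (lambda - omega) * h x - g x).
  move=> C0h [/has_derivative_twice[dp dq] e]; split=> //.
    exact/C0B/C0g/C0Z.
  exists h^`(), h^`(2)%classic; split=> // x.
  by have := e x; rewrite /c'; lra.
have [f [w [fw fE]]] := resolvent_solvable adm l0 C0g.
exists f; split.
- have [[cf f0] _ [p [q [dp dq we]]]] := fw.
  split.
    split=> //.
    have f1 : f^`() = p by apply/funext => x; exact: (has_derivativeP x dp).2.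
    have f2 : f^`(2)%classic = q.
      apply/funext => x.
      by rewrite (_ : f^`(2)%classic = f^`()^`())// f1; exact: (has_derivativeP x dq).2.
    split; first split.
    + by move=> x; exact: (has_derivativeP x dp).1.
    + by rewrite f1 => x; exact: (has_derivativeP x dq).1.
    + by move=> x; rewrite f2 f1; have := fE x; rewrite we /c'; lra.
  move=> h [ch h0 sh].
  have [] // := resolvent_inj adm l0 fw (solution_graph h (conj ch h0) sh).
  by move=> x; rewrite fE; ring.
- move=> n x n0; split.
    move=> t t0; rewrite /feynman_abs_integral.
    have s0 : 0 < t / n%:R by rewrite divr_gt0// ltr0n.
    have mng : measurable_fun setT (fun x => `|g x|) by exact: measurableT_comp.
    have ngG : bounded_by G (fun x => `|g x|) by move=> y; rewrite normr_id.
    (* The kernel is nonnegative, so the absolute value falls on [g] alone and the same iteration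
       applies to [|g|]. *)
    rewrite (@iter_integral_eq _ n _ (fun l => (expR (omega * t) * path_product
       (fun x y => expR (t / n%:R * c' x) * heat_kernel a b (t / n%:R) x y)
       (fun x => `|g x|) x l)%:E)); last first.
      move=> l ln; rewrite (@feynman_integrandE _ a b c g omega n t x l n0 t0 ax ln).
      rewrite normrM (ger0_norm (expR_ge0 _)) path_product_norm// => y z.
      by rewrite mulr_ge0 ?expR_ge0// mulr_ge0 ?powR_ge0 ?expR_ge0.
    by rewrite (iter_integral_path_product adm n _ x s0 mng ngG) ltry.
  have := laplace_chernoff_integrable adm l0 x n0 mg gG.
  apply: eq_integrable => // t; rewrite inE /= in_itv/= andbT => t0.
  by rewrite S_laplace.
- move=> P /uniform_nbhs[E [entE EP]].
  move: entE; rewrite -entourage_from_ballE => -[e /= e0 eE].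
  have e2 : 0 < e / 2 by rewrite divr_gt0.
  have [N N0 NP] := laplace_chernoff_cvg adm l0 e2 fw.
  exists N => // n /= Nn; apply: EP => x _; apply: eE => /=.
  have n0 : (0 < n)%N := leq_trans N0 Nn.
  rewrite /ball /= approxE// distrC.
  have := NP n Nn x.
  rewrite (_ : (fun y => (lambda - omega) * f y - w y) = g); last first.
    by apply/funext => y; exact: fE.
  by move=> /le_lt_trans; apply; lra.
Qed.
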